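(* Let $p\in\mathbb{N}=\{0,1,2,\dots\}$. Let $q$ be a sub-critical offspring distribution ($\mu<1$) with generating function $f$, and suppose that there exists a unique $\kappa>1$ such that $f(\kappa)=\kappa$ and $f^{(p\vee 1)}(\kappa)<+\infty$. Then for every $n\in\mathbb{N}$ and every $\Lambda_n\in\mathscr{F}_n$: (1) For every $s\in[0,\kappa)$, $$\lim_{m\to+\infty}\frac{\mathbb{E}\left[H_p(Z_{m+n})s^{Z_{m+n}}\mathbf{1}_{\Lambda_n}\right]}{\mathbb{E}\left[H_p(Z_{m+n})s^{Z_{m+n}}\right]}=\begin{cases}\mathbb{E}[\mathbf{1}_{\Lambda_n}] & \text{if }p=0,\\ \mathbb{E}\left[\frac{Z_n}{\mu^n}\mathbf{1}_{\Lambda_n}\right] & \text{if }p\ge 1.\end{cases}$$ (2) For every $a\ge 0$, $$\lim_{m\to+\infty}\frac{\mathbb{E}\left[H_p(Z_{m+n})\kappa^{Z_{m+n}}e^{-aZ_{m+n}/f'(\kappa)^{m+n}}\mathbf{1}_{\Lambda_n}\right]}{\mathbb{E}\left[H_p(Z_{m+n})\kappa^{Z_{m+n}}e^{-aZ_{m+n}/f'(\kappa)^{m+n}}\right]}=\mathbb{E}\left[\bar M_n^{(p)}\mathbf{1}_{\Lambda_n}\right],\qquad \bar M_n^{(p)}=\frac{1}{f'(\kappa)^{pn}}\kappa^{Z_n-1}\bar G_{n,0}^{(p)}(Z_n).$$ Moreover, for every $n_0\ge 0$, the probability measure $\mathbb{Q}_{n_0}^{(p)}$ on trees defined by $$\frac{d\mathbb{Q}_{n_0}^{(p)}}{d\mathbb{P}_{n_0}}\Big|_{\mathscr{F}_n}=\bar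 M_{n,n_0}^{(p)}:=\frac{1}{f'(\kappa)^{p(n-n_0)}}\kappa^{Z_n-1}\bar G_{n,n_0}^{(p)}(Z_n)\qquad (n\ge n_0)$$ is the probability measure $\bar{\mathbf{Q}}_{n_0}^{(p)}$ (the law of the multi-type Galton-Watson tree built from $\bar q$, defined in the context).
   Context: **Trees.** $\mathscr{U}=\bigcup_{n\ge0}(\mathbb{N}^* )^n$ is the set of finite words of positive integers, with $(\mathbb{N}^* )^0=\{\partial\}$ and $|u|$ the length of $u$; for $u\neq\partial$, $\bar u$ is $u$ with its last letter removed. A tree $\mathbf{t}$ rooted at $u\in\mathscr{U}$ is a subset of $\mathscr{U}$ such that $u\in\mathbf{t}$; $|v|<|u|$ implies $v\notin\mathbf{t}$; $v\in\mathbf{t}\setminus\{u\}$ implies $\bar v\in\mathbf{t}$; and for all $v\in\mathbf{t}$ there is $k_v(\mathbf{t})\in\mathbb{N}$ with $vi\in\mathbf{t}\iff i\le k_v(\mathbf{t})$ for all $i\in\mathbb{N}^*$. Let $\mathbf{1}_n=(1,\dots,1)\in(\mathbb{N}^* )^n$ ($\mathbf{1}_0=\partial$), $r_n(\mathbf{t})=\{u\in\mathbf{t}:|u|\le n\}$, $z_n(\mathbf{t})=\mathrm{Card}\{u\in\mathbf{t}:|u|=n\}$. **Galton-Watson trees.** $q=(q_n)_{n\in\mathbb{N}}$ is a probability on $\mathbb{N}$ with mean $\mu$ and generating function $f(s)=\sum_nq_ns^n$. Under $\mathbb{P}_k$, $\tau$ is the Galton-Watson tree with offspring distribution $q$ rooted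 at $\mathbf{1}_k$: for $h>k$ and every tree $\mathbf{t}$ rooted at $\mathbf{1}_k$ of height at most $h$, $\mathbb{P}_k(r_h(\tau)=\mathbf{t})=\prod_{u\in r_{h-1}(\mathbf{t})}q_{k_u(\mathbf{t})}$. $\mathbb{P}=\mathbb{P}_0$ (with expectation $\mathbb{E}$), $Z_n=z_n(\tau)$ (so $Z_0=1$ under $\mathbb{P}$); $\mathscr{F}_n$ is the $\sigma$-field generated by $r_n(\tau)$. Convention: $0^0=1$. **Objects attached to $\bar q$.** $\bar f(t)=f(\kappa t)/\kappa$, $t\in[0,1]$, is the generating function of the super-critical offspring distribution $\bar q_n=\kappa^{n-1}q_n$, whose mean is $\bar\mu=f'(\kappa)>1$. Let $\bar Z$ be the Galton-Watson process with offspring distribution $\bar q$ started from one individual, $\bar W$ the a.s. limit of $\bar Z_n/\bar\mu^n$, and $\bar\phi(b)=\mathbb{E}[e^{-b\bar W}]$, $b\ge0$, with derivatives $\bar\phi^{(k)}$ (one-sided at $0$), $\bar\phi^{(0)}=\bar\phi$. Let $H_0(x)=1$, $H_k(x)=\frac1{k!}\prod_{j=0}^{k-1}(x-j)$ for $k\ge1$; $S_{i,p}=\{(n_1,\dots,n_i)\in(\mathbb{N}^* )^i:\ n_1+\cdots+n_i=p\}$; $\bar a_i^{(p)}(n)=\sum_{(n_1,\ldots,n_i)\in S_{i,p}}\prod_{r=1}^i\frac{\bar\phi^{(n_r)}(a/\bar\mu^n)}{n_r!}$. For $n\ge n_0\ge0$, $$\bar G_{n,n_0}^{(0)}(x)=\frac{\bar\phi(a/\bar\mu^n)^x}{\bar\phi(a/\bar\mu^{n_0})},\qquad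 \bar G_{n,n_0}^{(p)}(x)=\frac{p!}{\bar\phi^{(p)}(a/\bar\mu^{n_0})}\sum_{i=1}^p\bar a_i^{(p)}(n)H_i(x)\bar\phi(a/\bar\mu^n)^{x-i}\quad(p\ge1).$$ **The measure $\bar{\mathbf{Q}}_{n_0}^{(p)}$.** Under it, $\tau$ is (the tree, types forgotten, of) an inhomogeneous multi-type Galton-Watson tree with types in $\{0,\dots,p\}$ such that: the root is $\mathbf{1}_{n_0}$ (height $n_0$) and has type $p$; a node of type $\ell$ at height $n$ gives, independently of the other nodes, $k$ offspring with respective types $(\ell_1,\dots,\ell_k)\in\mathbb{N}^k$ satisfying $\ell_1+\cdots+\ell_k=\ell$ with probability $$\bar q_k\,\frac{1}{\bar\mu^\ell}\,\frac{\ell!}{\bar\phi^{(\ell)}(a/\bar\mu^n)}\prod_{j=1}^k\frac{\bar\phi^{(\ell_j)}(a/\bar\mu^{n+1})}{\ell_j!}.$$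
   Formalization: In (1), s=0 is excluded when p≥1, where numerator and denominator both vanish (0/0). In (2) and the last claim, for p=1 it is assumed that W̄ is not a.s. 0, since otherwise φ̄'=0 and both M̄ and the multi-type offspring law are 0/0. *)

(* Defs.v *)
From HB Require Import structures.
From mathcomp Require Import all_boot all_order all_algebra finmap.
From mathcomp Require Import all_classical all_reals all_analysis.
Set Implicit Arguments.
Unset Strict Implicit.
Unset Printing Implicit Defensive.
Import Order.TTheory GRing.Theory Num.Theory.
Import numFieldNormedType.Exports.
Local Open Scope classical_set_scope.
Local Open Scope ring_scope.

(** Finite words of positive integers are sequences [u : seq nat] satisfying
    [is_word]; the empty word is [[::]], the length is [size]. *)

Definition is_word (u : seq nat) : bool := all (fun i => 0 < i)%N u.

Definition ones (n : nat) : seq nat := nseq n 1%N.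

(* last letter removed; only meaningful for nonempty words *)
Definition parent (u : seq nat) : seq nat := take (size u).-1 u.

Definition is_tree (u : seq nat) (t : set (seq nat)) : Prop :=
  [/\ t `<=` [set v | is_word v],
      t u,
      (forall v, (size v < size u)%N -> ~ t v),
      (forall v, t v -> v <> u -> t (parent v)) &
      (forall v, t v -> exists k : nat,
         forall i, (0 < i)%N -> (t (rcons v i) <-> (i <= k)%N))].

Record tree := Tree {
  nodes : set (seq nat);
  _ : exists u, is_tree u nodes }.

Definition nchild (t : set (seq nat)) (v : seq nat) : nat :=
  xget 0%N [set k | forall i, (0 < i)%N -> (t (rcons v i) <-> (i <= k)%N)].

Definition restr (n : nat) (t : set (seq nat)) : set (seq nat) :=
  [set u | t u /\ (size u <= n)%N].

Definition height_le (h : nat) (t : set (seq nat)) : Prop :=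
  forall u, t u -> (size u <= h)%N.

(* The set below is finite when [t] comes from a tree. *)
Definition zcard (n : nat) (t : tree) : nat :=
  #|` fset_set [set u | nodes t u /\ size u = n] |%fset.

Lemma is_tree_root : is_tree [::] [set [::]].
Proof.
split=> //.
- by move=> v /= ->.
- by move=> v /= ->; exists 0%N => i i0; split=> //; case: i i0.
Qed.

Definition root_tree : tree := Tree (ex_intro _ [::] is_tree_root).

HB.instance Definition _ := gen_eqMixin tree.
HB.instance Definition _ := gen_choiceMixin tree.
HB.instance Definition _ := isPointed.Build tree root_tree.

(* The values of [r_n] on trees form a countable set, so that the sigma-field
   generated by [r_n] is the one generated by its fibres. *)
Definition cyl (n : nat) (A : set (seq nat)) : set tree :=
  [set t | restr n (nodes t) = A].

Definition filt (n : nat) : set (set tree) := <<s range (cyl n) >>.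

Definition cyls : set (set tree) := \bigcup_n range (cyl n).

HB.instance Definition _ := Measurable.copy tree (g_sigma_algebraType cyls).

(** Trees whose nodes carry a type in [{0, ..., p}].  The values of [ttype]
    outside the nodes of [skel] are junk; the sigma-field ignores them. *)

Record typed_tree (p : nat) := TypedTree {
  skel : tree;
  ttype : seq nat -> 'I_p.+1 }.

HB.instance Definition _ p := gen_eqMixin (typed_tree p).
HB.instance Definition _ p := gen_choiceMixin (typed_tree p).
HB.instance Definition _ p :=
  isPointed.Build (typed_tree p) (TypedTree root_tree (fun=> ord0)).

Definition tcyl (p h : nat) (x : typed_tree p) : set (typed_tree p) :=
  [set y | restr h (nodes (skel y)) = restr h (nodes (skel x)) /\
     forall u, restr h (nodes (skel x)) u -> ttype y u = ttype x u].

Definition tcyls (p : nat) : set (set (typed_tree p)) :=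
  \bigcup_h range (@tcyl p h).

HB.instance Definition _ p :=
  Measurable.copy (typed_tree p) (g_sigma_algebraType (@tcyls p)).

Section offspring.
Variable R : realType.
Implicit Types q : nat -> R.

Definition is_offspring q : Prop :=
  (forall n, 0 <= q n) /\ (\sum_(0 <= n <oo) (q n)%:E)%E = 1%E.

Definition mean q : \bar R := (\sum_(0 <= n <oo) (n%:R * q n)%:E)%E.

(* [k]-th derivative at [s >= 0] of the generating function of [q] (the
   generating function itself for [k = 0]), as an extended real: at the radius
   of convergence this is the one-sided derivative, possibly [+oo]. *)
Definition gfD q (k : nat) (s : R) : \bar R :=
  (\sum_(0 <= n <oo) (q n * (n ^_ k)%:R * s ^+ (n - k))%:E)%E.

Definition tilt q (kappa : R) : nat -> R :=
  fun n => kappa ^ (n%:Z - 1) * q n.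

Definition is_GW q (k : nat) (P : probability tree R) : Prop :=
  forall (h : nat) (t : tree), (k < h)%N ->
    is_tree (ones k) (nodes t) -> height_le h (nodes t) ->
    P (cyl h (nodes t)) =
      (\big[*%R/1]_(u \in restr h.-1 (nodes t)) q (nchild (nodes t) u))%:E.

End offspring.

Section objects.
Variable R : realType.

Definition Hpoly (k : nat) (x : R) : R :=
  (k`!)%:R^-1 * \prod_(j < k) (x - j%:R).

Definition laplace (P : probability tree R) (W : tree -> R) (b : R) : R :=
  fine ('E_P[fun t => expR (- (b * W t))])%E.

(* derivative of a function on [[0, +oo[], one-sided at [0] *)
Definition deriv_nneg (f : R -> R) (x : R) : R :=
  lim ((f y - f x) / (y - x) @[y --> within [set y | 0 <= y] x^']).

Definition derivn_nneg (k : nat) (f : R -> R) : R -> R := iter k deriv_nneg f.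

Variables (phi : R -> R) (mubar a : R).

Let phiD (k n : nat) : R := derivn_nneg k phi (a / mubar ^+ n).

Definition abar (p i n : nat) : R :=
  \sum_(c : {ffun 'I_i -> 'I_p.+1} |
      [forall r, (0 < c r)%N] && ((\sum_r (c r : nat))%N == p))
    \prod_r (phiD (c r) n / ((c r)`!)%:R).

Definition Gbar (p n n0 x : nat) : R :=
  if p is 0 then phiD 0 n ^+ x / phiD 0 n0
  else (p`!)%:R / phiD p n0 *
    \sum_(1 <= i < p.+1)
      abar p i n * Hpoly i x%:R * phiD 0 n ^ (x%:Z - i%:Z).

(* For [n0 = 0] and [mubar = f'(kappa)] this is the process [Mbar_n^(p)]. *)
Definition Mbar (kappa : R) (p n n0 : nat) (t : tree) : R :=
  (mubar ^+ (p * (n - n0)))^-1 * kappa ^ ((zcard n t)%:Z - 1) *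
  Gbar p n n0 (zcard n t).

(* probability that a node of type [l] at height [n] has [size c] children,
   of respective types [c] *)
Definition mt_weight (qbar : nat -> R) (n l : nat) (c : seq nat) : R :=
  if sumn c == l then
    qbar (size c) * (mubar ^+ l)^-1 * ((l`!)%:R / phiD l n) *
    \prod_(j <- c) (phiD j n.+1 / (j`!)%:R)
  else 0.

Definition child_types (p : nat) (x : typed_tree p) (u : seq nat) : seq nat :=
  [seq (ttype x (rcons u i) : nat) | i <- iota 1 (nchild (nodes (skel x)) u)].

Definition is_typed_GW (qbar : nat -> R) (p n0 : nat)
    (Q : probability (typed_tree p) R) : Prop :=
  forall (h : nat) (x : typed_tree p), (n0 < h)%N ->
    is_tree (ones n0) (nodes (skel x)) -> height_le h (nodes (skel x)) ->
    Q (tcyl h x) =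
      (((ttype x (ones n0) : nat) == p)%:R *
       \big[*%R/1]_(u \in restr h.-1 (nodes (skel x)))
          mt_weight qbar (size u) (ttype x u) (child_types x u))%:E.

Definition is_Qbar (qbar : nat -> R) (p n0 : nat)
    (Q : probability tree R) : Prop :=
  exists Qt : probability (typed_tree p) R,
    is_typed_GW qbar n0 Qt /\
    forall A : set tree, measurable A -> Q A = Qt (@skel p @^-1` A).

End objects.

Definition has_density (R : realType) (n0 : nat) (P Q : probability tree R)
    (M : nat -> tree -> R) : Prop :=
  forall n (L : set tree), (n0 <= n)%N -> filt n L ->
    Q L = ('E_P[fun t => (M n t * \1_L t)%R])%E.

(* Main.v *)
Require Import Defs.
From mathcomp Require Import all_boot all_order all_algebra finmap.
From mathcomp Require Import all_classical all_reals all_analysis.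
From mathcomp Require Import measurable_realfun.
From mathcomp Require Import zify ring lra.
Set Implicit Arguments.
Unset Strict Implicit.
Unset Printing Implicit Defensive.
Import Order.TTheory GRing.Theory Num.Theory.
Import numFieldNormedType.Exports.
Local Open Scope classical_set_scope.
Local Open Scope ring_scope.


(** The quantities in both limits are coefficients of polynomials. If [A] is
    a polynomial, think of its coefficients as binomial moments attached to one
    individual; then [A ^+ z] collects those of [z] independent individuals,
    and averaging over one generation replaces [A] by the truncated composition
    of the offspring generating function [f] with [A], its [jet]. Since
    [H_p(z) s ^ z] is the coefficient of degree [p] of [(s + s X) ^ z], the
    Markov property ([markov]) rewrites the expectation of a binomial moment of
    generation [m + n] on an event of the filtration at time [n] as the
    expectation of [(A_m ^+ Z_n)`_p], where [A_m] is the [m]-th iterate of [jet]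
    on that linear polynomial. All the asymptotics take place in the iterates
    [A_m], the passage to the limit under the expectation being dominated.

    Below [kappa], the constant coefficient of [A_m] tends to [1] and all the
    others are of exact order [mu ^ m] ([moment_coef_le], [moment_coef_ge]):
    this follows from the convexity of [f], whose slope from [1] is below [1] on
    the interval from [1] to [kappa]. Expanding [A_m ^+ Z_n], only the term
    linear in the higher coefficients matters, and it has the factor [Z_n];
    for [p = 0] the limit of the constant coefficient is all there is.

    At [kappa], the relation [f (kappa x) = kappa * fbar x] ([jet_tilt]) trades
    the weight [kappa ^ Z] for the super-critical law [qbar]. The binomial
    moments of its process, damped by [exp (- b Z_m / mubar ^ m)] and normalised
    by [mubar ^ (j m)], converge to [w_j(b) = E[Wbar ^ j exp (- b Wbar)] / j!].
    For [b > 0] this is dominated convergence ([Vp_cvg_w]). For [b = 0] the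
    recursion obtained by branching at the first generation is a contraction
    ([Vp0_cvg]), which gives convergence to the moments of [Wbar] up to a
    scaling that disappears in the quotient ([Vp_cvg]). The numbers [w_j(b)] are
    up to sign the derivatives of the Laplace transform of [Wbar] divided by
    [j!] ([derivn_laplace]), and so the limit [(w ^+ Z_n)`_p] is the
    function [Gbar] ([GbarE]). That [w_j] does not vanish for [j >= 1] is
    the nondegeneracy of [Wbar], proved from the second moment if [p >= 2].

    Passing to the limit in the branching recursion gives the functional
    equation [mubar ^ l * w_l(mubar b) = (fbar (sum_j w_j(b) X ^ j))_l]
    ([w_step]). It says precisely that the weights of the multi-type tree sum to
    [1] ([typew_sum]). This tree is constructed by reading from one uniform
    point a sequence of independent choices of children, one for each word and
    type ([draws_joint], [sprout]). Along a finite tree the weights telescope,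
    and summing over the types of the last generation gives [(w ^+ Z_n)`_p] once
    more ([skel_cyl_law]): the law of the tree without types has the announced
    density on every cylinder. A law on trees is determined by its
    restrictions to the filtration ([has_density_unique]). *)

(** * Nodes of a tree, generation by generation *)

Definition children (A : set (seq nat)) (u : seq nat) : seq (seq nat) :=
  [seq rcons u i | i <- iota 1 (nchild A u)].

(** Lists rather than sets, so that a product or a sum over a generation
    splits along the families of the previous one, with [big_flatten]. *)
Fixpoint gen (A : set (seq nat)) (r : seq nat) (d : nat) : seq (seq nat) :=
  if d is d'.+1 then flatten [seq children A u | u <- gen A r d'] else [:: r].

Lemma genS A r d : gen A r d.+1 = flatten [seq children A u | u <- gen A r d].
Proof. by []. Qed.

Lemma parent_rcons u i : parent (rcons u i) = u.
Proof. by rewrite /parent size_rcons/= -cats1 take_cat ltnn subnn take0 cats0. Qed.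

Lemma size_gen A r d v : v \in gen A r d -> size v = (size r + d)%N.
Proof.
elim: d v => [|d IH] v; first by rewrite inE => /eqP->; rewrite addn0.
move=> /flattenP[s /mapP[u ug ->] /mapP[i _ ->]].
by rewrite size_rcons IH// addnS.
Qed.

Lemma nchildP r A v i : is_tree r A -> A v -> (0 < i)%N ->
  A (rcons v i) <-> (i <= nchild A v)%N.
Proof.
move=> [_ _ _ _ H] Av; rewrite /nchild; move: i.
exact: (@xgetPex _ 0%N [set k | forall i, (0 < i)%N ->
  (A (rcons v i) <-> (i <= k)%N)]) (H v Av).
Qed.

Lemma nchild_uniq A v k :
  (forall i, (0 < i)%N -> (A (rcons v i) <-> (i <= k)%N)) -> nchild A v = k.
Proof.
move=> H; apply: xget_unique => // k' H'; apply/eqP; rewrite eqn_leq.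
apply/andP; split.
- by case: k' H' => // k' H'; apply/(H _ _)/(H' k'.+1).
- by case: k H => // k H; apply/(H' _ _)/(H k.+1).
Qed.

Lemma mem_children r A u i : is_tree r A -> A u -> (0 < i)%N ->
  (rcons u i \in children A u) = `[< A (rcons u i) >].
Proof.
move=> tA Au i0; rewrite mem_map; last by move=> x y /rcons_inj [].
by rewrite mem_iota i0 add1n ltnS /=; apply/idP/asboolP => /(nchildP tA Au i0).
Qed.

Lemma is_tree_pos r A u i : is_tree r A -> A (rcons u i) -> (0 < i)%N.
Proof. by case=> + _ _ _ _ => /[apply] /=; rewrite /is_word all_rcons => /andP[]. Qed.

Lemma size_root_eq r A v : is_tree r A -> A v -> size v = size r -> v = r.
Proof.
move=> [_ Ar Hs Hp _] Av svr; apply: contrapT => vr.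
case: (ltnP 0 (size v)) => [v0|]; last first.
  rewrite leqn0 => /eqP sv; apply: vr; move: svr; rewrite sv.
  by move: sv => /size0nil -> /esym/size0nil ->.
apply: (Hs (parent v)); last exact: Hp.
by rewrite /parent size_take_min -svr; lia.
Qed.

Lemma mem_gen r A d v : is_tree r A ->
  (v \in gen A r d) <-> A v /\ size v = (size r + d)%N.
Proof.
move=> tA; elim: d v => [|d IH] v.
  rewrite /= inE addn0; split => [/eqP -> |[Av]].
    by case: tA.
  by move=> /(size_root_eq tA Av) ->.
split=> [vg|[Av sv]].
  split; last exact: size_gen vg.
  move: vg => /flattenP[s /mapP[u /IH[Au su] ->] /mapP[i ii ->]].
  have i0 : (0 < i)%N by move: ii; rewrite mem_iota => /andP[].
  by apply/asboolP; rewrite -(mem_children tA Au i0) map_f.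
case/lastP: v Av sv => [|u i] Av sv; first by move: sv; rewrite addnS.
have su : size u = (size r + d)%N by move: sv; rewrite size_rcons addnS => -[].
have Au : A u.
  case: tA => _ _ _ /(_ (rcons u i) Av); rewrite parent_rcons => H _; apply: H.
  by move=> /(congr1 size); rewrite sv; lia.
apply/flattenP; exists (children A u); first by apply/map_f/IH.
by rewrite (mem_children tA Au (is_tree_pos tA Av)); apply/asboolP.
Qed.

Lemma mem_gen_in r A d u : is_tree r A -> u \in gen A r d -> A u.
Proof. by move=> tA /(mem_gen _ _ tA)[]. Qed.

Lemma uniq_children A u : uniq (children A u).
Proof. by rewrite map_inj_uniq ?iota_uniq// => x y /rcons_inj []. Qed.

Lemma uniq_gen A r d : uniq (gen A r d).
Proof.
elim: d => //= d; elim: (gen A r d) => //= u s IH /andP[us /IH sU].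
rewrite cat_uniq uniq_children sU andbT /=; apply/hasPn => v.
move=> /flattenP[_ /mapP[w ws ->] /mapP[i _ ->]]; apply/negP => /mapP[j _].
by move=> /rcons_inj [wu _]; move: us; rewrite -wu ws.
Qed.

Lemma restrE n A u : (size u <= n)%N -> restr n A u = A u.
Proof. by move=> un; apply/propext; split => [[]//|]. Qed.

Lemma restrK m n A : (m <= n)%N -> restr m (restr n A) = restr m A.
Proof.
move=> mn; apply/seteqP; split => u [].
  by move=> [Au _] um; split.
by move=> Au um; split => //; split => //; apply: leq_trans mn.
Qed.

Lemma restr_restr_eq m n A B : (m <= n)%N -> restr n A = restr n B ->
  restr m A = restr m B.
Proof. by move=> mn AB; rewrite -(restrK A mn) AB restrK. Qed.

Lemma restr_id n A : height_le n A -> restr n A = A.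
Proof. by move=> An; apply/seteqP; split => [u []//|u Au]; split => //; exact: An. Qed.

Lemma height_restr n A : height_le n (restr n A).
Proof. by move=> u []. Qed.

Lemma nchild_restr n A B u : restr n A = restr n B -> (size u < n)%N ->
  nchild A u = nchild B u.
Proof.
move=> AB un; rewrite /nchild; congr (xget _ _); apply/funext => k.
have H i : A (rcons u i) = B (rcons u i).
  by rewrite -(@restrE n A) ?AB ?restrE// size_rcons.
by apply/propext; split => + i i0 => /(_ i i0); rewrite H.
Qed.

Lemma gen_restr n A B r d : restr n A = restr n B -> (size r + d <= n)%N ->
  gen A r d = gen B r d.
Proof.
move=> AB; elim: d => //= d IH dn; rewrite -IH; last by rewrite addnS in dn; lia.
congr flatten; apply/eq_in_map => u /size_gen su.
by rewrite /children (nchild_restr AB)// su; rewrite addnS in dn; lia.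
Qed.

Lemma is_tree_restr r A n : is_tree r A -> (size r <= n)%N -> is_tree r (restr n A).
Proof.
move=> tA rn; case: (tA) => Aw Ar As Ap Ac; split.
- by move=> v [/Aw].
- by split.
- by move=> v /As Av [].
- move=> v [Av vn] vr; split; first exact: Ap.
  by rewrite /parent size_take_min; lia.
- move=> v [Av]; rewrite leq_eqVlt => /predU1P[vn|vn].
    by exists 0%N => i i0; split=> [[]|]; rewrite ?size_rcons; lia.
  exists (nchild A v) => i i0; rewrite restrE ?size_rcons//.
  exact: (nchildP tA).
Qed.

Lemma treeP (t : tree) : exists u, is_tree u (nodes t).
Proof. by case: t. Qed.

(** The root of a tree has minimal length, hence survives every nonempty
    truncation. *)
Lemma is_tree_of_restr r n t : is_tree r (restr n (nodes t)) -> is_tree r (nodes t).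
Proof.
move=> tA; have [u tu] := treeP t.
have [rt rn] : restr n (nodes t) r by case: tA.
suff -> : r = u by [].
apply: (size_root_eq tu) => //; apply/eqP; rewrite eqn_leq; apply/andP; split.
- rewrite leqNgt; apply/negP => ur; case: tA => _ _ /(_ u ur) H _ _; apply: H.
  by split; [case: tu | lia].
- by rewrite leqNgt; apply/negP; case: tu => _ _ + _ _ => /[apply]; apply.
Qed.

Lemma finite_level r A n : is_tree r A -> finite_set [set u | A u /\ size u = n].
Proof.
move=> tA; case: (leqP (size r) n) => rn; last first.
  rewrite (_ : [set _ | _] = set0)//; apply/seteqP; split => // u [Au un].
  by case: tA => _ _ /(_ u) H _ _; apply: H Au; rewrite un.
apply/finite_seqP; exists (gen A r (n - size r)); apply/seteqP; split => u /=.
  by move=> [Au un]; apply/(mem_gen _ _ tA); rewrite subnKC.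
by move=> /(mem_gen _ _ tA); rewrite subnKC.
Qed.

Lemma zcard_gen r t d : is_tree r (nodes t) ->
  zcard (size r + d) t = size (gen (nodes t) r d).
Proof.
move=> tA; rewrite /zcard; apply/perm_size/uniq_perm; rewrite ?uniq_gen//.
move=> u; rewrite in_fset_set; last exact: finite_level tA.
by apply/idP/idP; rewrite inE /=; move=> /(mem_gen _ _ tA).
Qed.

Lemma zcard_restr m n t t' : (m <= n)%N ->
  restr n (nodes t) = restr n (nodes t') -> zcard m t = zcard m t'.
Proof.
move=> mn tt'; rewrite /zcard; congr (#|` fset_set _|%fset); apply/seteqP.
have H u : size u = m -> nodes t u = nodes t' u.
  by move=> um; rewrite -(@restrE n) ?tt' ?restrE// um.
by split => u [] /= + um; rewrite H.
Qed.

Lemma finite_restr r A n : is_tree r A -> finite_set (restr n A).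
Proof.
move=> tA; rewrite (_ : restr n A = \bigcup_(m in `I_n.+1) [set u | A u /\ size u = m]).
  by apply: bigcup_finite => // m _; exact: finite_level tA.
by apply/seteqP; split => u; [move=> [Au un]; exists (size u) | move=> [m /= mn [Au um]]; split => //; rewrite um].
Qed.

(** A tree of height [n.+1] is a graft on its truncation at height [n], with
    [c] the offspring numbers of generation [n]. Fixing the truncation and
    letting [c] vary describes one reproduction step. *)
Definition graft (A : set (seq nat)) (n : nat) (c : seq nat -> nat) :=
  A `|` [set v | exists u i, [/\ v = rcons u i, A u, size u = n & (0 < i <= c u)%N]].

Lemma is_tree_graft r A n c : is_tree r A -> (size r <= n)%N -> height_le n A ->
  is_tree r (graft A n c).
Proof.
move=> tA rn An; case: (tA) => Aw Ar As Ap Ac; split.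
- move=> v [/Aw//|[u [i [-> Au un /andP[i0 ic]]]]] /=.
  by rewrite /is_word all_rcons i0; exact: Aw.
- by left.
- move=> v vr [/(As _ vr)//|[u [i [vE Au un _]]]].
  by move: vr; rewrite vE size_rcons; lia.
- move=> v [Av vr|[u [i [-> Au un _]] _]]; first by left; exact: Ap.
  by rewrite parent_rcons; left.
- move=> v [Av|[u [i [-> Au un _]]]].
  + case: (ltnP (size v) n) => vn.
      exists (nchild A v) => i i0; split.
        move=> [/(nchildP tA Av i0)//|[u [j [/rcons_inj [<- _]]]] Aw' vn'].
        by move: vn; rewrite vn' ltnn.
      by move=> /(nchildP tA Av i0); left.
    have {}vn : size v = n by apply/eqP; rewrite eqn_leq vn An.
    exists (c v) => i i0; split.
      move=> [Avi|[u [j [/rcons_inj [<- <-]]]] _ _ /andP[]//].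
      by have := An _ Avi; rewrite size_rcons vn ltnn.
    by move=> ic; right; exists v, i; split => //; rewrite i0.
  + exists 0%N => j j0; split; last by case: j j0.
    move=> [|[w [k [/rcons_inj [<- _]]]] /An].
      by move=> /An; rewrite !size_rcons un; lia.
    by rewrite size_rcons un; lia.
Qed.

Lemma restr_graft A n c : height_le n A -> restr n (graft A n c) = A.
Proof.
move=> An; apply/seteqP; split => u.
  move=> [[//|[w [i [-> _ wn _]]]]]; rewrite size_rcons wn; lia.
by move=> Au; split; [left | exact: An].
Qed.

Lemma height_graft A n c : height_le n A -> height_le n.+1 (graft A n c).
Proof.
move=> An u [/An un|[w [i [-> _ wn _]]]]; first exact: ltnW.
by rewrite size_rcons wn.
Qed.

Lemma nchild_graft A n c u : height_le n A -> A u -> size u = n ->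
  nchild (graft A n c) u = c u.
Proof.
move=> An Au un; apply: nchild_uniq => i i0; split.
  move=> [Avi|[w [j [/rcons_inj [<- <-]]]] _ _ /andP[]//].
  by have := An _ Avi; rewrite size_rcons un ltnn.
by move=> ic; right; exists u, i; split => //; rewrite i0.
Qed.

Lemma graft_nchild r t n : is_tree r (nodes t) -> (size r <= n)%N ->
  restr n.+1 (nodes t) = graft (restr n (nodes t)) n (nchild (nodes t)).
Proof.
move=> tt rn; apply/seteqP; split => u.
  move=> [tu]; rewrite leq_eqVlt ltnS => /predU1P[un|un]; last by left.
  case/lastP: u tu un => [//|u i] tui; rewrite size_rcons => -[un].
  have ti := is_tree_pos tt tui.
  have tu : nodes t u.
    case: tt => _ _ _ /(_ _ tui); rewrite parent_rcons => H _; apply: H.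
    by move=> ur; move: rn; rewrite -ur size_rcons un ltnn.
  right; exists u, i; split => //; first by split => //; rewrite un.
  by rewrite ti; apply/(nchildP tt).
move=> [[tu un]|[w [i [-> [tw wn'] wn /andP[i0 ic]]]]].
  by split => //; exact: ltnW.
by split; [exact/(nchildP tt) | rewrite size_rcons wn].
Qed.

Lemma eq_graft A n c c' : (forall u, A u -> size u = n -> c u = c' u) ->
  graft A n c = graft A n c'.
Proof.
by move=> cc'; apply/seteqP; split => v [Av|[u [i [-> Au un ic]]]];
  (try by left); right; exists u, i; split => //; move: ic; rewrite cc'.
Qed.

(** * The filtration of truncations *)

Lemma measurable_cyl n A : measurable (cyl n A : set tree).
Proof. by apply: sub_sigma_algebra; exists n => //; exists A. Qed.

Lemma filt_measurable n : filt n `<=` (measurable : set (set tree)).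
Proof.
apply: smallest_sub; first exact: sigma_algebra_measurable.
by move=> _ [A _ <-]; exact: measurable_cyl.
Qed.

Definition saturated (n : nat) (L : set tree) :=
  forall t t', restr n (nodes t) = restr n (nodes t') -> L t -> L t'.

(** Truncated trees are finite sets of words, hence countably many. The fibres
    of the truncation are enumerated through the codes of these finite sets,
    with empty sets for the unused codes. *)
Definition cylF (n i : nat) : set tree :=
  if @choice.pickle_inv {fset seq nat} i is Some fs then cyl n [set` fs] else set0.

Lemma cylF_cyl n i : cylF n i = set0 \/ exists A, cylF n i = cyl n A.
Proof.
by rewrite /cylF; case: choice.pickle_inv => [fs|]; [right; exists [set` fs] | left].
Qed.

Lemma measurable_cylF n i : measurable (cylF n i).
Proof.
case: (cylF_cyl n i) => [->|[A ->]]; first exact: measurable0.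
exact: measurable_cyl.
Qed.

Lemma cylF_cover n : \bigcup_i cylF n i = setT.
Proof.
rewrite -subTset => t _; have [u tu] := treeP t.
exists (choice.pickle (fset_set (restr n (nodes t)))) => //.
rewrite /cylF pickleK_inv /cyl /=; apply/seteqP; split => v.
  by move=> tv; rewrite /= in_fset_set ?inE//; exact: finite_restr tu.
by rewrite /= in_fset_set ?inE//; exact: finite_restr tu.
Qed.

Lemma cylF_trivIset n : trivIset setT (cylF n).
Proof.
move=> i j _ _ [t []]; rewrite /cylF.
case Ei : choice.pickle_inv => [fs|//] it; case Ej : choice.pickle_inv => [gs|//] jt.
have fg : fs = gs.
  by move: it jt; rewrite /cyl /= => -> /seteqP[H1 H2]; apply/fsetP => u; apply/idP/idP; [exact: H1|exact: H2].
move: (@pickle_invK {fset seq nat} i) (@pickle_invK {fset seq nat} j).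
by rewrite Ei Ej fg /= => -> ->.
Qed.

Lemma filt_saturated n L : filt n L -> saturated n L.
Proof.
pose S := [set L | saturated n L].
suff : filt n `<=` S by move=> /[apply].
apply: smallest_sub; last first.
  by move=> _ [A _ <-] t t' tt'; rewrite /cyl /= tt'.
split.
- by move=> t t'.
- by move=> A SA t t' tt' [_ At]; split => // At'; apply: At; exact: SA At'.
- by move=> F SF t t' tt' [i _ Fi]; exists i => //; exact: SF tt' Fi.
Qed.

Lemma saturated_cylF n L i : saturated n L ->
  L `&` cylF n i = set0 \/ L `&` cylF n i = cylF n i.
Proof.
move=> sL; case: (pselect (exists t, (L `&` cylF n i) t)) => [[t [Lt it]]|H].
  right; apply/setIidr => t' it'; apply: (sL t) => //.
  by move: it it'; case: (cylF_cyl n i) => [->//|[A ->]] /= -> ->.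
by left; rewrite -subset0 => t Lt; apply: H; exists t.
Qed.

Lemma bigcup_cylF n L : \bigcup_i (L `&` cylF n i) = L.
Proof. by rewrite -setI_bigcupr cylF_cover setIT. Qed.

(** The sigma-field of a map with countably many values contains all the
    unions of its fibres, so that membership is a pointwise condition. *)
Lemma filtP n L : filt n L <-> saturated n L.
Proof.
split; first exact: filt_saturated.
move=> sL; rewrite -(bigcup_cylF n L).
have [_ _ Hcup] : sigma_algebra setT (filt n) by exact: smallest_sigma_algebra.
apply: Hcup => i; have [f0 _ _] : sigma_algebra setT (filt n) by exact: smallest_sigma_algebra.
case: (saturated_cylF i sL) => ->; first exact: f0.
case: (cylF_cyl n i) => [->|[A ->]]; first exact: f0.
by apply: sub_sigma_algebra; exists A.
Qed.

Lemma filt_le m n L : (m <= n)%N -> filt m L -> filt n L.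
Proof.
by move=> mn /filtP H; apply/filtP => t t' /(restr_restr_eq mn); exact: H.
Qed.

Lemma filt_zcard m n (D : set nat) : (m <= n)%N -> filt n [set t | D (zcard m t)].
Proof. by move=> mn; apply/filtP => t t' /(zcard_restr mn) /= ->. Qed.

Lemma measurable_zcard_set m (D : set nat) :
  measurable ([set t | D (zcard m t)] : set tree).
Proof. by apply: (@filt_measurable m); exact: filt_zcard. Qed.

Lemma filtT n : filt n [set: tree].
Proof. by apply/filtP. Qed.

Section expectations.
Variable R : realType.
Implicit Types P : probability tree R.

Lemma measurable_zcard_fun d (T : measurableType d) m (g : nat -> T) :
  measurable_fun [set: tree] (fun t => g (zcard m t)).
Proof. by move=> _ B mB; rewrite setTI; exact: (measurable_zcard_set m (g @^-1` B)). Qed.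

Lemma expectation_indicE P (F : tree -> R) (L : set tree) : measurable L ->
  ('E_P[fun t => (F t * \1_L t)%R] = \int[P]_(t in L) (F t)%:E)%E.
Proof.
move=> mL; rewrite unlock [RHS]integral_mkcond; apply: eq_integral => t _.
by rewrite patchE indicE; case: (t \in L); rewrite ?mulr1 ?mulr0.
Qed.

Lemma ge0_integral_cylF (P : probability tree R) n (L : set tree) (F : tree -> \bar R) : measurable L ->
  measurable_fun [set: tree] F -> (forall t, (0 <= F t)%E) ->
  (\int[P]_(t in L) F t = \sum_(i <oo) \int[P]_(t in L `&` cylF n i) F t)%E.
Proof.
move=> mL mF F0; rewrite -[in LHS](bigcup_cylF n L) ge0_integral_bigcup//.
- by move=> i; apply: measurableI => //; exact: measurable_cylF.
- exact: measurable_funTS.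
- by move=> i j _ _ [t [[_ ?] [_ ?]]]; apply: (@cylF_trivIset n) => //; exists t.
Qed.

Lemma ge0_integral_zcard (P : probability tree R) m (L : set tree) (g : nat -> R) : measurable L ->
  (forall z, 0 <= g z)%R ->
  (\int[P]_(t in L) (g (zcard m t))%:E =
   \sum_(z <oo) (g z)%:E * P (L `&` [set t | zcard m t = z]))%E.
Proof.
move=> mL g0; rewrite -[in LHS](_ : \bigcup_z (L `&` [set t | zcard m t = z]) = L).
  rewrite ge0_integral_bigcup//; last first.
  - by move=> i j _ _ [t [[_ <-] [_ <-]]].
  - by move=> t _; rewrite lee_fin.
  - by apply/measurable_EFinP/measurable_funTS; exact: measurable_zcard_fun.
  - by move=> z; apply: measurableI => //; exact: (measurable_zcard_set m [set z]).
  apply: eq_eseriesr => z _.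
  rewrite -integral_cst; last first.
    by apply: measurableI => //; exact: (measurable_zcard_set m [set z]).
  by apply: eq_integral => t; rewrite inE => -[_ /= ->].
by rewrite -setI_bigcupr (_ : \bigcup_z _ = setT) ?setIT// -subTset => t _; exists (zcard m t).
Qed.

End expectations.

(** * Galton-Watson trees: the law of the next generation *)

Lemma size_genS A r d : size (gen A r d.+1) = (\sum_(u <- gen A r d) nchild A u)%N.
Proof.
rewrite genS size_flatten sumnE !big_map; apply: eq_bigr => u _.
by rewrite /children size_map size_iota.
Qed.

Lemma big_genS (S : Type) (idx : S) (op : Monoid.law idx) A r d (F : seq nat -> S) :
  \big[op/idx]_(v <- gen A r d.+1) F v =
  \big[op/idx]_(u <- gen A r d) \big[op/idx]_(i <- iota 1 (nchild A u)) F (rcons u i).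
Proof.
by rewrite genS big_flatten big_map; apply: eq_bigr => u _; rewrite /children big_map.
Qed.

Lemma uniq_upto A r d : uniq (flatten [seq gen A r j | j <- index_iota 0 d]).
Proof.
elim: d => [|d IH]; first by [].
rewrite /index_iota subn0 -addn1 iotaD map_cat flatten_cat cat_uniq /= cats0.
move: IH; rewrite /index_iota subn0 => ->; rewrite uniq_gen andbT /=.
apply/hasPn => v /size_gen sv; apply/negP => /flattenP[s /mapP[j]].
by rewrite mem_iota add0n => /andP[_ jd] -> /size_gen; lia.
Qed.

Lemma fsbig_restr (S : Type) (idx : S) (op : Monoid.com_law idx) A r d (F : seq nat -> S) :
  is_tree r A ->
  \big[op/idx]_(u \in restr (size r + d) A) F u =
  \big[op/idx]_(0 <= j < d.+1) \big[op/idx]_(u <- gen A r j) F u.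
Proof.
move=> tA; have -> : \big[op/idx]_(0 <= j < d.+1) \big[op/idx]_(u <- gen A r j) F u =
    \big[op/idx]_(u <- flatten [seq gen A r j | j <- index_iota 0 d.+1]) F u.
  by rewrite big_flatten big_map.
rewrite [RHS]fsbig_seq; last exact: uniq_upto.
suff -> : [set` flatten [seq gen A r j | j <- index_iota 0 d.+1]] = restr (size r + d) A by [].
apply/seteqP; split => u.
    move=> Hu; have /flattenP[s /mapP[j + ->]] : u \in flatten [seq gen A r j | j <- index_iota 0 d.+1] by exact: Hu.
    rewrite mem_index_iota => /andP[_ jd].
    by move=> /(mem_gen _ _ tA)[Au su]; split => //; rewrite su leq_add2l -ltnS.
  move=> [Au su]; change (u \in flatten [seq gen A r j | j <- index_iota 0 d.+1]).
  apply/flattenP; exists (gen A r (size u - size r)).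
    by apply/map_f; rewrite mem_index_iota ltnS leq_subLR.
  apply/(mem_gen _ _ tA); split => //; rewrite subnKC// leqNgt; apply/negP => H.
  by case: tA => _ _ /(_ u H).
Qed.

(** The probability that a Galton-Watson law gives to the cylinder of [A] at
    depth [d] below the root; see [cyl_law]. *)
Definition gwp (R : realType) (q : nat -> R) (A : set (seq nat)) r (d : nat) : R :=
  \prod_(0 <= j < d) \prod_(u <- gen A r j) q (nchild A u).

Lemma gwp_restr (R : realType) (q : nat -> R) n A B r d :
  restr n A = restr n B -> (size r + d <= n)%N -> gwp q A r d = gwp q B r d.
Proof.
move=> AB rd; rewrite /gwp big_nat [RHS]big_nat; apply: eq_bigr => j /andP[_ jd].
rewrite -(gen_restr AB); last by lia.
rewrite big_seq [RHS]big_seq; apply: eq_bigr => u /size_gen su.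
by rewrite (nchild_restr AB)// su; lia.
Qed.

Lemma gwpS (R : realType) (q : nat -> R) A r d :
  gwp q A r d.+1 = gwp q A r d * \prod_(u <- gen A r d) q (nchild A u).
Proof. by rewrite /gwp big_nat_recr. Qed.

(** Sums over families of offspring numbers, or of types, with a prescribed
    total are sums over compositions. Seeing them as coefficients of powers
    replaces all manipulations of compositions by algebra in a polynomial
    ring. *)
Lemma coef_sum_exp (R : comNzRingType) (b : nat -> R) (N : nat) (Q : pred nat) z j :
  ((\sum_(i < N | Q i) b i *: 'X^i) ^+ z)`_j =
  \sum_(c : {ffun 'I_z -> 'I_N} | [forall r, Q (c r)] && ((\sum_r (c r : nat))%N == j))
     \prod_r b (c r).
Proof.
rewrite -{1}(card_ord z) -prodr_const bigA_distr_big /= coef_sum.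
rewrite [LHS](eq_bigl (fun c : {ffun 'I_z -> 'I_N} => [forall r, Q (c r)])); last first.
  by move=> c; apply/ffun_onP/forallP.
rewrite [RHS]big_mkcondr; apply: eq_bigr => c _.
have -> : \prod_i (b (c i) *: 'X^(c i)) =
    (\prod_i b (c i)) *: 'X^(\sum_i c i)%N :> {poly R}.
  by rewrite scaler_prod prodrXr.
by rewrite coefZ coefXn eq_sym; case: eqP; rewrite ?mulr1 ?mulr0.
Qed.

(** The probability that [z] individuals with offspring law [q] have [j]
    children in total. *)
Definition conv (R : realType) (q : nat -> R) (z j : nat) : R :=
  ((\sum_(i < j.+1) q i *: 'X^i) ^+ z)`_j.

Lemma measure_bigcup_fin d (T : measurableType d) (R : realType)
    (mu : {measure set T -> \bar R}) (I : finType) (Q : pred I) (F : I -> set T) :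
  (forall i j, Q i -> Q j -> F i `&` F j !=set0 -> i = j) ->
  (forall i, measurable (F i)) ->
  mu (\bigcup_(i in [set i | Q i]) F i) = (\sum_(i | Q i) mu (F i))%E.
Proof.
move=> tF mF; rewrite measure_fin_bigcup//=.
  rewrite -[RHS]big_filter [RHS]fsbig_seq; last by rewrite filter_uniq ?index_enum_uniq.
  suff -> : [set` [seq i <- index_enum I | Q i]] = [set i | Q i] by [].
  by apply/seteqP; split => i; rewrite /= mem_filter mem_index_enum andbT.
Qed.

Section next_generation.
Variables (R : realType) (q : nat -> R) (k : nat) (P : probability tree R).
Hypothesis P_GW : is_GW q k P.

(** Functions on a list without repetition, here a generation, are coded by
    finite functions on its indices, so that finite sums can range over them.
    The value outside the list is 0. *)
Definition cw (g : seq (seq nat)) (j : nat) (c : {ffun 'I_(size g) -> 'I_j.+1}) (u : seq nat) : nat :=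
  if insub (index u g) is Some i then c i else 0%N.

Lemma cw_nth g j (c : {ffun 'I_(size g) -> 'I_j.+1}) (i : 'I_(size g)) :
  uniq g -> cw c (nth [::] g i) = c i.
Proof. by move=> ug; rewrite /cw index_uniq// valK. Qed.

Lemma big_cw (S : Type) (idx : S) (op : Monoid.com_law idx) g j
    (c : {ffun 'I_(size g) -> 'I_j.+1}) (F : nat -> S) : uniq g ->
  \big[op/idx]_(u <- g) F (cw c u) = \big[op/idx]_i F (c i).
Proof.
move=> ug; rewrite (big_nth [::]) big_mkord; apply: eq_bigr => i _.
by rewrite cw_nth.
Qed.

Let size_ones : size (ones k) = k. Proof. by rewrite size_nseq. Qed.

Lemma next_generation_bigcup (A : set (seq nat)) d j :
  is_tree (ones k) A -> height_le (k + d) A ->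
  let g := gen A (ones k) d in
  cyl (k + d) A `&` [set t | zcard (k + d).+1 t = j] =
  \bigcup_(c in [set c : {ffun 'I_(size g) -> 'I_j.+1} | (\sum_i c i)%N == j])
     cyl (k + d).+1 (graft A (k + d) (cw c)).
Proof.
move=> tA hA g; set n := (k + d)%N; have ug : uniq g := uniq_gen _ _ _.
have kn : (size (ones k) <= n)%N by rewrite size_ones leq_addr.
apply/seteqP; split => t.
- move=> [/= tE zt]; have tt : is_tree (ones k) (nodes t).
    by apply: (@is_tree_of_restr _ n); rewrite tE.
  have gE : g = gen (nodes t) (ones k) d.
    by apply: (@gen_restr n); rewrite ?size_ones// tE restr_id.
  have jE : (\sum_(u <- g) nchild (nodes t) u)%N = j.
    by rewrite -zt -addnS -[X in (X + _)%N]size_ones zcard_gen// size_genS gE.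
  have cj u : u \in g -> (nchild (nodes t) u < j.+1)%N.
    by move=> ug'; rewrite ltnS -jE (big_rem u)//= leq_addr.
  pose c : {ffun 'I_(size g) -> 'I_j.+1} :=
    [ffun i : 'I_(size g) => inord (nchild (nodes t) (nth [::] g i))].
  have cE u : u \in g -> cw c u = nchild (nodes t) u.
    move=> ug'; have ig : (index u g < size g)%N by rewrite index_mem.
    rewrite -{1}(nth_index [::] ug') (cw_nth c (Ordinal ig))// ffunE inordK.
      by rewrite nth_index.
    by apply: cj; rewrite mem_nth.
  exists c => /=.
    rewrite -(big_cw addn c id ug) -[X in _ == X]jE; apply/eqP.
    by rewrite big_seq [RHS]big_seq; apply: eq_bigr => u /cE.
  rewrite /cyl /= (graft_nchild tt kn) tE; apply: eq_graft => u Au un.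
  by rewrite cE//; apply/(mem_gen _ _ tA); rewrite size_ones.
- move=> [c /= /eqP cj]; rewrite /cyl /= => tE.
  have tA' : is_tree (ones k) (graft A n (cw c)) by exact: is_tree_graft.
  have tt : is_tree (ones k) (nodes t).
    by apply: (@is_tree_of_restr _ n.+1); rewrite tE.
  have rE : restr n (nodes t) = A.
    by rewrite -(restrK _ (leqnSn n)) tE restr_graft.
  split; first by [].
  have gE : g = gen (nodes t) (ones k) d.
    by apply: (@gen_restr n); rewrite ?size_ones// rE restr_id.
  rewrite -addnS -[X in (X + _)%N]size_ones zcard_gen// size_genS -gE.
  rewrite -[RHS]cj -(big_cw addn c id ug) /= big_seq [RHS]big_seq.
  apply: eq_bigr => u /(mem_gen _ _ tA)[Au]; rewrite size_ones => un.
  rewrite (@nchild_restr n.+1 _ (graft A n (cw c))) ?un ?tE//; last first.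
    by rewrite restr_id//; exact: height_graft.
  by rewrite nchild_graft.
Qed.

(** The law of a tree of height [(k + d).+1] factors into the weight of its
    truncation and the product of the last offspring probabilities; summing
    the latter over all offspring families with total [j] gives the
    convolution. *)
Lemma next_generation_law (A : set (seq nat)) d j :
  is_tree (ones k) A -> height_le (k + d) A ->
  P (cyl (k + d) A `&` [set t | zcard (k + d).+1 t = j]) =
  (gwp q A (ones k) d * conv q (size (gen A (ones k) d)) j)%:E.
Proof.
move=> tA hA; set g := gen A (ones k) d; have ug : uniq g := uniq_gen _ _ _.
have kn : (size (ones k) <= k + d)%N by rewrite size_ones leq_addr.
rewrite next_generation_bigcup//= -/g measure_bigcup_fin//=; last 2 first.
- move=> c c' _ _ [t [/= H1 H2]]; apply/ffunP => i; apply/val_inj => /=.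
  rewrite -!cw_nth//; set u := nth [::] g i.
  have [Au un] : A u /\ size u = (k + d)%N.
    rewrite -[X in (X + _)%N]size_ones.
    by apply/(mem_gen _ _ tA)/mem_nth.
  rewrite -(nchild_graft (cw c) hA Au un) -(nchild_graft (cw c') hA Au un).
  by congr nchild; rewrite -H1 -H2.
- by move=> c; exact: measurable_cyl.
rewrite (eq_bigr (fun c : {ffun 'I_(size g) -> 'I_j.+1} =>
    (gwp q A (ones k) d * \prod_i q (c i))%:E)); last first.
  move=> c _.
  have tG : is_tree (ones k) (graft A (k + d) (cw c)) by exact: is_tree_graft.
  rewrite (P_GW (t := Tree (ex_intro (fun u => is_tree u _) _ tG)))//=; last 2 first.
  - by rewrite ltnS leq_addr.
  - exact: height_graft.
  have  := @fsbig_restr _ _ *%R _ _ d (fun u => q (nchild (graft A (k + d) (cw c)) u)) tG.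
  rewrite size_ones => ->.
  rewrite -/(gwp _ _ _ _) gwpS.
  have gE : gen (graft A (k + d) (cw c)) (ones k) d = g.
    by apply: (@gen_restr (k + d)); rewrite ?size_ones// restr_graft// restr_id.
  rewrite (@gwp_restr _ _ (k + d) _ A) ?size_ones//; last first.
    by rewrite restr_graft// restr_id.
  congr (_ * _)%:E; rewrite gE -(big_cw _ c q ug) /= big_seq [RHS]big_seq.
  apply: eq_bigr => u /(mem_gen _ _ tA)[Au]; rewrite size_ones => un.
  by rewrite nchild_graft.
rewrite sumEFin -big_distrr /=; congr (_ * _)%:E; rewrite /conv.
rewrite (coef_sum_exp q j.+1 predT); apply: eq_bigl => c.
by rewrite (_ : [forall r, _] = true)//; apply/forallP.
Qed.
End next_generation.

Section total_mass.
Variables (R : realType) (q : nat -> R) (k : nat) (P : probability tree R).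
Hypotheses (q_off : is_offspring q) (P_GW : is_GW q k P).

Let size_ones : size (ones k) = k. Proof. by rewrite size_nseq. Qed.

Lemma is_tree_root : is_tree (ones k) [set ones k].
Proof.
split => //.
- by move=> v /= ->; rewrite /is_word all_nseq orbT.
- by move=> v + /= ve; rewrite ve ltnn.
- move=> v /= ->; exists 0%N => i i0; split; last by case: i i0.
  by move=> /(congr1 size); rewrite size_rcons; lia.
Qed.

Lemma height_root : height_le k [set ones k].
Proof. by move=> u /= ->; rewrite size_ones. Qed.

(** The law is prescribed above height [k] only, so the event is split along
    the number of children of the root. *)
Lemma cyl_root_law : P (cyl k [set ones k]) = 1%E.
Proof.
rewrite -(_ : \bigcup_j (cyl k [set ones k] `&` [set t | zcard k.+1 t = j]) = cyl k [set ones k]); last first.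
  by rewrite -setI_bigcupr (_ : \bigcup_j _ = setT) ?setIT// -subTset => t _; exists (zcard k.+1 t).
rewrite measure_semi_bigcup//=; last 3 first.
- move=> j; apply: measurableI; first exact: measurable_cyl.
  exact: (measurable_zcard_set k.+1 [set j]).
- by move=> i j _ _ [t [[_ /= <-] [_ /= <-]]].
- apply: bigcup_measurable => j _; apply: measurableI; first exact: measurable_cyl.
  exact: (measurable_zcard_set k.+1 [set j]).
case: q_off => _ <-; apply: eq_eseriesr => j _.
have := @next_generation_law _ _ _ _ P_GW [set ones k] 0 j is_tree_root.
rewrite addn0 => ->; last exact: height_root.
rewrite /gwp big_nil mul1r /conv /= expr1 coef_sum (bigD1 ord_max)//= coefZ coefXn eqxx.
rewrite mulr1 big1 ?addr0// => i ij; rewrite coefZ coefXn; case: eqP; rewrite ?mulr0//.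
by move=> ji; move: ij; rewrite -val_eqE /= -ji eqxx.
Qed.

Lemma cyl_law A d : is_tree (ones k) A -> height_le (k + d) A ->
  P (cyl (k + d) A) = (gwp q A (ones k) d)%:E.
Proof.
move=> tA hA; case: d => [|d] in hA *.
  rewrite addn0 /gwp big_nil (_ : A = [set ones k]) ?cyl_root_law//.
  apply/seteqP; split => u /=; last by move=> ->; case: tA.
  move=> Au; apply: (size_root_eq tA Au); apply/eqP; rewrite eqn_leq size_ones.
  rewrite -{1}(addn0 k) hA//= leqNgt; apply/negP => uk.
  by case: tA => _ _ /(_ u); rewrite size_ones => /(_ uk).
rewrite (P_GW (t := Tree (ex_intro (fun u => is_tree u _) _ tA)))//=; last by lia.
rewrite addnS /=.
have := @fsbig_restr _ _ *%R _ _ d (fun u => q (nchild A u)) tA.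
by rewrite size_ones => ->.
Qed.

Lemma cyl_null n A : (k <= n)%N -> ~ is_tree (ones k) A -> P (cyl n A) = 0%E.
Proof.
move=> kn tA; apply/eqP; rewrite eq_le measure_ge0 andbT.
have -> : 0%E = P (~` cyl k [set ones k]) :> \bar R.
  by rewrite probability_setC ?cyl_root_law ?subee//; exact: measurable_cyl.
apply: le_measure; rewrite ?inE; [exact: measurable_cyl| |].
  by apply: measurableC; exact: measurable_cyl.
move=> t /= tn tk; apply: tA; rewrite -tn; apply: is_tree_restr; last by rewrite size_ones.
by apply: (@is_tree_of_restr _ k); rewrite tk; exact: is_tree_root.
Qed.

Lemma zcard_root t : cyl k [set ones k] t -> zcard k t = 1%N.
Proof.
move=> tk; have tt : is_tree (ones k) (nodes t).
  by apply: (@is_tree_of_restr _ k); rewrite tk; exact: is_tree_root.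
by rewrite -{1}(addn0 k) -[X in (X + _)%N]size_ones zcard_gen.
Qed.

End total_mass.

(** * Polynomials as jets: the generating function acting on coefficients *)

Section jets.
Variables (R : realType) (p : nat).
Implicit Types (q : nat -> R) (A B : {poly R}).

(** A polynomial [A] of degree at most [p] records [p + 1] nonnegative numbers
    attached to one individual, typically its binomial moments of order at
    most [p]; then [A ^+ z] records those of [z] independent individuals, by
    Vandermonde's identity. *)
Definition pge0 A := forall i, 0 <= A`_i.

Definition ple A B := forall i, A`_i <= B`_i.

Definition jser q A i : \bar R := (\sum_(0 <= n <oo) (q n * (A ^+ n)`_i)%:E)%E.

Definition jfin q A := forall i, (i <= p)%N -> (jser q A i < +oo)%E.

(** Truncation at degree [p] of the formal composition of the generating
    function of [q] with [A]. It plays the role of the generating function and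
    of its first [p] derivatives at once: one generation of the process is one
    application of [jet]. *)
Definition jet q A : {poly R} := \poly_(i < p.+1) fine (jser q A i).

Lemma pge0M A B : pge0 A -> pge0 B -> pge0 (A * B).
Proof. by move=> A0 B0 i; rewrite coefM sumr_ge0// => j _; rewrite mulr_ge0. Qed.

Lemma pge0_1 : pge0 1.
Proof. by move=> i; rewrite coef1 ler0n. Qed.

Lemma pge0X A n : pge0 A -> pge0 (A ^+ n).
Proof. by move=> A0; elim: n => [|n IH]; rewrite ?expr0 ?exprS; [exact: pge0_1|exact: pge0M]. Qed.

Lemma pleM A B C D : pge0 A -> pge0 C -> ple A B -> ple C D -> ple (A * C) (B * D).
Proof.
move=> A0 C0 AB CD i; rewrite !coefM ler_sum// => j _.
by apply: ler_pM.
Qed.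

Lemma pleX A B n : pge0 A -> ple A B -> ple (A ^+ n) (B ^+ n).
Proof.
move=> A0 AB; elim: n => [|n IH]; first by move=> i; rewrite !expr0.
by rewrite !exprS; apply: pleM => //; exact: pge0X.
Qed.

Lemma jser_ge0 q A i : (forall n, 0 <= q n) -> pge0 A -> (0 <= jser q A i)%E.
Proof. by move=> q0 A0; apply: nneseries_ge0 => n _ _; rewrite lee_fin mulr_ge0//; exact: pge0X. Qed.

Lemma pge0_jet q A : (forall n, 0 <= q n) -> pge0 A -> pge0 (jet q A).
Proof. by move=> q0 A0 i; rewrite coef_poly; case: ifP => // _; rewrite fine_ge0// jser_ge0. Qed.

Lemma jetE q A i : (forall n, 0 <= q n) -> pge0 A -> jfin q A -> (i <= p)%N ->
  ((jet q A)`_i)%:E = jser q A i.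
Proof.
move=> q0 A0 Af ip; rewrite coef_poly ltnS ip fineK//.
by rewrite ge0_fin_numE ?Af// jser_ge0.
Qed.

Lemma coefX_eq A B N z i : (forall j, (j <= N)%N -> A`_j = B`_j) -> (i <= N)%N ->
  (A ^+ z)`_i = (B ^+ z)`_i.
Proof.
move=> AB; elim: z i => [|z IH] i iN; first by rewrite !expr0.
rewrite !exprS !coefM; apply: eq_bigr => j _; rewrite AB ?IH//.
  by rewrite (leq_trans (leq_subr _ _)).
by rewrite (leq_trans _ iN)// -ltnS.
Qed.

Lemma conv0 q j : conv q 0 j = (j == 0)%:R.
Proof. by rewrite /conv expr0 coef1. Qed.

Lemma coef_trunc q N i : (i < N)%N -> (\sum_(l < N) q l *: 'X^l)`_i = q i.
Proof.
move=> iN; have := coef_poly N q i; rewrite iN poly_def => <-; congr (_`_ _).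
Qed.

Lemma convS q z j : conv q z.+1 j = \sum_(l < j.+1) q l * conv q z (j - l).
Proof.
rewrite /conv exprS coefM; apply: eq_bigr => l _; rewrite coef_trunc//; congr (_ * _).
apply: (@coefX_eq _ _ (j - l)) => // i ijl; rewrite !coef_trunc//; lia.
Qed.

Lemma conv_ge0 q z j : (forall n, 0 <= q n) -> 0 <= conv q z j.
Proof.
move=> q0; elim: z j => [|z IH] j; first by rewrite conv0 ler0n.
by rewrite convS sumr_ge0// => l _; rewrite mulr_ge0.
Qed.


Lemma nneseries_cauchy (u v : nat -> R) :
  (forall n, 0 <= u n) -> (forall n, 0 <= v n) ->
  (\sum_(0 <= n <oo) (v n)%:E < +oo)%E ->
  (\sum_(0 <= j <oo) (\sum_(l < j.+1) u l * v (j - l)%N)%:E =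
   (\sum_(0 <= n <oo) (u n)%:E) * (\sum_(0 <= n <oo) (v n)%:E))%E.
Proof.
move=> u0 v0 vfin.
pose w l j := (if (l <= j)%N then u l * v (j - l)%N else 0)%:E : \bar R.
have w0 l j : (0 <= w l j)%E by rewrite /w lee_fin; case: ifP => // _; rewrite mulr_ge0.
transitivity (\sum_(0 <= j <oo) \sum_(0 <= l <oo) w l j)%E.
  apply: eq_eseriesr => j _; rewrite (nneseries_split _ j.+1)//= add0n.
  rewrite eseries0 ?adde0; last first.
    by move=> l /= jl _; rewrite /w leqNgt jl.
  rewrite big_mkord -sumEFin; apply: eq_bigr => l _.
  by rewrite /w -ltnS ltn_ord.
rewrite nneseries_interchange//.
set V := (\sum_(0 <= n <oo) (v n)%:E)%E in vfin *.
have VE : V = (fine V)%:E.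
  by rewrite fineK// ge0_fin_numE// nneseries_ge0// => n _ _; rewrite lee_fin.
rewrite muleC VE -nneseriesZl; last by move=> i _; rewrite lee_fin.
apply: eq_eseriesr => l _; rewrite -VE muleC -nneseriesZl; last by move=> i _; rewrite lee_fin.
rewrite (nneseries_split _ l)//= add0n big_nat big1 ?add0e; last first.
  by move=> j /= jl; rewrite /w leqNgt jl.
rewrite -nneseries_addn; last by move=> j; exact: w0.
by apply: eq_eseriesr => j _; rewrite /w leq_addl addnK EFinM.
Qed.

(** The total offspring of [z] individuals has the [z]-th power of the
    offspring generating function as its generating function. *)
Lemma nneseries_conv q A z i : (forall n, 0 <= q n) -> pge0 A -> jfin q A ->
  (i <= p)%N ->
  (\sum_(0 <= j <oo) (conv q z j * (A ^+ j)`_i)%:E = ((jet q A ^+ z)`_i)%:E)%E.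
Proof.
move=> q0 A0 Af; elim: z i => [|z IH] i ip.
  rewrite (nneseries_split _ 1)//=; last first.
    by move=> k _; rewrite lee_fin mulr_ge0 ?conv_ge0//; exact: pge0X.
  rewrite big_nat1 conv0 mul1r eseries0 ?adde0//.
  by case=> // j _ _; rewrite conv0 mul0r.
rewrite exprS coefM -sumEFin.
transitivity (\sum_(0 <= j <oo) \sum_(a < i.+1) (\sum_(l < j.+1)
    (q l * (A ^+ l)`_a) * (conv q z (j - l) * (A ^+ (j - l)%N)`_(i - a)))%:E)%E.
  apply: eq_eseriesr => j _; rewrite sumEFin; congr EFin.
  rewrite exchange_big /= convS big_distrl; apply: eq_bigr => l _ /=.
  have -> : A ^+ j = A ^+ l * A ^+ (j - l) by rewrite -exprD subnKC// -ltnS.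
  rewrite coefM big_distrr; apply: eq_bigr => a _ /=; ring.
rewrite nneseries_sum; last first.
  move=> a j _; rewrite lee_fin sumr_ge0// => l _.
  by rewrite !mulr_ge0 ?conv_ge0//; exact: pge0X.
apply: eq_bigr => a _.
have ap : (a <= p)%N by rewrite (leq_trans _ ip)// -ltnS.
have iap : (i - a <= p)%N by rewrite (leq_trans (leq_subr _ _)).
rewrite (nneseries_cauchy (u := fun l => q l * (A ^+ l)`_a)
  (v := fun j => conv q z j * (A ^+ j)`_(i - a))).
- by rewrite IH// EFinM jetE.
- by move=> l; rewrite mulr_ge0//; exact: pge0X.
- by move=> l; rewrite mulr_ge0 ?conv_ge0//; exact: pge0X.
- by rewrite IH// ltry.
Qed.

End jets.

(** * The Markov property of the generation sizes *)

Section markov.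
Variables (R : realType) (p : nat) (q : nat -> R) (k : nat) (P : probability tree R).
Hypotheses (q_off : is_offspring q) (P_GW : is_GW q k P).

Let q0 n : 0 <= q n. Proof. by case: q_off. Qed.

Let size_ones : size (ones k) = k. Proof. by rewrite size_nseq. Qed.

(* Trees not rooted at [ones k] form a null set, so that only the fibres at
   trees rooted there matter. *)
Let integral_zcard_fibres n (L : set tree) (g1 g2 : nat -> R) :
  (k <= n)%N -> filt n L -> (forall z, 0 <= g1 z) -> (forall z, 0 <= g2 z) ->
  (forall C, is_tree (ones k) C -> height_le n C ->
     \int[P]_(t in cyl n C) (g1 (zcard n.+1 t))%:E =
     \int[P]_(t in cyl n C) (g2 (zcard n t))%:E)%E ->
  ('E_P[fun t => (g1 (zcard n.+1 t) * \1_L t)%R] =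
   'E_P[fun t => (g2 (zcard n t) * \1_L t)%R])%E.
Proof.
move=> kn fL g10 g20 H; have mL := filt_measurable fL.
have m1 : measurable_fun [set: tree] (fun t => (g1 (zcard n.+1 t))%:E).
  by apply/measurable_EFinP; exact: measurable_zcard_fun.
have m2 : measurable_fun [set: tree] (fun t => (g2 (zcard n t))%:E).
  by apply/measurable_EFinP; exact: measurable_zcard_fun.
have /= E1 := ge0_integral_cylF P n mL m1 (fun t => g10 _).
have /= E2 := ge0_integral_cylF P n mL m2 (fun t => g20 _).
rewrite !expectation_indicE// E1 E2.
apply: eq_eseriesr => c _.
case: (saturated_cylF c (filt_saturated fL)) => ->; first by rewrite !integral_set0.
case: (cylF_cyl n c) => [->|[C ->]]; first by rewrite !integral_set0.
have mC := measurable_cyl n C.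
case: (pselect (is_tree (ones k) C)) => tC; last first.
  by rewrite !null_set_integral//; first [exact: measurable_funTS | exact: (cyl_null q_off P_GW)].
case: (pselect (exists t, cyl n C t)) => [[t0 Ct0]|noC]; last first.
  suff -> : cyl n C = set0 by rewrite !integral_set0.
  by rewrite -subset0 => t Ct; apply: noC; exists t.
by apply: H => //; rewrite -Ct0; exact: height_restr.
Qed.

(** Given the truncation at height [n], the next generation has [zcard n]
    independent families; averaging [A ^+ Z] over them gives a quantity of the
    same form, with [A] replaced by its jet. *)
Lemma markov_step n (L : set tree) A i : (k <= n)%N -> filt n L -> pge0 A ->
  jfin p q A -> (i <= p)%N ->
  ('E_P[fun t => ((A ^+ zcard n.+1 t)`_i * \1_L t)%R] =
   'E_P[fun t => ((jet p q A ^+ zcard n t)`_i * \1_L t)%R])%E.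
Proof.
move=> kn fL A0 Af ip.
have J0 : pge0 (jet p q A) by exact: pge0_jet.
apply: (integral_zcard_fibres (g1 := fun z => (A ^+ z)`_i)
  (g2 := fun z => (jet p q A ^+ z)`_i)) => //; try by move=> z; exact: pge0X.
move=> C tC hC; have mC := measurable_cyl n C.
have [d nE] : exists d, n = (k + d)%N by exists (n - k)%N; rewrite subnKC.
subst n; pose z := size (gen C (ones k) d).
have gz := @ge0_integral_zcard R P (k + d).+1 (cyl (k + d) C) (fun z => (A ^+ z)`_i) mC (fun z => pge0X _ A0 _).
rewrite gz (eq_integral (fun=> ((jet p q A ^+ z)`_i)%:E)); last first.
  move=> t; rewrite inE => Ct; suff -> : zcard (k + d) t = z by [].
  have tt : is_tree (ones k) (nodes t) by apply: (@is_tree_of_restr _ (k + d)); rewrite Ct.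
  have := zcard_gen d tt; rewrite size_ones => ->; congr size.
  by apply: (@gen_restr (k + d)); rewrite ?size_ones// Ct restr_id.
rewrite integral_cst// -(nneseries_conv z q0 A0 Af ip).
rewrite [X in (_ = _ * X)%E](_ : _ = (gwp q C (ones k) d)%:E); last exact: cyl_law.
rewrite muleC -nneseriesZl; last first.
  by move=> j _; rewrite lee_fin mulr_ge0 ?conv_ge0//; exact: pge0X.
apply: eq_eseriesr => j _.
rewrite [X in (_ * X = _)%E](_ : _ = (gwp q C (ones k) d * conv q z j)%:E); last exact: next_generation_law.
rewrite -!EFinM.
by congr EFin; rewrite -/z; ring.
Qed.

Fixpoint jetn (p : nat) (q : nat -> R) m A := if m is m'.+1 then jetn p q m' (jet p q A) else A.

Lemma markov m n (L : set tree) A i : (k <= n)%N -> filt n L -> pge0 A ->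
  (forall m, jfin p q (jetn p q m A)) -> (i <= p)%N ->
  ('E_P[fun t => ((A ^+ zcard (m + n) t)`_i * \1_L t)%R] =
   'E_P[fun t => ((jetn p q m A ^+ zcard n t)`_i * \1_L t)%R])%E.
Proof.
move=> kn fL A0 Af ip; elim: m A A0 Af => [|m IH] A A0 Af; first by [].
rewrite addSn markov_step//.
- by apply: IH; [exact: pge0_jet | move=> m'; exact: (Af m'.+1)].
- by rewrite (leq_trans kn)// leq_addl.
- by apply: filt_le fL; rewrite leq_addl.
- exact: (Af 0%N).
Qed.

Lemma expectation_root (g : nat -> R) : (forall z, 0 <= g z) ->
  ('E_P[fun t => g (zcard k t)] = (g 1%N)%:E)%E.
Proof.
move=> g0; rewrite unlock (ge0_integral_zcard P k measurableT g0).
rewrite (nneseries_split _ 2)//=; last by move=> z _; rewrite mule_ge0 ?lee_fin.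
have H z : P (setT `&` [set t | zcard k t = z]) = (z == 1%N)%:R%:E.
  rewrite setTI; case: eqP => [->|z1].
    apply/eqP; rewrite eq_le; apply/andP; split.
      by apply: probability_le1; exact: (measurable_zcard_set k [set 1%N]).
    rewrite -(cyl_root_law q_off P_GW); apply: le_measure; rewrite ?inE.
    - exact: measurable_cyl.
    - exact: (measurable_zcard_set k [set 1%N]).
    - by move=> t; exact: zcard_root.
  apply/eqP; rewrite eq_le measure_ge0 andbT.
  apply: (@le_trans _ _ (P (~` cyl k [set ones k]))); last first.
    by rewrite probability_setC ?(cyl_root_law q_off P_GW) ?subee//; exact: measurable_cyl.
  apply: le_measure; rewrite ?inE.
  - exact: (measurable_zcard_set k [set z]).
  - by apply: measurableC; exact: measurable_cyl.
  - by move=> t /= tz /zcard_root; rewrite tz.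
rewrite big_nat_recr//= big_nat1 !H /= mule0 add0e mule1 eseries0 ?adde0//.
by move=> z z2 _; rewrite H; case: eqP z2 => [->//|]; rewrite mule0.
Qed.

Lemma coef_jetn m A i : pge0 A -> (forall m, jfin p q (jetn p q m A)) ->
  (i <= p)%N ->
  ('E_P[fun t => ((A ^+ zcard (m + k) t)`_i)%R] = ((jetn p q m A)`_i)%:E)%E.
Proof.
move=> A0 Af ip.
have H (F : tree -> R) : (fun t => F t) = (fun t => F t * \1_[set: tree] t).
  by apply/funext => t; rewrite indicE in_setT mulr1.
rewrite H markov//; last exact: filtT.
rewrite -H (expectation_root (g := fun z => (jetn p q m A ^+ z)`_i)) ?expr1// => z.
apply: pge0X; elim: m A A0 {Af H} => [//|m IH] A A0 /=; apply: IH; exact: pge0_jet.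
Qed.

End markov.

Section coefficients_of_powers.
Variable R : realType.
Implicit Types A B : {poly R}.

Lemma coef_low_exp A l i : A`_0 = 0 -> (i < l)%N -> (A ^+ l)`_i = 0.
Proof.
move=> A0; elim: l i => [//|l IH] i il; rewrite exprS coefM big_ord_recl A0 mul0r add0r.
by rewrite big1// => j _; rewrite IH ?mulr0// lift0; have := ltn_ord j; lia.
Qed.

(** The number of terms is bounded by the degree [i], whatever the exponent:
    this separates the growth in [n], through binomial coefficients and powers
    of the constant coefficient, from the higher coefficients of [A]. *)
Lemma coefX_expand A n i :
  (A ^+ n)`_i = \sum_(l < i.+1) 'C(n, l)%:R * A`_0 ^+ (n - l) * ((A - (A`_0)%:P) ^+ l)`_i.
Proof.
set A' := A - _; have A'0 : A'`_0 = 0 by rewrite coefB coefC eqxx subrr.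
rewrite -{1}[A](subrK (A`_0)%:P) -/A' addrC exprDn coef_sum.
pose F l := 'C(n, l)%:R * A`_0 ^+ (n - l) * (A' ^+ l)`_i.
transitivity (\sum_(l < n.+1) F l).
  by apply: eq_bigr => l _; rewrite coefMn -polyC_exp coefCM -mulr_natl mulrA.
have Fn l : (n < l)%N -> F l = 0 by move=> nl; rewrite /F bin_small// !mul0r.
have Fi l : (i < l)%N -> F l = 0 by move=> il; rewrite /F coef_low_exp// mulr0.
rewrite -!(big_mkord xpredT F).
case: (leqP n i) => ni.
  rewrite [RHS](big_cat_nat (n := n.+1))//= [X in _ = _ + X]big_nat [X in _ = _ + X]big1 ?addr0//.
  by move=> l /andP[nl _]; rewrite Fn.
rewrite (big_cat_nat (n := i.+1))//=; last by rewrite ltnS ltnW.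
rewrite [X in _ + X = _]big_nat [X in _ + X = _]big1 ?addr0//.
by move=> l /andP[nl _]; rewrite Fi.
Qed.

Lemma coefX_le A B N z i : (forall j, (j <= N)%N -> 0 <= A`_j <= B`_j) -> (i <= N)%N ->
  0 <= (A ^+ z)`_i <= (B ^+ z)`_i.
Proof.
move=> AB; elim: z i => [|z IH] i iN; first by rewrite !expr0 coef1 lexx ler0n.
have H (j : 'I_i.+1) : 0 <= A`_j <= B`_j /\ 0 <= (A ^+ z)`_(i - j) <= (B ^+ z)`_(i - j).
  split; first by apply: AB; rewrite (leq_trans _ iN)// -ltnS.
  by apply: IH; rewrite (leq_trans (leq_subr _ _)).
rewrite !exprS !coefM; apply/andP; split.
  by apply: sumr_ge0 => j _; have [/andP[a0 _] /andP[b0 _]] := H j; exact: mulr_ge0.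
by apply: ler_sum => j _; have [/andP[a0 ?] /andP[b0 ?]] := H j; exact: ler_pM.
Qed.

Lemma coefX_scale A B (c : R) N n i : (forall j, (j <= N)%N -> B`_j = c ^+ j * A`_j) ->
  (i <= N)%N -> (B ^+ n)`_i = c ^+ i * (A ^+ n)`_i.
Proof.
move=> AB; elim: n i => [|n IH] i iN.
  by rewrite !expr0 coef1; case: i {iN} => [|i]; rewrite ?expr0 ?mulr1 ?mulr0.
rewrite !exprS !coefM big_distrr; apply: eq_bigr => j _.
have ji : (j <= i)%N by rewrite -ltnS.
rewrite AB ?(leq_trans ji)// IH; last by rewrite (leq_trans (leq_subr _ _)).
have -> : c ^+ i = c ^+ j * c ^+ (i - j) by rewrite -exprD subnKC.
by rewrite /=; ring.
Qed.

Lemma pge0_tail A : pge0 A -> pge0 (A - (A`_0)%:P).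
Proof. by move=> A0 i; rewrite coefB coefC; case: eqP => [->|_]; rewrite ?subrr ?subr0. Qed.

Lemma bin_geo (e : R) z j : 0 <= e -> 'C(z, j)%:R * e ^+ j <= (1 + e) ^+ z.
Proof.
move=> e0; case: (leqP j z) => jz; last first.
  by rewrite bin_small// mul0r exprn_ge0// addr_ge0.
rewrite exprDn (bigD1 (Ordinal (jz : (j < z.+1)%N)))//= expr1n mul1r mulr_natl lerDl.
by apply: sumr_ge0 => i _; rewrite expr1n mul1r mulrn_wge0// exprn_ge0.
Qed.

Lemma HpolyE p z : Hpoly p z%:R = 'C(z, p)%:R :> R.
Proof.
rewrite /Hpoly; elim: p => [|p IH]; first by rewrite big_ord0 bin0 fact0 invr1 mulr1.
rewrite big_ord_recr /= factS.
have p0 : (p.+1%:R : R) != 0 by rewrite pnatr_eq0.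
have f0 : (p`!%:R : R) != 0 by rewrite pnatr_eq0 -lt0n fact_gt0.
have -> : (p.+1 * p`!)%:R^-1 * (\prod_(j < p) (z%:R - j%:R) * (z%:R - p%:R)) =
    (p`!)%:R^-1 * \prod_(j < p) (z%:R - j%:R) * (z%:R - p%:R) / p.+1%:R :> R.
  by rewrite natrM invfM; ring.
rewrite IH; apply: (mulIf p0); rewrite divfK//.
case: (leqP p z) => pz.
  by rewrite -natrB// -!natrM [in RHS]mulnC mul_bin_left mulnC.
by rewrite !bin_small ?mul0r//; lia.
Qed.

(** The jets start from this polynomial: its powers carry the binomial moments
    weighted by [s ^+ z]. *)
Lemma coef_binom (s : R) z j : ((s%:P + s *: 'X) ^+ z)`_j = 'C(z, j)%:R * s ^+ z.
Proof.
have -> : s%:P + s *: 'X = s *: (1 + 'X) :> {poly R} by rewrite scalerDr alg_polyC.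
rewrite exprZn coefZ mulrC addrC exprD1n coef_sum.
congr (_ * _); case: (leqP j z) => jz.
  rewrite (bigD1 (Ordinal (jz : (j < z.+1)%N)))//= coefMn coefXn eqxx big1 ?addr0// => i ij.
  rewrite coefMn coefXn; case: eqP => ji; rewrite ?mul0rn//.
  by move: ij; rewrite -val_eqE /= ji eqxx.
rewrite bin_small// big1// => i _; rewrite coefMn coefXn; case: eqP => ji; rewrite ?mul0rn//.
by have := ltn_ord i; rewrite -ji; lia.
Qed.

End coefficients_of_powers.

(** * Jets at a point where the generating function is finite *)

Section jet_class.
Variables (R : realType) (p : nat) (q : nat -> R) (r : R).
Hypotheses (q0 : forall n, 0 <= q n) (r1 : 1 <= r).
Hypothesis qr : (\sum_(0 <= n <oo) (q n * r ^+ n)%:E <= r%:E)%E.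
Hypothesis qrD : forall i, (i <= p)%N ->
  (\sum_(0 <= n <oo) (q n * 'C(n, i)%:R * r ^+ n)%:E < +oo)%E.
Implicit Types A B : {poly R}.

(** If the generating function maps [r] below [r], polynomials with constant
    coefficient at most [r] are stable under [jet]: a condition on the
    constant coefficient controls all the others, see [jdom_jfin]. *)
Definition jdom A := pge0 A /\ A`_0 <= r.

(** By [coefX_expand], the bound is a combination of terms of the series for
    the derivatives of the generating function at [r], which converge. *)
Lemma coefX_bound A : jdom A -> exists2 C, 0 <= C & forall n i, (i <= p)%N ->
  (A ^+ n)`_i <= C * \sum_(l < p.+1) 'C(n, l)%:R * r ^+ n.
Proof.
move=> [A0 Ar]; set A' := A - (A`_0)%:P; have A'0 : pge0 A' by exact: pge0_tail.
exists (\sum_(i < p.+1) \sum_(l < p.+1) (A' ^+ l)`_i).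
  by apply: sumr_ge0 => i _; apply: sumr_ge0 => l _; exact: pge0X.
move=> n i ip; rewrite coefX_expand -/A' -!(big_mkord xpredT (fun l => 'C(n, l)%:R * _ ^+ (n - l) * (A' ^+ l)`_i)).
apply: (@le_trans _ _ (\sum_(l < p.+1) 'C(n, l)%:R * A`_0 ^+ (n - l) * (A' ^+ l)`_i)).
  rewrite -(big_mkord xpredT (fun l => 'C(n, l)%:R * A`_0 ^+ (n - l) * (A' ^+ l)`_i)).
  rewrite [leRHS](big_cat_nat (n := i.+1))//= lerDl sumr_ge0// => l _.
  by rewrite !mulr_ge0 ?exprn_ge0//; exact: pge0X.
rewrite big_distrr /=; apply: ler_sum => l _.
rewrite mulrC; apply: ler_pM => //.
- by exact: pge0X.
- by rewrite mulr_ge0 ?exprn_ge0.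
- rewrite (bigD1 (Ordinal (ip : (i < p.+1)%N)))//= (bigD1 l)//= -addrA lerDl.
  by rewrite addr_ge0// sumr_ge0// => ? _; [|apply: sumr_ge0 => ? _]; exact: pge0X.
- rewrite ler_wpM2l//; apply: (@le_trans _ _ (r ^+ (n - l))).
    by apply: lerXn2r; rewrite ?nnegrE// (le_trans _ r1).
  by rewrite ler_weXn2l// leq_subr.
Qed.

Lemma jdom_jfin A : jdom A -> jfin p q A.
Proof.
move=> dA i ip; have [C C0 HC] := coefX_bound dA.
apply: (@le_lt_trans _ _ (C%:E * \sum_(l < p.+1) \sum_(0 <= n <oo) (q n * 'C(n, l)%:R * r ^+ n)%:E)%E).
  rewrite -nneseries_sum; last first.
    by move=> l n _; rewrite lee_fin !mulr_ge0// exprn_ge0// (le_trans _ r1).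
  rewrite -nneseriesZl; last first.
    by move=> n _; rewrite sumEFin lee_fin sumr_ge0// => l _; rewrite !mulr_ge0// exprn_ge0// (le_trans _ r1).
  apply: lee_nneseries => [n _|n _]; first by rewrite lee_fin mulr_ge0//; apply: pge0X; case: dA.
  rewrite sumEFin -EFinM lee_fin (le_trans (ler_wpM2l (q0 n) (HC n i ip)))//.
  rewrite mulrCA big_distrr /= ler_wpM2l//.
  by rewrite le_eqVlt; apply/orP; left; apply/eqP/eq_bigr => l _; rewrite mulrA.
rewrite lte_mul_pinfty ?lee_fin ?fin_numE//.
by apply: lte_sum_pinfty => l _; apply: qrD; rewrite -ltnS.
Qed.

Lemma coef0_exp A n : (A ^+ n)`_0 = A`_0 ^+ n.
Proof. by rewrite -!horner_coef0 horner_exp. Qed.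

Lemma jet0E A : jdom A -> ((jet p q A)`_0)%:E = (\sum_(0 <= n <oo) (q n * A`_0 ^+ n)%:E)%E.
Proof.
move=> dA; rewrite jetE//; [|by case: dA|exact: jdom_jfin].
by apply: eq_eseriesr => n _; rewrite coef0_exp.
Qed.

Lemma jdom_jet A : jdom A -> jdom (jet p q A).
Proof.
move=> dA; have [A0 Ar] := dA; split; first exact: pge0_jet.
rewrite -lee_fin jet0E//; apply: le_trans qr; apply: lee_nneseries => [n _|n _].
  by rewrite lee_fin mulr_ge0// exprn_ge0.
by rewrite lee_fin ler_wpM2l// lerXn2r// nnegrE// (le_trans _ r1).
Qed.

Lemma jdom_jetn m A : jdom A -> jdom (jetn p q m A).
Proof. by elim: m A => //= m IH A dA; apply/IH/jdom_jet. Qed.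

Lemma jetn_jfin A : jdom A -> forall m, jfin p q (jetn p q m A).
Proof. by move=> dA m; apply/jdom_jfin/jdom_jetn. Qed.

Lemma jetnD m n A : jetn p q (m + n) A = jetn p q m (jetn p q n A).
Proof. by elim: n A => [|n IH] A; rewrite ?addn0// addnS /= IH. Qed.

Lemma jetnS m A : jetn p q m.+1 A = jet p q (jetn p q m A).
Proof. by rewrite -add1n jetnD. Qed.

Lemma ple_jet A B : pge0 A -> ple A B -> jdom B -> ple (jet p q A) (jet p q B).
Proof.
move=> A0 AB dB i; rewrite !coef_poly; case: ifP => // ip.
have [B0 Br] := dB; have dA : jdom A by split => //; apply: le_trans Br.
have pf C : jdom C -> jser q C i \is a fin_num.
  move=> dC; rewrite ge0_fin_numE; first exact: jdom_jfin.
  by apply: jser_ge0 => //; case: dC.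
apply: fine_le; rewrite ?pf//; apply: lee_nneseries => [n _|n _].
  by rewrite lee_fin mulr_ge0//; exact: pge0X.
by rewrite lee_fin ler_wpM2l//; exact: pleX.
Qed.

Lemma ple_jetn m A B : pge0 A -> ple A B -> jdom B -> ple (jetn p q m A) (jetn p q m B).
Proof.
elim: m A B => //= m IH A B A0 AB dB; apply: IH; [exact: pge0_jet|exact: ple_jet|exact: jdom_jet].
Qed.

End jet_class.

Section expectation_toolbox.
Variables (R : realType) (P : probability tree R).

Lemma expectationT (F : tree -> R) :
  ('E_P[F] = 'E_P[fun t => (F t * \1_[set: tree] t)%R])%E.
Proof. by congr ('E_P[_])%E; apply/funext => t; rewrite indicE in_setT mulr1. Qed.

Lemma expectation_zcard_le n (g h : nat -> R) : (forall z, 0 <= g z <= h z) ->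
  ('E_P[fun t => g (zcard n t)] <= 'E_P[fun t => h (zcard n t)])%E.
Proof.
move=> gh; rewrite unlock; apply: ge0_le_integral => //.
- by move=> t _; rewrite lee_fin; case/andP: (gh (zcard n t)).
- by apply/measurable_EFinP; exact: measurable_zcard_fun.
- by apply/measurable_EFinP; exact: measurable_zcard_fun.
- by move=> t _; rewrite lee_fin; case/andP: (gh (zcard n t)).
Qed.

Lemma expectation_zcardD n (g h : nat -> R) : (forall z, 0 <= g z) -> (forall z, 0 <= h z) ->
  ('E_P[fun t => (g (zcard n t) + h (zcard n t))%R]
   = 'E_P[fun t => g (zcard n t)] + 'E_P[fun t => h (zcard n t)])%E.
Proof.
move=> g0 h0; rewrite unlock -ge0_integralD//.
- by move=> t _; rewrite lee_fin.
- by apply/measurable_EFinP; exact: measurable_zcard_fun.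
- by move=> t _; rewrite lee_fin.
- by apply/measurable_EFinP; exact: measurable_zcard_fun.
Qed.

Lemma expectation_zcardZ n (c : R) (g : nat -> R) : 0 <= c -> (forall z, 0 <= g z) ->
  ('E_P[fun t => (c * g (zcard n t))%R] = c%:E * 'E_P[fun t => g (zcard n t)])%E.
Proof.
move=> c0 g0; rewrite unlock -ge0_integralZl_EFin//.
- by move=> t _; rewrite lee_fin.
- by apply/measurable_EFinP; exact: measurable_zcard_fun.
Qed.

(** Dominated convergence, the dominating function being a function of the
    size of a fixed generation. *)
Lemma cvg_expectation_zcard n (L : set tree) (g : nat -> nat -> R) (g' h : nat -> R) :
  measurable L -> (forall z, g m z @[m --> \oo] --> g' z) ->
  (forall m z, 0 <= g m z <= h z) -> ('E_P[fun t => h (zcard n t)] < +oo)%E ->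
  ('E_P[fun t => (g m (zcard n t) * \1_L t)%R] @[m --> \oo] -->
   'E_P[fun t => (g' (zcard n t) * \1_L t)%R])%E.
Proof.
move=> mL gg' gh hfin.
have mg (f : nat -> R) : measurable_fun L (fun t => (f (zcard n t))%:E).
  by apply/measurable_EFinP/measurable_funTS; exact: measurable_zcard_fun.
under eq_fun do rewrite expectation_indicE//.
rewrite expectation_indicE//.
have h0 z : 0 <= h z by have /andP[/le_trans] := gh 0%N z; apply.
have [] := @dominated_convergence _ _ _ P L mL (fun m t => (g m (zcard n t))%:E)
   (fun t => (g' (zcard n t))%:E) (fun t => (h (zcard n t))%:E) => //.
- by apply: aeW => t _; apply: cvg_EFin; [exact: nearW | exact: gg'].
- apply/integrableP; split; first exact: mg.
  apply: le_lt_trans hfin; rewrite unlock.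
  apply: (@le_trans _ _ (\int[P]_(t in L) (h (zcard n t))%:E)%E).
    rewrite le_eqVlt; apply/orP; left; apply/eqP/eq_integral => t _.
    by rewrite gee0_abs// lee_fin.
  apply: ge0_subset_integral => //; last by move=> t _; rewrite lee_fin.
  by apply/measurable_EFinP; exact: measurable_zcard_fun.
- by apply: aeW => t m _ ; have /andP[g0 gh'] := gh m (zcard n t); rewrite gee0_abs ?lee_fin.
Qed.

Lemma expectation_zcardZL n (L : set tree) (c : R) (g : nat -> R) : measurable L ->
  0 <= c -> (forall z, 0 <= g z) ->
  ('E_P[fun t => (c * g (zcard n t) * \1_L t)%R] =
   c%:E * 'E_P[fun t => (g (zcard n t) * \1_L t)%R])%E.
Proof.
move=> mL c0 g0; rewrite !(expectation_indicE _ _ mL) -ge0_integralZl_EFin//.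
- by move=> t _; rewrite lee_fin.
- by apply/measurable_EFinP/measurable_funTS; exact: measurable_zcard_fun.
Qed.

Lemma expectation_zcard_sum n N (g : nat -> nat -> R) : (forall l z, 0 <= g l z) ->
  ('E_P[fun t => (\sum_(l < N) g l (zcard n t))%R] =
   \sum_(l < N) 'E_P[fun t => g l (zcard n t)])%E.
Proof.
move=> g0; elim: N => [|N IH].
  rewrite big_ord0 (_ : 'E_P[_] = 'E_P[fun=> 0%R])%E; first exact: expectation_cst.
  by congr ('E_P[_])%E; apply/funext => t; rewrite big_ord0.
rewrite big_ord_recr -IH /= -(@expectation_zcardD n (fun z => \sum_(l < N) g l z) (g N))//.
  by congr ('E_P[_])%E; apply/funext => t; rewrite big_ord_recr.
by move=> z; exact: sumr_ge0.
Qed.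

(** The common factor [c] carries the rate at which numerator and denominator
    vanish or explode. *)
Lemma cvge_ratio (c : nat -> R) (u v : nat -> \bar R) (a b : R) :
  (\forall m \near \oo, c m != 0) -> (u m @[m --> \oo] --> a%:E)%E ->
  (v m @[m --> \oo] --> b%:E)%E -> b != 0 ->
  (((c m)%:E * u m) / ((c m)%:E * v m) @[m --> \oo] --> (a / b)%:E)%E.
Proof.
move=> c0 ua vb b0.
have /fine_cvgP[uf ua'] := ua; have /fine_cvgP[vf vb'] := vb.
have Hc : (fine (u m) / fine (v m)) @[m --> \oo] --> a / b by apply: cvgM => //; exact: cvgV.
have vn : \forall m \near \oo, fine (v m) != 0.
  exact: (@cvgr_neq0 _ _ _ _ _ _ _ vb' b0).
have Hc' : ((fine (u m) / fine (v m))%:E @[m --> \oo] --> (a / b)%:E)%E.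
  by apply: cvg_EFin; [exact: nearW | exact: Hc].
apply: cvg_trans Hc'; apply: near_eq_cvg; near=> m.
have um : u m \is a fin_num by near: m.
have vm : v m \is a fin_num by near: m.
have v0 : fine (v m) != 0 by near: m.
have cm : c m != 0 by near: m.
rewrite -{2}(fineK um) -{2}(fineK vm) -!EFinM inver mulf_eq0 (negbTE cm) (negbTE v0) /=.
by rewrite -EFinM; congr EFin; field; rewrite cm v0.
Unshelve. all: by end_near. Qed.

End expectation_toolbox.

(** * Limits, expectations and derivatives *)

Lemma cvg_exprn_comp (R : realType) (f : nat -> R) (l : R) k :
  f m @[m --> \oo] --> l -> (f m ^+ k) @[m --> \oo] --> l ^+ k.
Proof.
move=> fl; elim: k => [|k IH]; first by rewrite expr0; exact: cvg_cst.
by rewrite exprS; under eq_fun do rewrite exprS; exact: cvgM.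
Qed.

(** The distance to [E / (1 - rho)] is contracted by [rho] up to an error
    which vanishes. *)
Lemma cvg_contraction (R : realType) (u e : nat -> R) (rho E : R) : 0 <= rho < 1 ->
  (forall m, u m.+1 = rho * u m + e m) -> e m @[m --> \oo] --> E ->
  u m @[m --> \oo] --> E / (1 - rho).
Proof.
move=> /andP[r0 r1] rec eE; have r1' : 0 < 1 - rho by rewrite subr_gt0.
set L := E / (1 - rho); pose d m := `|L - u m|.
have dS m : d m.+1 <= rho * d m + `|E - e m|.
  have -> : d m.+1 = `|rho * (L - u m) + (E - e m)|.
    congr `|_|; rewrite rec (_ : E = L * (1 - rho)); first by ring.
    by rewrite divfK// gt_eqF.
  by rewrite (le_trans (ler_normD _ _))// normrM (ger0_norm r0).
apply/cvgrPdist_le => eps eps0.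
have /cvgrPdist_le/(_ (eps / 2 * (1 - rho)))[|N _ HN] := eE.
  by rewrite mulr_gt0// divr_gt0.
have dN k : d (N + k)%N <= rho ^+ k * d N + eps / 2.
  elim: k => [|k IH]; first by rewrite addn0 expr0 mul1r lerDl divr_ge0// ltW.
  rewrite addnS (le_trans (dS _))//.
  apply: (@le_trans _ _ (rho * (rho ^+ k * d N + eps / 2) + eps / 2 * (1 - rho))).
    by rewrite lerD ?ler_wpM2l// HN//= leq_addr.
  by rewrite exprS le_eqVlt; apply/orP; left; apply/eqP; ring.
have : d N * rho ^+ k @[k --> \oo] --> 0.
  by rewrite -[X in _ --> X](mulr0 (d N)); apply: cvgMr; apply: cvg_expr; rewrite ger0_norm.
move=> /cvgrPdist_le/(_ (eps / 2))[|N' _ HN']; first by rewrite divr_gt0.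
exists (N + N')%N => // m /= Nm; rewrite -/(d m).
have -> : m = (N + (m - N))%N by rewrite subnKC// (leq_trans (leq_addr _ _) Nm).
rewrite (le_trans (dN _))// [leRHS](splitr eps) lerD2r.
have /= := HN' (m - N)%N; rewrite sub0r normrN mulrC => H.
by rewrite (le_trans (ler_norm _))// H// leq_subRL// (leq_trans (leq_addr _ _) Nm).
Qed.

Lemma cvg_coefX (R : realType) (A : nat -> {poly R}) (B : {poly R}) N z i :
  (forall j, (j <= N)%N -> (A m)`_j @[m --> \oo] --> B`_j) -> (i <= N)%N ->
  (A m ^+ z)`_i @[m --> \oo] --> (B ^+ z)`_i.
Proof.
move=> AB; elim: z i => [|z IH] i iN.
  by under eq_fun do rewrite expr0; rewrite expr0; exact: cvg_cst.
rewrite exprS coefM (_ : (fun m => _) = (fun m => \sum_(j < i.+1) (A m)`_j * (A m ^+ z)`_(i - j))).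
  apply: (@cvg_big R _ +%R 0); first exact: add_continuous.
  move=> j _; have jN : (j <= N)%N by rewrite (leq_trans _ iN)// -ltnS.
  by apply: cvgM; [exact: AB|apply: IH; rewrite (leq_trans (leq_subr _ _))].
by apply/funext => m; rewrite exprS coefM.
Qed.

Section real_expectation.
Variables (R : realType) (P : probability tree R).
Implicit Types F G H : tree -> R.

Definition rE F : R := fine ('E_P[F])%E.

(** Integrability of [F] through an integrable majorant, which is what
    differences, limits and positivity of expectations need here. *)
Definition dominates H F := [/\ measurable_fun [set: tree] F, measurable_fun [set: tree] H,
  (forall t, `|F t| <= H t) & ('E_P[H] < +oo)%E].

Lemma dominates_integrable F H : dominates H F -> P.-integrable setT (EFin \o F).
Proof.
case=> mF mH FH EH; apply: (@le_integrable _ _ _ P _ measurableT _ (EFin \o H)).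
- exact/measurable_EFinP.
- by move=> t _ /=; rewrite lee_fin (le_trans (FH t))// ler_norm.
- apply/integrableP; split; first exact/measurable_EFinP.
  move: EH; rewrite unlock; apply: le_lt_trans; rewrite le_eqVlt; apply/orP; left; apply/eqP.
  by apply: eq_integral => t _ /=; rewrite ger0_norm// (le_trans (normr_ge0 _) (FH t)).
Qed.

Lemma rE_fin F H : dominates H F -> ('E_P[F] = (rE F)%:E)%E.
Proof.
move=> /dominates_integrable iF; rewrite /rE fineK// unlock.
exact: integrable_fin_num.
Qed.

Lemma rE_sub F1 F2 H1 H2 : dominates H1 F1 -> dominates H2 F2 ->
  rE (fun t => F1 t - F2 t) = rE F1 - rE F2.
Proof.
move=> /dominates_integrable i1 /dominates_integrable i2.
by rewrite /rE unlock; exact: (RintegralB measurableT i1 i2).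
Qed.

Lemma rE_scale (c : R) F H : dominates H F -> rE (fun t => c * F t) = c * rE F.
Proof.
move=> /dominates_integrable iF.
by rewrite /rE unlock; exact: (RintegralZl c measurableT iF).
Qed.

Lemma rE_ge0 F : (forall t, 0 <= F t) -> 0 <= rE F.
Proof. by move=> F0; rewrite fine_ge0// expectation_ge0. Qed.

Lemma rE_cvg (F : nat -> tree -> R) G H : (forall m, dominates H (F m)) ->
  dominates H G -> {ae P, forall t, F m t @[m --> \oo] --> G t} ->
  rE (F m) @[m --> \oo] --> rE G.
Proof.
move=> dF dG FG.
have : ('E_P[F m] @[m --> \oo] --> (rE G)%:E)%E.
  rewrite -(rE_fin dG) unlock.
  have [|||||_ _] := @dominated_convergence _ _ _ P setT measurableT
    (fun m => EFin \o F m) (EFin \o G) (EFin \o H); last exact.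
  - by move=> m; case: (dF m) => mF _ _ _; apply/measurable_EFinP.
  - by case: dG => mG _ _ _; apply/measurable_EFinP.
  - by apply: filterS FG => t Ft _; apply: cvg_EFin; [exact: nearW|exact: Ft].
  - case: dG => _ mH GH EH; apply: (@dominates_integrable _ H); split=> // t.
    by rewrite ger0_norm// (le_trans (normr_ge0 _) (GH t)).
  - by apply: aeW => t m _ /=; rewrite lee_fin; case: (dF m).
by move=> /fine_cvgP[_].
Qed.

Lemma rE_gt0 F H : dominates H F -> (forall t, 0 <= F t) ->
  ~ {ae P, forall t, F t = 0} -> 0 < rE F.
Proof.
move=> dF F0 nF; rewrite lt0r rE_ge0// andbT; apply/eqP => E0; apply: nF.
have mF : measurable_fun [set: tree] (EFin \o F) by case: dF => mF _ _ _; apply/measurable_EFinP.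
have /ae_eq_integral_abs : measurable [set: tree] by [].
move=> /(_ _ P _ mF)[+ _]; rewrite (_ : (\int[P]_(t in _) _)%E = 0%E); last first.
  have := rE_fin dF; rewrite E0 unlock => {}E0; rewrite -[RHS]E0; apply: eq_integral => t _ /=.
  by rewrite ger0_norm.
by move=> /(_ erefl); apply: filterS => t /(_ I) /= [].
Qed.

Lemma ae_eq_rE F G : measurable_fun [set: tree] F -> measurable_fun [set: tree] G ->
  {ae P, forall t, F t = G t} -> rE F = rE G.
Proof.
move=> mF mG FG; rewrite /rE unlock; congr fine; apply: ae_eq_integral => //.
- exact/measurable_EFinP.
- exact/measurable_EFinP.
- by apply: filterS FG => t /= -> _.
Qed.

End real_expectation.

Section derivatives.
Variable R : realType.

Lemma expRN_chord (x y : R) :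
  (y - x) * expR (- y) <= expR (- x) - expR (- y) <= (y - x) * expR (- x).
Proof.
have H (u v : R) : expR (- u) - expR (- v) <= (v - u) * expR (- u).
  have -> : expR (- v) = expR (- u) * expR (- (v - u)) by rewrite -expRD; congr expR; ring.
  rewrite -[X in X - _]mulr1 -mulrBr mulrC ler_wpM2r ?expR_ge0//.
  by have := expR_ge1Dx (- (v - u)); lra.
rewrite H andbT; have := H y x; lra.
Qed.

(** The one-sided derivative is read along sequences. A sequence may take the
    value [b], where the difference quotient is extended by its limit. *)
Lemma deriv_nnegE (f g : R -> R) (b l : R) : 0 <= b -> (forall y, 0 <= y -> f y = g y) ->
  (forall u : nat -> R, (forall k, 0 <= u k) -> u k @[k --> \oo] --> b ->
    (if u k == b then l else (u k - b)^-1 * (g (u k) - g b)) @[k --> \oo] --> l) ->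
  deriv_nneg f b = l.
Proof.
move=> b0 fg H.
pose G (y : R) := let x := Num.max y 0 in if x == b then l else (x - b)^-1 * (g x - g b).
have Gb : G b = l by rewrite /G max_l// eqxx.
have cG : G y @[y --> b] --> l.
  apply/(@cvg_nbhsP _ R^o) => u ub; apply: (H (fun k => Num.max (u k) 0)).
    by move=> k; rewrite le_max lexx orbT.
  apply/cvgrPdist_le => e e0; have /cvgrPdist_le/(_ e e0) := ub; apply: filterS => k.
  apply: le_trans; case: (leP (u k) 0) => [uk|//]; rewrite subr0 !ger0_norm ?subr_ge0 ?(le_trans uk)//.
  by rewrite lerBrDr gerDl.
rewrite /deriv_nneg; set F := within _ _.
have PF : ProperFilter F.
  apply: Build_ProperFilter_ex => A /= [e /= e0 He].
  exists (b + e / 2); apply: He => //=.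
  - by rewrite opprD addNKr normrN gtr0_norm ?divr_gt0// ltr_pdivrMr// ltr_pMr// ltr1n.
  - by rewrite -subr_eq0 addrAC subrr add0r gt_eqF// divr_gt0.
  - by rewrite addr_ge0// divr_ge0// ltW.
apply: cvg_lim => //.
have : G y @[y --> F] --> l.
  by apply: cvg_trans cG; apply: cvg_app => A /= [e /= e0 He]; exists e => //= y ye _ _; exact: He.
apply: cvg_trans; apply: near_eq_cvg.
exists 1 => //= y _ yb y0; rewrite /G max_l//= (negbTE yb) fg// fg//.
by rewrite mulrC.
Qed.

End derivatives.

(** * Subcritical generating functions with a second fixed point *)

Section subcritical.
Variables (R : realType) (q : nat -> R) (kappa : R) (D : nat).
Hypotheses (q_off : is_offspring q) (q_sub : (mean q < 1)%E) (kappa1 : 1 < kappa).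
Hypothesis kappa_fix : gfD q 0 kappa = kappa%:E.
Hypotheses (D1 : (1 <= D)%N) (kappa_fin : (gfD q D kappa < +oo)%E).

Let q0 n : 0 <= q n. Proof. by case: q_off. Qed.

Definition gf (x : R) : \bar R := (\sum_(0 <= n <oo) (q n * x ^+ n)%:E)%E.

(** The quotient [(f x - 1) / (x - 1)] for the generating function [f],
    expanded so that it makes sense at [1], where it is the mean. *)
Definition slope (x : R) : \bar R := (\sum_(0 <= n <oo) (q n * \sum_(i < n) x ^+ i)%:E)%E.

Let geo_ge0 n (x : R) : 0 <= x -> 0 <= \sum_(i < n) x ^+ i.
Proof. by move=> x0; apply: sumr_ge0 => i _; exact: exprn_ge0. Qed.

Lemma gf_fix : gf kappa = kappa%:E.
Proof.
rewrite -kappa_fix; apply: eq_eseriesr => n _.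
by rewrite ffactn0 subn0 mulr1.
Qed.

Lemma gf_slope x : 1 <= x -> gf x = (1 + (x - 1)%:E * slope x)%E.
Proof.
move=> x1; have x0 : 0 <= x by exact: le_trans x1.
case: (q_off) => _ <-.
rewrite -nneseriesZl; last by move=> n _; rewrite lee_fin mulr_ge0// geo_ge0.
rewrite -nneseriesD; last 2 first.
- by move=> n _ _; rewrite lee_fin.
- by move=> n _ _; rewrite -EFinM lee_fin !mulr_ge0 ?subr_ge0// geo_ge0.
apply: eq_eseriesr => n _; rewrite -EFinM -EFinD; congr EFin.
by rewrite mulrCA -subrX1; ring.
Qed.

Lemma slope_ge0 x : 0 <= x -> (0 <= slope x)%E.
Proof. by move=> x0; apply: nneseries_ge0 => n _ _; rewrite lee_fin mulr_ge0// geo_ge0. Qed.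

Lemma le_slope x y : 0 <= x -> x <= y -> (slope x <= slope y)%E.
Proof.
move=> x0 xy; apply: lee_nneseries => [n _|n _]; first by rewrite lee_fin mulr_ge0// geo_ge0.
rewrite lee_fin ler_wpM2l// ler_sum// => i _.
by rewrite lerXn2r// nnegrE// (le_trans x0).
Qed.

Lemma slope_kappa : slope kappa = 1%E.
Proof.
have := gf_slope (ltW kappa1); rewrite gf_fix.
have := slope_ge0 (ltW (lt_trans ltr01 kappa1)).
case: (slope kappa) => [s|_|//] //.
  move=> _; rewrite -EFinM -EFinD => -[] H; congr EFin.
  have k1 : kappa - 1 != 0 by rewrite subr_eq0 gt_eqF.
  by apply: (mulfI k1); rewrite mulr1 [in RHS]H; ring.
by rewrite gt0_muley ?lte_fin ?subr_gt0// addey.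
Qed.

Lemma slope1 : slope 1 = mean q.
Proof.
apply: eq_eseriesr => n _; congr EFin; rewrite mulrC; congr (_ * _).
rewrite (eq_bigr (fun=> 1)); last by move=> i _; rewrite expr1n.
by rewrite sumr_const card_ord.
Qed.

Let le_term (u : nat -> R) k : (forall n, 0 <= u n) ->
  ((u k)%:E <= \sum_(0 <= n <oo) (u n)%:E)%E.
Proof.
move=> u0; apply: (@le_trans _ _ (\sum_(0 <= n < k.+1) (u n)%:E)%E); last first.
  by apply: nneseries_lim_ge => n _ _; rewrite lee_fin.
by rewrite big_nat_recr//= leeDr// sume_ge0// => n _; rewrite lee_fin.
Qed.

(** The slope is below [1] at [1] and equal to [1] at [kappa], so that the
    generating function is not affine. *)
Lemma offspring_ge2 : exists2 k, (2 <= k)%N & 0 < q k.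
Proof.
apply: contrapT => H.
have qz k : (2 <= k)%N -> q k = 0.
  move=> k2; apply/eqP; rewrite eq_le q0 andbT leNgt; apply/negP => qk.
  by apply: H; exists k.
suff E : mean q = slope kappa by move: q_sub; rewrite E slope_kappa ltxx.
rewrite -slope1; apply: eq_eseriesr => n _; congr EFin.
case: n => [|[|n]]; rewrite ?big_ord0 ?big_ord1 ?expr0// qz// !mul0r //.
Qed.

Lemma mean_fin : mean q = (fine (mean q))%:E.
Proof.
rewrite fineK// ge0_fin_numE ?(lt_trans q_sub)// ?ltry//.
by rewrite -slope1 slope_ge0.
Qed.

Lemma mean_gt0 : 0 < fine (mean q).
Proof.
have [k k2 qk] := offspring_ge2; rewrite -lte_fin -mean_fin.
apply: lt_le_trans (le_term (u := fun n => n%:R * q n) k _); last by move=> n; rewrite mulr_ge0.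
by rewrite lte_fin mulr_gt0// ltr0n (leq_trans _ k2).
Qed.

Lemma mean_lt1 : fine (mean q) < 1.
Proof. by rewrite -lte_fin -mean_fin. Qed.

Let strict_series (u v : nat -> R) k : (forall n, 0 <= u n) -> (forall n, u n <= v n) ->
  u k < v k -> (\sum_(0 <= n <oo) (v n)%:E < +oo)%E ->
  (\sum_(0 <= n <oo) (u n)%:E < \sum_(0 <= n <oo) (v n)%:E)%E.
Proof.
move=> u0 uv ukv vf.
have uf : (\sum_(0 <= n <oo) (u n)%:E < +oo)%E.
  by apply: le_lt_trans vf; apply: lee_nneseries => n _; rewrite lee_fin.
have -> : (\sum_(0 <= n <oo) (v n)%:E =
    \sum_(0 <= n <oo) (u n)%:E + \sum_(0 <= n <oo) (v n - u n)%:E)%E.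
  rewrite -nneseriesD; last 2 first.
  - by move=> n _ _; rewrite lee_fin.
  - by move=> n _ _; rewrite lee_fin subr_ge0.
  by apply: eq_eseriesr => n _; rewrite -EFinD; congr EFin; ring.
rewrite lteDl; last by rewrite ge0_fin_numE// nneseries_ge0// => n _ _; rewrite lee_fin.
apply: lt_le_trans (le_term (u := fun n => v n - u n) k _); first by rewrite lte_fin subr_gt0.
by move=> n; rewrite subr_ge0.
Qed.

Lemma slope_lt1 r : 1 <= r < kappa -> (slope r < 1)%E.
Proof.
move=> /andP[r1 rk]; have r0 : 0 <= r by exact: le_trans r1.
rewrite -slope_kappa; have [k k2 qk] := offspring_ge2.
have geo_le n : \sum_(i < n) r ^+ i <= \sum_(i < n) kappa ^+ i.
  by apply: ler_sum => i _; rewrite lerXn2r ?nnegrE ?(ltW (lt_trans ltr01 kappa1))// ltW.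
apply: (strict_series (k := k)).
- by move=> n; rewrite mulr_ge0// geo_ge0.
- by move=> n; rewrite ler_wpM2l.
- rewrite ltr_pM2l//; case: k k2 {qk} => [|[|k]]// _.
  rewrite !big_ord_recl /= !expr0 ltrD2l ltr_leD// ?expr1//.
  by apply: ler_sum => i _; rewrite lerXn2r ?nnegrE ?(ltW (lt_trans ltr01 kappa1))// ltW.
- by rewrite -/(slope kappa) slope_kappa ltry.
Qed.

Lemma gf_fin x : 0 <= x <= kappa -> gf x \is a fin_num.
Proof.
move=> /andP[x0 xk]; rewrite ge0_fin_numE; last first.
  by apply: nneseries_ge0 => n _ _; rewrite lee_fin mulr_ge0// exprn_ge0.
apply: (@le_lt_trans _ _ (gf kappa)); last by rewrite gf_fix ltry.
apply: lee_nneseries => [n _|n _]; first by rewrite lee_fin mulr_ge0// exprn_ge0.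
by rewrite lee_fin ler_wpM2l// lerXn2r// nnegrE (le_trans x0).
Qed.

Lemma slope_fin x : 0 <= x <= kappa -> slope x \is a fin_num.
Proof.
move=> /andP[x0 xk]; rewrite ge0_fin_numE ?slope_ge0//.
by rewrite (le_lt_trans (le_slope x0 xk))// slope_kappa ltry.
Qed.

(** Up to the finitely many [n] below [D], the lower factorial powers are
    bounded by the one of order [D]. *)
Lemma bin_series_fin i : (i <= D)%N ->
  (\sum_(0 <= n <oo) (q n * 'C(n, i)%:R * kappa ^+ n)%:E < +oo)%E.
Proof.
move=> iD; have k0 : 0 <= kappa by exact/ltW/(lt_trans ltr01).
have k1 n m : (n <= m)%N -> kappa ^+ n <= kappa ^+ m by move=> nm; rewrite ler_weXn2l// ltW.
pose K : R := 2 ^+ D * kappa ^+ D.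
apply: (@le_lt_trans _ _ (K%:E * (\sum_(0 <= n <oo) (q n)%:E) + (kappa ^+ D)%:E * gfD q D kappa)%E); last first.
  case: q_off => _ ->; rewrite mule1 lte_add_pinfty ?ltry//.
  by rewrite lte_mul_pinfty ?fin_numE ?lee_fin ?exprn_ge0.
rewrite -!nneseriesZl; last 2 first.
- by move=> n _; rewrite lee_fin !mulr_ge0// exprn_ge0.
- by move=> n _; rewrite lee_fin.
rewrite -nneseriesD; last 2 first.
- by move=> n _ _; rewrite -EFinM lee_fin !mulr_ge0// exprn_ge0.
- by move=> n _ _; rewrite -EFinM lee_fin !mulr_ge0// exprn_ge0.
apply: lee_nneseries => [n _|n _]; first by rewrite lee_fin !mulr_ge0// exprn_ge0.
rewrite -!EFinM -EFinD lee_fin.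
have -> : K * q n + kappa ^+ D * (q n * (n ^_ D)%:R * kappa ^+ (n - D)) =
    q n * (K + (n ^_ D)%:R * (kappa ^+ D * kappa ^+ (n - D))) by ring.
rewrite -mulrA ler_wpM2l//; case: (ltnP n D) => nD.
  rewrite -[leLHS]addr0 lerD ?mulr_ge0 ?exprn_ge0// /K ler_pM ?exprn_ge0 ?k1 ?(ltnW nD)//.
  apply: (@le_trans _ _ (2 ^+ n)); last by rewrite ler_weXn2l ?(ltnW nD)// ler1n.
  have := @bin_geo R 1 n i ler01; rewrite expr1n mulr1 => /le_trans; apply.
  by rewrite -natr1.
rewrite -exprD subnKC// -[leLHS]add0r lerD ?mulr_ge0 ?exprn_ge0//.
rewrite ler_wpM2r ?exprn_ge0// ler_nat.
have H : ('C(n, i) <= n ^_ i)%N by rewrite -bin_ffact leq_pmulr// fact_gt0.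
apply: leq_trans H _; rewrite -(subnKC iD); move: nD; rewrite -{1}(subnKC iD).
elim: (D - i)%N => [|l IH] nl; rewrite ?addn0// addnS ffactnSr.
by rewrite (leq_trans (IH _))// ?leq_pmulr; lia.
Qed.

Lemma gfD1_fin : gfD q 1 kappa = (fine (gfD q 1 kappa))%:E.
Proof.
have k0 : 0 < kappa by exact: (lt_trans ltr01).
rewrite fineK// ge0_fin_numE; last first.
  by apply: nneseries_ge0 => n _ _; rewrite lee_fin !mulr_ge0// exprn_ge0// ltW.
apply: le_lt_trans (bin_series_fin D1).
apply: lee_nneseries => [n _|n _]; first by rewrite lee_fin !mulr_ge0// exprn_ge0// ltW.
rewrite lee_fin ffactn1 bin1 ler_wpM2l ?mulr_ge0// ler_weXn2l ?leq_subr// ltW//.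
Qed.

(** A strictly convex function crosses the diagonal at [kappa] from below: the
    derivative there exceeds the slope between [1] and [kappa], which is [1]. *)
Lemma gfD1_gt1 : 1 < fine (gfD q 1 kappa).
Proof.
rewrite -lte_fin -gfD1_fin -slope_kappa; have [k k2 qk] := offspring_ge2.
have k0 : 0 <= kappa by exact/ltW/(lt_trans ltr01).
have sumle n : \sum_(i < n) kappa ^+ i <= \sum_(i < n) kappa ^+ (n - 1).
  by apply: ler_sum => i _; rewrite ler_weXn2l ?(ltW kappa1)//; have := ltn_ord i; lia.
have sumE n : \sum_(i < n) kappa ^+ (n - 1) = (n ^_ 1)%:R * kappa ^+ (n - 1).
  by rewrite sumr_const card_ord ffactn1 mulr_natl.
rewrite /gfD; under [ltRHS]eq_eseriesr do rewrite -mulrA -sumE.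
apply: (strict_series (k := k)).
- by move=> n; rewrite mulr_ge0// geo_ge0.
- by move=> n; rewrite ler_wpM2l.
- rewrite ltr_pM2l//; case: k k2 {qk} => [|[|k]]// _.
  rewrite 2!big_ord_recl [ltRHS]big_ord_recl ltr_leD//; first by rewrite expr0 exprn_egt1//; lia.
  rewrite [leRHS]big_ord_recl lerD//; first by rewrite ler_weXn2l ?(ltW kappa1)//; rewrite lift0; lia.
  by apply: ler_sum => i _; rewrite ler_weXn2l ?(ltW kappa1)// !lift0; have := ltn_ord i; lia.
- have := gfD1_fin; rewrite /gfD; under eq_eseriesr do rewrite -mulrA -sumE.
  by move=> ->; rewrite ltry.
Qed.

(** A second-order expansion at [1]: the second derivative is bounded between
    [1] and [r] because the series still converges at [kappa], beyond [r]. *)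
Lemma slope_le r : 1 <= r < kappa -> exists2 C : R, 0 <= C &
  forall x, 1 <= x <= r -> (slope x <= mean q + (C * (x - 1))%:E)%E.
Proof.
move=> /andP[r1 rk]; have r0 : 0 < r by exact: lt_le_trans r1.
have k0 : 0 <= kappa by exact/ltW/(lt_trans ltr01).
pose e := kappa / r - 1.
have e0 : 0 < e by rewrite /e subr_gt0 ltr_pdivlMr// mul1r.
have e20 : 0 <= e ^- 2 by rewrite invr_ge0 exprn_ge0// ltW.
exists (e ^- 2 * kappa); first by rewrite mulr_ge0 ?invr_ge0 ?exprn_ge0 ?(ltW e0)// ltW// (lt_trans ltr01).
move=> x /andP[x1 xr]; have x0 : 0 <= x by exact: le_trans x1.
have -> : (e ^- 2 * kappa * (x - 1))%:E = (\sum_(0 <= n <oo) ((e ^- 2 * (x - 1)) * (q n * kappa ^+ n))%:E)%E.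
  under eq_eseriesr do rewrite EFinM.
  rewrite nneseriesZl ?gf_fix; last by move=> n _; rewrite lee_fin mulr_ge0// exprn_ge0// ltW// (lt_trans ltr01).
  by rewrite -/(gf kappa) gf_fix -EFinM; congr EFin; ring.
rewrite -slope1 -nneseriesD; last 2 first.
- by move=> n _ _; rewrite lee_fin mulr_ge0// geo_ge0.
- by move=> n _ _; rewrite lee_fin mulr_ge0 ?(mulr_ge0 e20) ?subr_ge0// mulr_ge0// exprn_ge0.
apply: lee_nneseries => [n _|n _]; first by rewrite lee_fin mulr_ge0// geo_ge0.
rewrite -EFinD lee_fin.
have -> : q n * (\sum_(i < n) 1 ^+ i) + e ^- 2 * (x - 1) * (q n * kappa ^+ n) =
  q n * (\sum_(i < n) 1 ^+ i + (x - 1) * (e ^- 2 * kappa ^+ n)) by ring.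
rewrite ler_wpM2l// -lerBlDl -sumrB.
apply: (@le_trans _ _ ((x - 1) * ('C(n, 2)%:R * r ^+ n))); last first.
  rewrite ler_wpM2l ?subr_ge0// [leRHS]mulrC ler_pdivlMr ?exprn_gt0//.
  rewrite (_ : kappa = r * (1 + e)); last by rewrite /e; field; rewrite gt_eqF.
  by rewrite exprMn mulrAC [X in X <= _]mulrC ler_wpM2l ?exprn_ge0 ?(ltW r0)// bin_geo// ltW.
rewrite -triangular_sum big_mkord natr_sum big_distrl big_distrr /=; apply: ler_sum => i _.
rewrite expr1n subrX1 ler_wpM2l ?subr_ge0//.
apply: (@le_trans _ _ (\sum_(j < i) r ^+ n)); last by rewrite sumr_const card_ord mulr_natl.
apply: ler_sum => j _; apply: (@le_trans _ _ (r ^+ j)).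
  by rewrite lerXn2r ?nnegrE ?(ltW r0).
by rewrite ler_weXn2l// ltnW// (ltn_trans (ltn_ord j)).
Qed.

Definition gfR (x : R) : R := fine (gf x).

(** Iterates of the generating function from a point below [kappa] approach
    [1] at the exact rate of the mean: they do so geometrically, the slope
    being below [1], and this makes the second-order corrections summable. *)
Lemma iter_gf_le r : 1 <= r < kappa -> exists2 C : R, 0 <= C &
  forall m, iter m gfR r - 1 <= C * fine (mean q) ^+ m /\ 1 <= iter m gfR r <= r.
Proof.
move=> rk'; have [C C0 HC] := slope_le rk'; have /andP[r1 rk] := rk'.
have sl x : 1 <= x <= r -> slope x = (fine (slope x))%:E.
  move=> /andP[x1 xr]; rewrite fineK// slope_fin// (le_trans _ x1)//=.
  by rewrite (le_trans xr)// ltW.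
pose rho := fine (slope r); pose mu := fine (mean q).
have rho1 : rho < 1 by rewrite -lte_fin -sl ?slope_lt1// r1 lexx.
have rho0 : 0 <= rho by rewrite fine_ge0// slope_ge0// (le_trans _ r1).
have mu0 : 0 < mu by exact: mean_gt0.
have gE x : 1 <= x <= r -> gfR x - 1 = (x - 1) * fine (slope x).
  move=> xr; have /andP[x1 _] := xr.
  by rewrite /gfR gf_slope// sl// -EFinM -EFinD /=; ring.
have sr x : 1 <= x <= r -> 0 <= fine (slope x) <= rho.
  move=> xr; have /andP[x1 xr'] := xr; have x0 : 0 <= x by exact: le_trans x1.
  rewrite fine_ge0 ?slope_ge0//= -lee_fin -sl// -sl ?r1 ?lexx//.
  exact: le_slope.
have sm x : 1 <= x <= r -> fine (slope x) <= mu + C * (x - 1).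
  by move=> xr; rewrite -lee_fin -sl// EFinD -mean_fin HC.
have It m : 1 <= iter m gfR r <= r /\ iter m gfR r - 1 <= (r - 1) * rho ^+ m.
  elim: m => [|m [xr IH]]; first by rewrite r1 lexx expr0 mulr1.
  have /andP[x1 xr'] := xr; have /andP[s0 sr'] := sr _ xr.
  have H : iter m.+1 gfR r - 1 <= (iter m gfR r - 1) * rho.
    by rewrite iterS gE// ler_wpM2l// subr_ge0.
  split; last by rewrite (le_trans H)// exprSr mulrA ler_wpM2r.
  rewrite -subr_ge0 {1}iterS gE// mulr_ge0 ?subr_ge0//=.
  rewrite -(lerD2r (-1)) (le_trans H)// -[leRHS]mulr1; apply: ler_pM => //.
  - by rewrite subr_ge0.
  - by rewrite lerD2r.
  - exact: ltW.
pose K := C * (r - 1) / mu.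
have K0 : 0 <= K by rewrite !mulr_ge0 ?subr_ge0 ?invr_ge0// ltW.
have Bd m : iter m gfR r - 1 <= (r - 1) * expR (K * \sum_(k < m) rho ^+ k) * mu ^+ m.
  elim: m => [|m IH]; first by rewrite big_ord0 mulr0 expR0 expr0 !mulr1.
  have [xr Hm] := It m; have /andP[x1 _] := xr.
  rewrite iterS gE//; set y := iter m gfR r - 1 in IH Hm *.
  have y0 : 0 <= y by rewrite subr_ge0.
  apply: (@le_trans _ _ (y * (mu * expR (K * rho ^+ m)))).
    rewrite ler_wpM2l// (le_trans (sm _ xr))//.
    apply: (@le_trans _ _ (mu * (1 + K * rho ^+ m))).
      rewrite [leRHS]mulrDr mulr1 lerD2l -/y (_ : mu * (K * rho ^+ m) = C * ((r - 1) * rho ^+ m)).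
        by rewrite ler_wpM2l.
      by rewrite /K; field; rewrite gt_eqF.
    by rewrite ler_pM2l// expR_ge1Dx.
  rewrite big_ord_recr mulrDr expRD exprSr.
  rewrite [leRHS](_ : _ = ((r - 1) * expR (K * \sum_(k < m) rho ^+ k) * mu ^+ m) * (mu * expR (K * rho ^+ m))); last by ring.
  by rewrite ler_wpM2r// mulr_ge0 ?expR_ge0// ltW.
exists ((r - 1) * expR (K / (1 - rho))).
  by rewrite mulr_ge0 ?subr_ge0 ?expR_ge0.
move=> m; split; last by case: (It m).
rewrite (le_trans (Bd m))// ler_wpM2r ?exprn_ge0 ?(ltW mu0)// ler_wpM2l ?subr_ge0//.
rewrite ler_expR ler_wpM2l// -[leRHS]mul1r ler_pdivlMr ?subr_gt0//.
have := subrX1 rho m; rewrite mulrC => H.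
rewrite -[leLHS]opprK -mulrN opprB -H opprB gerBl exprn_ge0//.
Qed.


(** * Limits below the second fixed point *)

Section below_kappa.
Variable P : probability tree R.
Hypothesis P_GW : is_GW q 0 P.

Let mu := fine (mean q).
Let mu0 : 0 < mu. Proof. exact: (mean_gt0). Qed.
Let mu1 : mu < 1. Proof. exact: (mean_lt1). Qed.

Lemma gf_le r : 1 <= r < kappa -> (gf r <= r%:E)%E.
Proof.
move=> rk; have /andP[r1 _] := rk; have r0 : 0 <= r by exact: le_trans r1.
rewrite gf_slope//; have -> : r%:E = (1 + (r - 1)%:E)%E by rewrite -EFinD; congr EFin; ring.
rewrite leeD2l// -[leRHS]mule1 lee_wpmul2l//.
  by rewrite lee_fin subr_ge0.
exact/ltW/(slope_lt1).
Qed.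

(** The series of the generating function still converges at [kappa], and the
    factor [(kappa / r) ^+ n] absorbs the binomial coefficient. *)
Lemma bin_series_fin_lt r i : 1 <= r < kappa ->
  (\sum_(0 <= n <oo) (q n * 'C(n, i)%:R * r ^+ n)%:E < +oo)%E.
Proof.
move=> /andP[r1 rk]; have r0 : 0 < r by exact: lt_le_trans r1.
have k0 : 0 <= kappa by exact/ltW/(lt_trans ltr01).
pose e := kappa / r - 1.
have e0 : 0 < e by rewrite /e subr_gt0 ltr_pdivlMr// mul1r.
apply: (@le_lt_trans _ _ ((e ^- i)%:E * gf kappa)%E); last first.
  by rewrite gf_fix -EFinM ltry.
rewrite -nneseriesZl; last by move=> n _; rewrite lee_fin mulr_ge0// exprn_ge0.
apply: lee_nneseries => [n _|n _].
  by rewrite lee_fin !mulr_ge0// exprn_ge0// ltW.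
rewrite -EFinM lee_fin -mulrA [leRHS]mulrCA ler_wpM2l// [leRHS]mulrC ler_pdivlMr ?exprn_gt0//.
rewrite (_ : kappa = r * (1 + e)); last by rewrite /e; field; rewrite gt_eqF.
by rewrite exprMn mulrAC [X in X <= _]mulrC ler_wpM2l ?exprn_ge0 ?(ltW r0)// bin_geo// ltW.
Qed.

Section fixed_degree.
Variable (p : nat).

Lemma jetn0E r A m : 1 <= r < kappa -> jdom r A ->
  (jetn p q m A)`_0 = iter m (gfR) A`_0.
Proof.
move=> rk dA; have /andP[r1 _] := rk.
have J := @jdom_jetn _ p _ _ q0 r1 (gf_le rk) (fun i _ => bin_series_fin_lt i rk).
have S := @jetnS _ p q.
elim: m => [//|m IH]; rewrite S iterS -IH.
apply: EFin_inj.
rewrite (@jet0E _ p _ _ q0 r1 (fun i _ => bin_series_fin_lt i rk)); last exact: J.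
rewrite /gfR fineK//; have [B0 Br] := J m _ dA.
apply: gf_fin => //.
by rewrite B0 (le_trans Br)//; case/andP: rk => _ /ltW.
Qed.

Lemma expectation_coef r A m i : 1 <= r < kappa -> jdom r A -> (i <= p)%N ->
  ('E_P[fun t => ((A ^+ zcard m t)`_i)%R] = ((jetn p q m A)`_i)%:E)%E.
Proof.
move=> rk dA ip; have /andP[r1 _] := rk.
have := @coef_jetn _ p _ 0 _ q_off P_GW m A i; rewrite addn0; apply => //; first by case: dA.
exact: (@jetn_jfin _ p _ _ q0 r1 (gf_le rk) (fun i _ => bin_series_fin_lt i rk)).
Qed.

End fixed_degree.

Lemma jdom_lin (r s : R) : 0 <= s <= r -> jdom r (s%:P + s *: 'X).
Proof.
move=> /andP[s0 sr]; split; last by rewrite coefD coefC coefZ coefX mulr0 addr0.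
move=> i; rewrite coefD coefC coefZ coefX.
by case: i => [|[|i]]; rewrite /= ?mulr0 ?mulr1 ?addr0 ?add0r.
Qed.

Lemma expectation_exp r m : 1 <= r < kappa ->
  ('E_P[fun t => (r ^+ zcard m t)%R] = (iter m (gfR) r)%:E)%E.
Proof.
move=> rk; have /andP[r1 _] := rk; have r0 : 0 <= r by exact: le_trans r1.
have dr : jdom r (r%:P + r *: 'X) by apply: jdom_lin; rewrite r0 lexx.
have := expectation_coef m rk dr (leqnn 0).
rewrite (jetn0E _ _ rk dr) coefD coefC coefZ coefX mulr0 addr0 => <-.
by congr ('E_P[_])%E; apply/funext => t; rewrite coef_binom bin0 mul1r.
Qed.

Lemma expectation_zcard m : ('E_P[fun t => ((zcard m t)%:R)%R] = (mu ^+ m)%:E)%E.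
Proof.
have rk : 1 <= (1 : R) < kappa by rewrite lexx.
have dA : jdom (1 : R) (1%:P + 1 *: 'X) by apply: jdom_lin; rewrite ler01 lexx.
have := @expectation_coef 1 1 _ m 1 rk dA (leqnn 1).
rewrite (_ : 'E_P[_] = 'E_P[fun t => ((zcard m t)%:R)%R])%E; last first.
  by congr ('E_P[_])%E; apply/funext => t; rewrite coef_binom bin1 expr1n mulr1.
move=> ->; congr EFin.
suff [] : (jetn 1 q m (1%:P + 1 *: 'X))`_0 = 1 /\ (jetn 1 q m (1%:P + 1 *: 'X))`_1 = mu ^+ m by [].
have J := @jdom_jetn _ 1 _ _ q0 (lexx 1) (gf_le rk) (fun i _ => bin_series_fin_lt i rk).
have F := @jdom_jfin _ 1 _ _ q0 (lexx 1) (fun i _ => bin_series_fin_lt i rk).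
elim: m => [|m [IH0 IH1]].
  by rewrite /= !coefD !coefC !coefZ !coefX /= expr0 mulr0 mulr1 addr0 add0r.
rewrite !jetnS; set A := jetn _ _ _ _ in IH0 IH1 *; have [A0 A1] := J m _ dA.
have jA : jfin 1 q A by apply: F; exact: J.
split; apply: EFin_inj; rewrite jetE//.
  rewrite /jser; under eq_eseriesr do rewrite coef0_exp IH0 expr1n mulr1.
  by case: q_off.
rewrite /jser (eq_eseriesr (g := fun n => ((mu ^+ m)%:E * (n%:R * q n)%:E)%E)); last first.
  move=> n _; rewrite coefX_expand !big_ord_recl big_ord0 /= expr0 coef1 mulr0 add0r addr0.
  by rewrite expr1 coefB coefC subr0 IH0 IH1 expr1n mulr1 bin1 -EFinM; congr EFin; ring.
rewrite nneseriesZl; last by move=> n _; rewrite lee_fin mulr_ge0.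
by rewrite -/(mean q) (mean_fin) -EFinM exprSr.
Qed.

(** Since [j > 0], the function [z |-> 'C(z, j) s ^+ z] vanishes at [0] and is
    bounded by a multiple of [r ^+ z - 1] for some [r] with [max s 1 < r <
    kappa]; then [iter_gf_le] applies. *)
Lemma weighted_moment_le p s : 0 <= s < kappa -> exists2 C : R, 0 < C &
  forall m j, (0 < j <= p)%N ->
  ('E_P[fun t => ('C(zcard m t, j)%:R * s ^+ zcard m t)%R] <= (C * mu ^+ m)%:E)%E.
Proof.
move=> /andP[s0 sk].
pose r := (Num.max s 1 + kappa) / 2.
have mk : Num.max s 1 < kappa by rewrite gt_max sk.
have [mr rk] : Num.max s 1 < r /\ r < kappa by rewrite /r; split; lra.
have r1 : 1 < r by rewrite (le_lt_trans _ mr)// le_max lexx orbT.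
have sr : s < r by rewrite (le_lt_trans _ mr)// le_max lexx.
have r0 : 0 < r by exact: lt_trans r1.
have [e [e0 e1 er]] : exists e : R, [/\ 0 < e, e <= 1 & s * (1 + e) <= r].
  have [->|s0'] := eqVneq s 0; first by exists 1; rewrite ltr01 lexx mul0r ltW.
  have sp : 0 < s by rewrite lt0r s0'.
  exists (Num.min 1 (r / s - 1)); split.
  - by rewrite lt_min ltr01 subr_gt0 ltr_pdivlMr// mul1r.
  - by rewrite ge_min lexx.
  - rewrite mulrC -ler_pdivlMr// -lerBrDl.
    by rewrite ge_min lexx orbT.
have rk' : 1 <= r < kappa by rewrite ltW.
have [C C0 HC] := iter_gf_le rk'.
pose K := e ^- p / (1 - r^-1).
have ri : 0 < 1 - r^-1 by rewrite subr_gt0 invf_lt1.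
have K0 : 0 < K by rewrite divr_gt0// invr_gt0 exprn_gt0.
exists (K * (C + 1)); first by rewrite mulr_gt0// ltr_wpDl.
move=> m j /andP[j0 jp].
have key z : 0 <= 'C(z, j)%:R * s ^+ z + K <= K * r ^+ z.
  rewrite addr_ge0 ?(ltW K0) ?mulr_ge0 ?exprn_ge0//=.
  case: z => [|z]; first by rewrite bin0n eqn0Ngt j0 mul0r add0r expr0 mulr1.
  rewrite -lerBrDr.
  have -> : K * r ^+ z.+1 - K = e ^- p * ((r ^+ z.+1 - 1) / (1 - r^-1)) by rewrite /K; ring.
  apply: (@le_trans _ _ (e ^- p * r ^+ z.+1)).
    rewrite [leRHS]mulrC ler_pdivlMr ?exprn_gt0//.
    apply: (@le_trans _ _ ('C(z.+1, j)%:R * s ^+ z.+1 * e ^+ j)).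
      rewrite ler_wpM2l ?mulr_ge0 ?exprn_ge0//.
      by rewrite ler_wiXn2l// ltW.
    rewrite mulrAC mulrC; apply: (@le_trans _ _ ((s * (1 + e)) ^+ z.+1)).
      by rewrite exprMn ler_wpM2l ?exprn_ge0// bin_geo// ltW.
    apply: lerXn2r; rewrite ?nnegrE ?(ltW r0)//.
    by rewrite mulr_ge0// addr_ge0// ltW.
  rewrite ler_pM2l ?invr_gt0 ?exprn_gt0// ler_pdivlMr// mulrBr mulr1 lerB//.
  by rewrite exprS mulrAC divff ?gt_eqF// mul1r exprn_ege1// ltW.
have := @expectation_zcard_le _ P m _ _ key.
rewrite (@expectation_zcardD _ P m (fun z => 'C(z, j)%:R * s ^+ z) (fun=> K)); last 2 first.
- by move=> z; rewrite mulr_ge0// exprn_ge0.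
- by move=> _; exact: ltW.
rewrite (@expectation_zcardZ _ P m K (fun z => r ^+ z)) ?(ltW K0)//; last by move=> z; rewrite exprn_ge0// ltW.
rewrite expectation_exp// (_ : 'E_P[fun=> K] = K%:E)%E; last exact: expectation_cst.
rewrite -EFinM -leeBrDr// -EFinB => /le_trans; apply; rewrite lee_fin.
have -> : K * iter m (gfR) r - K = K * (iter m (gfR) r - 1) by ring.
rewrite -[leRHS]mulrA ler_pM2l//; have [H _] := HC m; rewrite (le_trans H)//.
by rewrite ler_wpM2r ?exprn_ge0 ?(ltW mu0)// lerDl.
Qed.


Lemma jet_term_le p A k i : pge0 A -> jfin p q A -> (i <= p)%N ->
  q k * (A ^+ k)`_i <= (jet p q A)`_i.
Proof.
move=> A0 Af ip; rewrite -lee_fin jetE//.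
apply: (@le_trans _ _ (\sum_(0 <= n < k.+1) (q n * (A ^+ n)`_i)%:E)%E); last first.
  by apply: nneseries_lim_ge => n _ _; rewrite lee_fin mulr_ge0//; exact: pge0X.
rewrite big_nat_recr//= leeDr// sume_ge0// => n _; rewrite lee_fin mulr_ge0//; exact: pge0X.
Qed.

Lemma coefM_ge (A B : {poly R}) i j : pge0 A -> pge0 B -> A`_i * B`_j <= (A * B)`_(i + j).
Proof.
move=> A0 B0; have ij : (i < (i + j).+1)%N by rewrite ltnS leq_addr.
rewrite coefM (bigD1 (Ordinal ij))//= addKn lerDl sumr_ge0// => l _.
exact: mulr_ge0.
Qed.

Section moments.
Variables (p : nat) (s : R).
Hypotheses (s0 : 0 <= s) (sk : s < kappa).

Let r := Num.max s 1.
Let rk : 1 <= r < kappa. Proof. by rewrite le_max lexx orbT /= gt_max sk. Qed.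
Let r1 : 1 <= r. Proof. by case/andP: rk. Qed.
Let A m := jetn p q m (s%:P + s *: 'X).

Let J m B : jdom r B -> jdom r (jetn p q m B).
Proof. exact: (@jdom_jetn _ p _ _ q0 r1 (gf_le rk) (fun i _ => bin_series_fin_lt i rk)). Qed.
Let F B : jdom r B -> jfin p q B.
Proof. exact: (@jdom_jfin _ p _ _ q0 r1 (fun i _ => bin_series_fin_lt i rk)). Qed.
Let dlin : jdom r (s%:P + s *: 'X). Proof. by apply: jdom_lin; rewrite s0 le_max lexx. Qed.
Let dA m : jdom r (A m). Proof. exact: J. Qed.

Lemma moment_coef m j : (j <= p)%N ->
  ('E_P[fun t => ('C(zcard m t, j)%:R * s ^+ zcard m t)%R] = ((A m)`_j)%:E)%E.
Proof.
move=> jp; rewrite /A -(expectation_coef m rk dlin jp).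
by congr ('E_P[_])%E; apply/funext => t; rewrite coef_binom.
Qed.

Lemma moment_coef_le : exists2 C : R, 0 < C &
  forall m j, (0 < j <= p)%N -> (A m)`_j <= C * mu ^+ m.
Proof.
have [|C C0 HC] := @weighted_moment_le p s; first by rewrite s0.
exists C => // m j jp; rewrite -lee_fin -moment_coef; first exact: HC.
by case/andP: jp.
Qed.

(** The process dies out, and [E[s ^+ Z]] is squeezed between [1 - E[Z]] and
    [E[r ^+ Z]]. *)
Lemma cvg_moment_coef0 : (A m)`_0 @[m --> \oo] --> (1 : R).
Proof.
have mucvg : (mu ^+ m) @[m --> \oo] --> (0 : R).
  by apply: cvg_expr; rewrite ger0_norm// ltW.
have [C C0 HC] := iter_gf_le rk.
apply: (squeeze_cvgr (f := fun m => 1 - mu ^+ m) (h := fun m => 1 + C * mu ^+ m)).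
- apply: nearW => m; apply/andP; split.
    rewrite -lee_fin -moment_coef// EFinB leeBlDr// -expectation_zcard.
    rewrite -(@expectation_zcardD _ P m (fun z => 'C(z, 0)%:R * s ^+ z) (fun z => z%:R))//; last first.
      by move=> z; rewrite mulr_ge0// exprn_ge0.
    rewrite -(_ : 'E_P[fun=> 1%R] = 1%:E)%E; last exact: expectation_cst.
    apply: (@expectation_zcard_le _ P m (fun=> 1) (fun z => 'C(z, 0)%:R * s ^+ z + z%:R)) => z; rewrite ler01 bin0 mul1r /=.
    case: z => [|z]; first by rewrite expr0 addr0.
    by rewrite -natr1 addrA lerDr addr_ge0// exprn_ge0.
  have [H _] := HC m; rewrite -lerBlDl (le_trans _ H)// lerB//.
  rewrite -lee_fin -moment_coef// -expectation_exp//.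
  apply: (@expectation_zcard_le _ P m (fun z => 'C(z, 0)%:R * s ^+ z) (fun z => r ^+ z)) => z; rewrite bin0 mul1r exprn_ge0 ?s0//=.
  by apply: lerXn2r; rewrite ?nnegrE ?s0 ?(le_trans ler01 r1)// /r le_max lexx.
- rewrite -[X in _ --> X]subr0; apply: cvgB => //; exact: cvg_cst.
- rewrite -[X in _ --> X]addr0; apply: cvgD; first exact: cvg_cst.
  by rewrite -(mulr0 C); exact: cvgMr.
Qed.

(** Some offspring number is at least [2], so that positivity of the
    coefficients spreads by one degree at each generation. *)
Lemma moment_coef_gt0 m j : 0 < s -> (1 <= p)%N -> (j <= p)%N -> (j <= m.+1)%N -> 0 < (A m)`_j.
Proof.
move=> sp p1; have [[|[|k]]// _ qk] := offspring_ge2.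
elim: m j => [|m IH] j jp jm.
  rewrite /A /= coefD coefC coefZ coefX.
  by case: j jm {jp} => [|[|j]]//= _; rewrite ?mulr0 ?mulr1 ?addr0 ?add0r.
rewrite /A jetnS -/(A m); have [A0 _] := dA m.
apply: lt_le_trans (jet_term_le k.+2 A0 (F (dA m)) jp); rewrite mulr_gt0//.
have a0 : 0 < (A m)`_0 by exact: IH.
have a1 : 0 < (A m)`_1 by exact: IH.
have k0 : 0 < (A m ^+ k)`_0 by rewrite coef0_exp exprn_gt0.
case: j jp jm => [|j] jp jm; first by rewrite coef0_exp exprn_gt0.
have aj : 0 < (A m)`_j by apply: IH => //; exact: ltnW.
apply: (@lt_le_trans _ _ ((A m)`_1 * ((A m)`_j * (A m ^+ k)`_0))).
  by rewrite !mulr_gt0.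
rewrite -add1n !exprS; apply: le_trans (coefM_ge 1 j A0 _); last first.
  by apply: pge0M => //; exact: pge0X.
rewrite ler_wpM2l//; rewrite -{2}(addn0 j); apply: coefM_ge => //; exact: pge0X.
Qed.

(** The coefficients do not decay faster than the mean either: as the second
    moment is also of order [mu ^+ m], on survival the size of a generation
    stays bounded with positive probability. *)
Lemma moment_coef_ge j : 0 < s -> (2 <= p)%N -> (0 < j <= p)%N -> exists2 c : R, 0 < c &
  forall m, c * mu ^+ m <= (A (m + p))`_j.
Proof.
move=> sp p2 /andP[j0 jp]; have p1 : (1 <= p)%N by exact: ltnW.
have a0 := @moment_coef_gt0 p 0 sp p1 (leq0n _) (leq0n _).
have ap := @moment_coef_gt0 p j sp p1 jp (leq_trans jp (leqnSn _)).
pose s1 := Num.min 1 (A p)`_0.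
have s10 : 0 < s1 by rewrite lt_min ltr01.
have [|C C0 HC] := @weighted_moment_le 2 1; first by rewrite ler01.
pose K : R := 4 * C; have K0 : 0 < K by rewrite mulr_gt0.
have [k Kk] : exists k, K <= k%:R by exists (Num.bound K); exact/ltW/archi_boundP/ltW.
have k0 : 0 < k%:R :> R by exact: lt_le_trans Kk.
exists ((A p)`_j * (s1 ^+ k / 2)); first by rewrite mulr_gt0// divr_gt0// exprn_gt0.
move=> m; have -> : A (m + p) = jetn p q m (A p) by rewrite /A jetnD.
rewrite -lee_fin -(expectation_coef m rk (dA p) jp).
have [B0 Br] := dA p.
pose g z : R := (A p)`_j * (z%:R * s1 ^+ (z - 1)).
apply: (@le_trans _ _ ('E_P[fun t => g (zcard m t)])%E); last first.
  apply: (@expectation_zcard_le _ P m g (fun z => ((A p) ^+ z)`_j)) => z; rewrite !mulr_ge0 ?exprn_ge0 ?(ltW s10)//=.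
  have pl : (1 < j.+1)%N by [].
  rewrite coefX_expand (bigD1 (Ordinal pl))//= bin1 expr1 coefB coefC.
  rewrite [in X in X + _](_ : (j == 0)%N = false) ?subr0; last by case: (j) j0.
  apply: (@le_trans _ _ (z%:R * (A p)`_0 ^+ (z - 1) * (A p)`_j)).
    rewrite /g [leLHS]mulrC ler_wpM2r// ler_wpM2l// lerXn2r ?nnegrE ?(ltW s10)//.
    by rewrite ge_min lexx orbT.
  rewrite lerDl sumr_ge0// => l _; rewrite !mulr_ge0 ?exprn_ge0//.
  by apply: pge0X; exact: pge0_tail.
rewrite /g (@expectation_zcardZ _ P m _ (fun z => z%:R * s1 ^+ (z - 1)))//; last first.
  by move=> z; rewrite mulr_ge0// exprn_ge0// ltW.
rewrite -mulrA EFinM lee_wpmul2l ?lee_fin ?(ltW ap)//.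
(* By the second-moment bound, the event that the size exceeds k takes away at
   most half of the mean; below k the factor s1 ^+ z is at least s1 ^+ k. *)
pose h z : R := s1 ^+ k * 2 / k%:R * ('C(z, 2)%:R * 1 ^+ z).
have key z : 0 <= s1 ^+ k * z%:R <= z%:R * s1 ^+ (z - 1) + h z.
  rewrite mulr_ge0 ?exprn_ge0 ?(ltW s10)//=.
  case: z => [|z]; first by rewrite mulr0 mul0r add0r /h bin0n mul0r mulr0.
  have hz : 0 <= h z.+1 by rewrite /h !mulr_ge0 ?exprn_ge0 ?invr_ge0 ?(ltW s10)// ?expr1n.
  rewrite subn1 /=; case: (leqP z k) => zk.
    rewrite -[leLHS]addr0 lerD// mulrC ler_wpM2l// ler_wiXn2l ?(ltW s10)//.
    by rewrite ge_min lexx.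
  rewrite -[leLHS]add0r lerD ?mulr_ge0 ?exprn_ge0 ?(ltW s10)//.
  rewrite /h expr1n mulr1 -!mulrA ler_wpM2l ?exprn_ge0 ?(ltW s10)//.
  rewrite mulrCA [leRHS]mulrC ler_pdivlMr// -!natrM ler_nat.
  by rewrite mul_bin_left subn1 /= bin1 mulnC leq_mul2r ltnW ?orbT.
have := @expectation_zcard_le _ P m _ _ key.
rewrite (@expectation_zcardZ _ P m _ (fun z => z%:R)) ?exprn_ge0 ?(ltW s10)//.
rewrite expectation_zcard (@expectation_zcardD _ P m (fun z => z%:R * s1 ^+ (z - 1)) h); last 2 first.
- by move=> z; rewrite mulr_ge0// exprn_ge0// ltW.
- by move=> z; rewrite /h !mulr_ge0 ?exprn_ge0 ?invr_ge0 ?(ltW s10)// expr1n.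
rewrite /h (@expectation_zcardZ _ P m _ (fun z => 'C(z, 2)%:R * 1 ^+ z)); last 2 first.
- by rewrite !mulr_ge0 ?exprn_ge0 ?invr_ge0 ?(ltW s10).
- by move=> z; rewrite mulr_ge0// expr1n.
have := HC m 2 isT; set e2 := ('E_P[_])%E; set e1 := ('E_P[_])%E => H2 H1.
have : ((s1 ^+ k)%:E * (mu ^+ m)%:E <= e1 + (s1 ^+ k * 2 / k%:R)%:E * (C * mu ^+ m)%:E)%E.
  apply: le_trans H1 _; rewrite leeD2l// lee_wpmul2l// lee_fin.
  by rewrite !mulr_ge0 ?exprn_ge0 ?invr_ge0 ?(ltW s10).
rewrite -!EFinM -leeBlDr// -EFinB => /(le_trans _); apply; rewrite lee_fin.
have -> : s1 ^+ k / 2 * mu ^+ m = (s1 ^+ k * mu ^+ m) * 2^-1 by ring.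
have -> : s1 ^+ k * mu ^+ m - s1 ^+ k * 2 / k%:R * (C * mu ^+ m) =
  (s1 ^+ k * mu ^+ m) * (1 - 2 * C / k%:R) by ring.
rewrite ler_wpM2l ?mulr_ge0 ?exprn_ge0 ?(ltW s10) ?(ltW mu0)//.
suff : 2 * C / k%:R <= 2^-1 by lra.
by rewrite ler_pdivrMr// ler_pdivlMl// (le_trans _ Kk)// /K; lra.
Qed.

End moments.


Lemma cvg_muX (C : R) : C * mu ^+ m @[m --> \oo] --> (0 : R).
Proof.
have H : `|mu| < 1 by rewrite ger0_norm// ltW.
exact: (cvg_geometric C H).
Qed.

Lemma limit_below_kappa0 n (L : set tree) s : filt n L -> 0 <= s < kappa ->
  ('E_P[fun t => (s ^+ zcard (m + n) t * \1_L t)%R] @[m --> \oo] --> 'E_P[\1_L])%E.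
Proof.
move=> fL /andP[s0 sk]; have mL := filt_measurable fL.
pose r := Num.max s 1.
have rk : 1 <= r < kappa by rewrite le_max lexx orbT /= gt_max sk.
have /andP[r1 _] := rk; have r0 : 0 <= r by exact: le_trans r1.
have dlin : jdom r (s%:P + s *: 'X) by apply: jdom_lin; rewrite s0 le_max lexx.
pose A m := jetn 0 q m (s%:P + s *: 'X).
have dA m : jdom r (A m).
  exact: (@jdom_jetn _ 0 _ _ q0 r1 (gf_le rk) (fun i _ => bin_series_fin_lt i rk)).
rewrite (_ : (fun m => _) = fun m => ('E_P[fun t => ((A m)`_0 ^+ zcard n t * \1_L t)%R])%E); last first.
  apply/funext => m; transitivity ('E_P[fun t => ((A m ^+ zcard n t)`_0 * \1_L t)%R])%E; last first.
    by congr ('E_P[_])%E; apply/funext => t; rewrite coef0_exp.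
  rewrite -(@markov _ 0 _ _ _ q_off P_GW m n L (s%:P + s *: 'X))//.
  - by congr ('E_P[_])%E; apply/funext => t; rewrite coef_binom bin0 mul1r.
  - by case: dlin.
  - exact: (@jetn_jfin _ 0 _ _ q0 r1 (gf_le rk) (fun i _ => bin_series_fin_lt i rk)).
rewrite (_ : 'E_P[\1_L] = 'E_P[fun t => (1 * \1_L t)%R])%E; last first.
  by congr ('E_P[_])%E; apply/funext => t; rewrite mul1r.
apply: (@cvg_expectation_zcard _ P n L (fun m z => (A m)`_0 ^+ z) (fun=> 1) (fun z => r ^+ z)) => //.
- by move=> z; rewrite -(expr1n _ z); apply: cvg_exprn_comp; exact: (@cvg_moment_coef0 0 s s0 sk).
- by move=> m z; have [A0 Ar] := dA m; rewrite exprn_ge0//= lerXn2r// nnegrE.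
- by rewrite expectation_exp// ltry.
Qed.


(** In the expansion of [(A ^+ Z)`_p] around the constant coefficient, the
    linear term [Z A`_p] dominates, the terms of order at least [2] in the
    tail of [A] being of order [mu ^+ (2 * m)]: conditionally on survival, a
    single individual of generation [n] has descendants in generation [m + n]
    asymptotically, and there are [Z_n] choices for it. *)
Lemma limit_below_kappa p n s : (0 < p)%N -> 0 < s < kappa ->
  exists2 c : nat -> R, (\forall m \near \oo, c m != 0) &
  forall L : set tree, filt n L -> exists2 u : nat -> \bar R,
    (u m @[m --> \oo] --> 'E_P[fun t => ((zcard n t)%:R * \1_L t)%R])%E &
    forall m, (p + 2 <= m)%N ->
      ('E_P[fun t => ('C(zcard (m + n) t, p)%:R * s ^+ zcard (m + n) t * \1_L t)%R]
       = (c m)%:E * u m)%E.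
Proof.
move=> p0 /andP[s0 sk]; pose p' := (p + 2)%N.
have p'2 : (2 <= p')%N by rewrite leq_addl.
have pp' : (p <= p')%N by rewrite leq_addr.
have pp'0 : (0 < p <= p')%N by rewrite p0.
pose r := Num.max s 1.
have rk : 1 <= r < kappa by rewrite le_max lexx orbT /= gt_max sk.
have /andP[r1 _] := rk; have r0 : 0 <= r by exact: le_trans r1.
have dlin : jdom r (s%:P + s *: 'X) by apply: jdom_lin; rewrite ltW//= le_max lexx.
pose A m := jetn p' q m (s%:P + s *: 'X).
have dA m : jdom r (A m).
  exact: (@jdom_jetn _ p' _ _ q0 r1 (gf_le rk) (fun i _ => bin_series_fin_lt i rk)).
have Agt0 m : (p' <= m)%N -> 0 < (A m)`_p.
  by move=> pm; apply: moment_coef_gt0 => //; [exact: ltW|by rewrite (leq_trans _ p'2)|rewrite (leq_trans pp')// (leq_trans pm)].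
exists (fun m => (A m)`_p).
  by near=> m; rewrite gt_eqF//; apply: Agt0; near: m; exact: nbhs_infty_ge.
move=> L fL; have mL := filt_measurable fL.
have [C C0 HC] := @moment_coef_le p' s (ltW s0) sk.
have [c c0 Hc] := @moment_coef_ge p' s (ltW s0) sk p s0 p'2 pp'0.
pose g m z := ((A m ^+ z)`_p) / (A m)`_p.
have g0 m z : 0 <= g m z.
  by have [A0 _] := dA m; rewrite mulr_ge0 ?invr_ge0//; exact: pge0X.
exists (fun m => 'E_P[fun t => (g m (zcard n t) * \1_L t)%R])%E; last first.
  move=> m pm; rewrite -expectation_zcardZL//; last by apply/ltW/Agt0.
  transitivity ('E_P[fun t => ((A m ^+ zcard n t)`_p * \1_L t)%R])%E; last first.
    by congr ('E_P[_])%E; apply/funext => t; rewrite /g; congr (_ * _); rewrite [RHS]mulrC divfK// gt_eqF// Agt0.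
  rewrite -(@markov _ p' _ _ _ q_off P_GW m n L (s%:P + s *: 'X))//.
  - by congr ('E_P[_])%E; apply/funext => t; rewrite coef_binom.
  - by case: dlin.
  - exact: (@jetn_jfin _ p' _ _ q0 r1 (gf_le rk) (fun i _ => bin_series_fin_lt i rk)).
pose B : {poly R} := \poly_(i < p'.+1) 1.
pose d m := mu ^+ (m + p'); have d0 m : 0 < d m by rewrite exprn_gt0.
pose T l := C ^+ l * (B ^+ l)`_p / (c / mu ^+ p').
have B0 : pge0 B by move=> i; rewrite coef_poly; case: ifP.
have c'0 : 0 < c / mu ^+ p' by rewrite divr_gt0// exprn_gt0.
have T0 l : 0 <= T l.
  by rewrite /T !mulr_ge0 ?exprn_ge0 ?invr_ge0 ?(ltW C0) ?(ltW c'0)//; exact: pge0X.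
pose tl m := A m - ((A m)`_0)%:P.
have tl0 m : pge0 (tl m) by apply: pge0_tail; case: (dA m).
pose e m l := (tl (m + p')%N ^+ l)`_p / (A (m + p')%N)`_p.
have e0 m l : 0 <= e m l.
  rewrite mulr_ge0//; first exact: pge0X.
  by rewrite invr_ge0 ltW// Agt0// leq_addl.
have el m l : (0 < l)%N -> e m l <= T l * d m ^+ l.-1.
  move=> l0; rewrite /e ler_pdivrMr ?Agt0 ?leq_addl//.
  apply: (@le_trans _ _ ((C * d m) ^+ l * (B ^+ l)`_p)).
    rewrite -coefZ -exprZn; 
    have : forall j, (j <= p')%N -> 0 <= (tl (m + p')%N)`_j <= ((C * d m) *: B)`_j; last first.
      by move=> H; have /andP[] := coefX_le l H pp'.
    move=> j jp; rewrite tl0 /= coefZ coef_poly ltnS jp mulr1 /tl coefB coefC.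
    case: eqP => [->|/eqP j0]; first by rewrite subrr mulr_ge0// ltW.
    by rewrite subr0 HC// lt0n j0.
  apply: (@le_trans _ _ (T l * d m ^+ l.-1 * (c / mu ^+ p' * d m))).
    have -> : (C * d m) ^+ l = C ^+ l * (d m * d m ^+ l.-1) by rewrite exprMn -exprS prednK.
    rewrite /T le_eqVlt; apply/orP; left; apply/eqP; field.
    by rewrite (gt_eqF c0) expf_neq0 ?(gt_eqF mu0).
  rewrite ler_wpM2l//; first by rewrite (mulr_ge0 (T0 l))// exprn_ge0// ltW.
  apply: le_trans (Hc m); rewrite le_eqVlt; apply/orP; left; apply/eqP.
  by rewrite /d exprD; field; rewrite expf_neq0// (gt_eqF mu0).
have gE m z : g (m + p')%N z = \sum_(l < p.+1) 'C(z, l)%:R * (A (m + p')%N)`_0 ^+ (z - l) * e m l.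
  by rewrite /g coefX_expand big_distrl; apply: eq_bigr => l _; rewrite /e mulrA.
have e0l m : e m 0 = 0 by rewrite /e expr0 coef1 gtn_eqF// mul0r.
have e1l m : e m 1 = 1.
  rewrite /e expr1 /tl coefB coefC gtn_eqF// subr0 divff// gt_eqF//.
  by rewrite Agt0// leq_addl.
have dle1 m l : d m ^+ l <= 1 by rewrite -exprM exprn_ile1// ltW.
rewrite -(cvg_shiftn p') /=.
apply: (@cvg_expectation_zcard _ P n L (fun m z => g (m + p')%N z) (fun z => z%:R)
  (fun z => \sum_(l < p.+1) T l * ('C(z, l)%:R * r ^+ z))) => //.
- move=> z; have -> : (fun m => g (m + p')%N z) = (fun m => \sum_(l < p.+1) 'C(z, l)%:R * (A (m + p')%N)`_0 ^+ (z - l) * e m l).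
    by apply/funext => m; exact: gE.
  rewrite [X in _ --> X](_ : _ = \sum_(l < p.+1) (if l == 1%N :> nat then z%:R else 0)); last first.
    have p1 : (1 < p.+1)%N by [].
    rewrite (bigD1 (Ordinal p1))//= big1 ?addr0// => l; rewrite -val_eqE /=.
    by move=> /negbTE ->.
  apply: cvg_big => [|l _]; first exact: add_continuous.
  case: (ltngtP l 1%N) => l1.
  + rewrite (_ : (fun m => _) = fun=> 0); first exact: cvg_cst.
    have l0 : nat_of_ord l = 0%N by move: l1; rewrite ltnS leqn0 => /eqP.
    by apply/funext => m; rewrite l0 e0l mulr0.
  + have Hd : d m ^+ l.-1 @[m --> \oo] --> (0 : R).
      apply: (squeeze_cvgr (f := fun=> 0) (h := fun m => 1 * mu ^+ m)).
      * apply: nearW => m; rewrite exprn_ge0 ?(ltW (d0 m))//= mul1r /d -exprM.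
        rewrite ler_wiXn2l ?(ltW mu0) ?(ltW mu1)//.
        have l1' : (0 < l.-1)%N by case: (nat_of_ord l) l1 => [|[]].
        by rewrite -[leqLHS]muln1 leq_mul// leq_addr.
      * exact: cvg_cst.
      * exact: cvg_muX.
    have Hel : e m l @[m --> \oo] --> (0 : R).
      apply: (squeeze_cvgr (f := fun=> 0) (h := fun m => T l * d m ^+ l.-1)).
      * by apply: nearW => m; rewrite e0 el//; exact: ltnW.
      * exact: cvg_cst.
      * by rewrite -(mulr0 (T l)); exact: cvgMr.
    apply: (squeeze_cvgr (f := fun=> 0) (h := fun m => 'C(z, l)%:R * r ^+ (z - l) * e m l)).
    * apply: nearW => m; have [A0 Ar] := dA (m + p')%N.
      have el0 := e0 m l; apply/andP; split.
        by apply: (mulr_ge0 _ el0); rewrite mulr_ge0// exprn_ge0.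
      rewrite (ler_wpM2r el0)// ler_wpM2l//.
      by rewrite lerXn2r// nnegrE.
    * exact: cvg_cst.
    * by rewrite -(mulr0 ('C(z, l)%:R * r ^+ (z - l))); exact: cvgMr.
  + rewrite l1; have -> : (fun m => 'C(z, 1)%:R * (A (m + p')%N)`_0 ^+ (z - 1) * e m 1) =
        (fun m => z%:R * (A (m + p')%N)`_0 ^+ (z - 1)).
      by apply/funext => m; rewrite e1l mulr1 bin1.
    rewrite -[X in _ --> X]mulr1; apply: cvgMr.
    rewrite -(expr1n _ (z - 1)); apply: cvg_exprn_comp.
    have := @cvg_moment_coef0 p' s (ltW s0) sk.
    by rewrite -(cvg_shiftn p').
- move=> m z; rewrite g0 gE /=; apply: ler_sum => l _; have [A0 Ar] := dA (m + p')%N.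
  case: l => -[|l] lp /=; first by rewrite e0l mulr0; apply: (mulr_ge0 (T0 0%N)); rewrite mulr_ge0// exprn_ge0.
  rewrite mulrC; apply: ler_pM; first exact: e0.
  + by rewrite mulr_ge0// exprn_ge0.
  + by apply: (le_trans (el _ _ _)) => //; rewrite -[leRHS]mulr1 ler_wpM2l.
  + rewrite ler_wpM2l//; apply: (@le_trans _ _ (r ^+ (z - l.+1))).
      by rewrite lerXn2r// nnegrE.
    by rewrite ler_weXn2l// leq_subr.
- rewrite (@expectation_zcard_sum _ P n _ (fun l z => T l * ('C(z, l)%:R * r ^+ z))); last first.
    by move=> l z; apply: (mulr_ge0 (T0 l)); rewrite mulr_ge0// exprn_ge0.
  apply: lte_sum_pinfty => l _.
  rewrite (@expectation_zcardZ _ P n _ (fun z => 'C(z, l)%:R * r ^+ z))//; last first.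
    by move=> z; rewrite mulr_ge0// exprn_ge0.
  have dr : jdom r (r%:P + r *: 'X) by apply: jdom_lin; rewrite r0 lexx.
  have := @expectation_coef p _ _ n l rk dr; rewrite -ltnS => /(_ (ltn_ord l)).
  rewrite (_ : 'E_P[_] = 'E_P[fun t => ('C(zcard n t, l)%:R * r ^+ zcard n t)%R])%E.
    by move=> ->; rewrite -EFinM ltry.
  by congr ('E_P[_])%E; apply/funext => t; rewrite coef_binom.
Unshelve. all: by end_near. Qed.

(** The rate at which the numerator vanishes does not depend on the event, and
    cancels. *)
Lemma ratio_limit_below_kappa p n (L : set tree) s : filt n L -> 0 <= s < kappa ->
  (p = 0%N \/ 0 < s) ->
  let X m t := Hpoly p (zcard (m + n) t)%:R * s ^+ zcard (m + n) t in
  ('E_P[fun t => (X m t * \1_L t)%R] / 'E_P[X m])%E @[m --> \oo] -->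
  (if p is 0 then 'E_P[\1_L]
   else 'E_P[fun t => ((zcard n t)%:R / mu ^+ n * \1_L t)%R])%E.
Proof.
move=> fL sk sp X; have mL := filt_measurable fL.
have XT m : ('E_P[X m] = 'E_P[fun t => (X m t * \1_[set: tree] t)%R])%E by exact: expectationT.
have XE (L' : set tree) m : ('E_P[fun t => (X m t * \1_L' t)%R] =
    'E_P[fun t => ('C(zcard (m + n) t, p)%:R * s ^+ zcard (m + n) t * \1_L' t)%R])%E.
  by congr ('E_P[_])%E; apply/funext => t; rewrite /X HpolyE.
have EL : ('E_P[\1_L] = (fine 'E_P[\1_L])%:E)%E.
  by rewrite fineK// expectation_indic// fin_num_measure.
case: p => [|p] in X sp XT XE *.
  have HL := limit_below_kappa0 fL sk; have HT := limit_below_kappa0 (@filtT n) sk.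
  rewrite EL in HL *; rewrite (_ : 'E_P[\1_[set: tree]] = 1%:E)%E in HT; last first.
    by rewrite expectation_indic// probability_setT.
  have c1 : \forall m \near \oo, (fun=> 1 : R) (m : nat) != 0.
    by apply: nearW => m; exact: oner_neq0.
  have := cvge_ratio c1 HL HT (oner_neq0 _); rewrite divr1; apply: cvg_trans.
  apply: near_eq_cvg; apply: nearW => m; rewrite XT !XE !mul1e.
  by congr ('E_P[_] / 'E_P[_])%E; apply/funext => t; rewrite bin0 mul1r.
have s0 : 0 < s by case: sp.
have s0k : 0 < s < kappa by rewrite s0; case/andP: sk.
have [c c0 H] := limit_below_kappa n (ltn0Sn p) s0k.
have [u uL Hu] := H L fL; have [v vT Hv] := H _ (@filtT n).
have mun : mu ^+ n != 0 by rewrite expf_neq0// gt_eqF.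
have ZT : ('E_P[fun t => ((zcard n t)%:R * \1_[set: tree] t)%R] = (mu ^+ n)%:E)%E.
  by rewrite -expectationT expectation_zcard.
have ZL : ('E_P[fun t => ((zcard n t)%:R * \1_L t)%R] =
    (fine 'E_P[fun t => ((zcard n t)%:R * \1_L t)%R])%:E)%E.
  rewrite fineK// ge0_fin_numE; last by apply: expectation_ge0 => t; rewrite mulr_ge0.
  apply: le_lt_trans (_ : _ <= (mu ^+ n)%:E)%E _; last by rewrite ltry.
  rewrite -expectation_zcard unlock; apply: ge0_le_integral => //.
  - apply/measurable_EFinP/measurable_funM; last exact: measurable_indic.
    exact: (measurable_zcard_fun _ (fun z => z%:R : R)).
  - by apply/measurable_EFinP; exact: (measurable_zcard_fun _ (fun z => z%:R : R)).
  - by move=> t _; rewrite lee_fin indicE; case: (t \in L); rewrite ?mulr1 ?mulr0.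
rewrite ZT in vT.
have -> : ('E_P[fun t => ((zcard n t)%:R / mu ^+ n * \1_L t)%R] =
    (fine 'E_P[fun t => ((zcard n t)%:R * \1_L t)%R] / mu ^+ n)%:E)%E.
  rewrite mulrC EFinM -ZL -(@expectation_zcardZL _ P n L _ (fun z => z%:R))//.
    by congr ('E_P[_])%E; apply/funext => t; rewrite [in RHS](mulrC (_^-1)).
  by rewrite invr_ge0 exprn_ge0// ltW.
rewrite ZL in uL.
apply: cvg_trans (cvge_ratio c0 uL vT mun).
apply: near_eq_cvg; near=> m; rewrite XT !XE Hu ?Hv//; near: m; exact: nbhs_infty_ge.
Unshelve. all: by end_near. Qed.

End below_kappa.

(** * The tilted offspring distribution *)

Let kp : 0 < kappa. Proof. exact: lt_trans kappa1. Qed.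
Let kn : kappa != 0. Proof. by rewrite gt_eqF. Qed.

Local Notation qb := (tilt q kappa).
Local Notation mub := (fine (gfD q 1 kappa)).

Let mub1 : 1 < mub.
Proof. exact: (gfD1_gt1). Qed.
Let mub0 : 0 < mub. Proof. exact: lt_trans mub1. Qed.
Let mubX m : 0 < mub ^+ m. Proof. exact: exprn_gt0. Qed.

Lemma tiltE n : qb n = kappa ^+ n / kappa * q n.
Proof. by rewrite /tilt expfzDr. Qed.

Lemma tilt_ge0 n : 0 <= qb n.
Proof. by rewrite tiltE !mulr_ge0 ?exprn_ge0 ?invr_ge0// ltW. Qed.

Lemma tilt_series (g : nat -> R) : (forall n, 0 <= g n) ->
  (\sum_(0 <= n <oo) (qb n * g n)%:E =
   (kappa^-1)%:E * \sum_(0 <= n <oo) (q n * g n * kappa ^+ n)%:E)%E.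
Proof.
move=> g0; rewrite -nneseriesZl; last by move=> n _; rewrite lee_fin !mulr_ge0 ?exprn_ge0// ltW.
by apply: eq_eseriesr => n _; rewrite tiltE -EFinM; congr EFin; ring.
Qed.

Lemma tilt_offspring : is_offspring qb.
Proof.
split; first exact: tilt_ge0.
have := @tilt_series (fun=> 1) (fun=> ler01).
under eq_eseriesr do rewrite mulr1; move=> ->.
under eq_eseriesr do rewrite mulr1.
by rewrite -/(gf kappa) gf_fix -EFinM mulVf.
Qed.

Lemma tilt_le1 : (\sum_(0 <= n <oo) (qb n * 1 ^+ n)%:E <= 1%:E)%E.
Proof.
case: tilt_offspring => _ <-; rewrite le_eqVlt; apply/orP; left; apply/eqP.
by apply: eq_eseriesr => n _; rewrite expr1n mulr1.
Qed.

Lemma tilt_bin_fin i : (i <= D)%N ->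
  (\sum_(0 <= n <oo) (qb n * 'C(n, i)%:R * 1 ^+ n)%:E < +oo)%E.
Proof.
move=> iD; under eq_eseriesr do rewrite expr1n mulr1.
rewrite (tilt_series (g := fun n => 'C(n, i)%:R))// lte_mul_pinfty ?fin_numE ?lee_fin ?invr_ge0 ?ltW//.
exact: (bin_series_fin).
Qed.

Lemma tilt_mean : (\sum_(0 <= n <oo) (qb n * n%:R)%:E = mub%:E)%E.
Proof.
rewrite (tilt_series (g := fun n => n%:R))// -(gfD1_fin).
rewrite -nneseriesZl; last by move=> n _; rewrite lee_fin !mulr_ge0 ?exprn_ge0// ltW.
apply: eq_eseriesr => n _; rewrite -EFinM; congr EFin; rewrite ffactn1.
case: n => [|n]; first by rewrite !mulr0 !mul0r mulr0.
by rewrite subn1 /= exprS; field.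
Qed.

(** Weighting by [kappa ^+ Z] changes the offspring law into the tilted one:
    this is the identity [f (kappa x) = kappa * fbar x] at the level of jets. *)
Lemma jet_tilt B : pge0 B -> jet D q (kappa *: B) = kappa *: jet D qb B.
Proof.
move=> B0; apply/polyP => i; rewrite coefZ !coef_poly; case: ifP => iD; last by rewrite mulr0.
have -> : jser q (kappa *: B) i = (kappa%:E * jser qb B i)%E.
  rewrite /jser (tilt_series (g := fun n => (B ^+ n)`_i)); last by move=> n; exact: pge0X.
  rewrite muleA -EFinM divff// mul1e; apply: eq_eseriesr => n _.
  by rewrite exprZn coefZ; congr EFin; ring.
case: (jser qb B i) (jser_ge0 i tilt_ge0 B0) => [x||] //= _.
by rewrite gt0_muley ?lte_fin//= mulr0.
Qed.

Lemma pge0Z (c : R) B : 0 <= c -> pge0 B -> pge0 (c *: B).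
Proof. by move=> c0 B0 i; rewrite coefZ mulr_ge0. Qed.

Lemma jetn_tilt m B : pge0 B -> jetn D q m (kappa *: B) = kappa *: jetn D qb m B.
Proof.
elim: m B => //= m IH B B0; rewrite jet_tilt// IH//.
by apply: pge0_jet => // n; exact: tilt_ge0.
Qed.

(** Scaling the coefficient of degree [j] by [c ^+ j] is substituting [c X]
    for the variable, which commutes with composition on the left. *)
Lemma jet_scale (c : R) (A B : {poly R}) l : 0 <= c -> pge0 A ->
  (forall j, (j <= D)%N -> B`_j = c ^+ j * A`_j) -> (l <= D)%N ->
  (jet D qb B)`_l = c ^+ l * (jet D qb A)`_l.
Proof.
move=> c0 A0 AB lD; rewrite !coef_poly ltnS lD.
have -> : jser qb B l = ((c ^+ l)%:E * jser qb A l)%E.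
  rewrite /jser -nneseriesZl; last by move=> n _; rewrite lee_fin mulr_ge0 ?tilt_ge0//; exact: pge0X.
  by apply: eq_eseriesr => n _; rewrite (coefX_scale _ AB)// -EFinM; congr EFin; ring.
case: (jser qb A l) (jser_ge0 l tilt_ge0 A0) => [x||] //= _.
have [->|cn] := eqVneq (c ^+ l) 0; first by rewrite mul0e mul0r.
by rewrite gt0_muley ?lte_fin ?lt0r ?cn ?exprn_ge0//= mulr0.
Qed.

Local Notation J1 := (@jdom_jetn _ D _ _ tilt_ge0 (lexx 1) tilt_le1 tilt_bin_fin).
Local Notation F1 := (@jdom_jfin _ D _ _ tilt_ge0 (lexx 1) tilt_bin_fin).

Definition damp (b : R) m : R := expR (- (b / mub ^+ m)).

Lemma damp_in01 b m : 0 <= b -> 0 <= damp b m <= 1.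
Proof.
move=> b0; rewrite expR_ge0 -expR0 ler_expR oppr_le0.
by rewrite divr_ge0// ltW.
Qed.

(** The coefficient of degree [j] is the binomial moment of order [j] of
    [Z_m], damped by [exp (- b Z_m / mub ^+ m)]; in [Vp] it is divided by [mub
    ^+ (j * m)]. *)
Definition Vraw b m := jetn D qb m ((damp b m)%:P + damp b m *: 'X).
Definition Vp b m : {poly R} := \poly_(j < D.+1) ((Vraw b m)`_j / (mub ^+ m) ^+ j).

Lemma jdom_Vraw b m : 0 <= b -> jdom 1 (Vraw b m).
Proof. by move=> b0; apply: J1; apply: jdom_lin; exact: damp_in01. Qed.

Lemma Vraw_Vp b m j : (j <= D)%N -> (Vraw b m)`_j = (mub ^+ m) ^+ j * (Vp b m)`_j.
Proof. by move=> jD; rewrite coef_poly ltnS jD mulrC divfK// gt_eqF// exprn_gt0. Qed.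

Lemma jdom_Vp b m : 0 <= b -> jdom 1 (Vp b m).
Proof.
move=> b0; have [V0 V1] := jdom_Vraw m b0; split.
  by move=> j; rewrite coef_poly; case: ifP => // _; rewrite divr_ge0// exprn_ge0// ltW.
by rewrite coef_poly /= expr0 divr1.
Qed.

(** Branching at the first generation: the normalisation of the subtrees of
    the children lags one generation behind, which shows as the factor [mub]
    on the damping parameter and as [mub ^+ l]. *)
Lemma Vp_step b m l : 0 <= b -> (l <= D)%N ->
  mub ^+ l * (Vp (mub * b) m.+1)`_l = (jet D qb (Vp b m))`_l.
Proof.
move=> b0 lD; have [V0 _] := jdom_Vp m b0.
have H := jet_scale (ltW (mubX m)) V0 (Vraw_Vp b m) lD.
rewrite coef_poly ltnS lD /Vraw (_ : damp (mub * b) m.+1 = damp b m); last first.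
  by rewrite /damp exprS invfM mulrACA divff ?gt_eqF// mul1r.
rewrite jetnS -/(Vraw b m) H.
have -> : (mub ^+ m.+1) ^+ l = mub ^+ l * (mub ^+ m) ^+ l by rewrite exprS exprMn.
have n1 : mub ^+ l != 0 by rewrite expf_neq0// gt_eqF.
have n2 : mub ^+ m ^+ l != 0 by rewrite !expf_neq0// gt_eqF.
by move: n1 n2; generalize (mub ^+ l), (mub ^+ m ^+ l) => x y x0 y0; field; rewrite x0 y0.
Qed.

Lemma Vp_le b m : 0 <= b -> ple (Vp b m) (Vp 0 m).
Proof.
move=> b0 j; rewrite !coef_poly; case: ifP => // jD.
rewrite ler_wpM2r ?invr_ge0 ?exprn_ge0 ?(ltW mub0)//.
have /andP[d0 d1] := damp_in01 m b0.
have E : damp 0 m = 1 by rewrite /damp mul0r oppr0 expR0.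
refine (@ple_jetn _ D _ _ tilt_ge0 (lexx 1) tilt_le1 tilt_bin_fin m _ _ _ _ _ j).
- by have [] := jdom_lin (damp_in01 m b0).
- move=> i; rewrite !coefD !coefC !coefZ !coefX E.
  by case: i => [|[|i]]; rewrite /= ?mulr0 ?mulr1 ?addr0 ?add0r.
- exact/jdom_lin/damp_in01.
Qed.

Lemma Vp_expectation (P : probability tree R) b m j : is_GW qb 0 P -> 0 <= b -> (j <= D)%N ->
  ('E_P[fun t => ('C(zcard m t, j)%:R * expR (- (b * ((zcard m t)%:R / mub ^+ m))))%R]
   = ((mub ^+ m) ^+ j * (Vp b m)`_j)%:E)%E.
Proof.
move=> P_GW b0 jD; rewrite -Vraw_Vp//.
have dl := jdom_lin (damp_in01 m b0).
have := @coef_jetn _ D _ 0 _ tilt_offspring P_GW m _ j (proj1 dl); rewrite addn0 => <- //.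
  congr ('E_P[_])%E; apply/funext => t; rewrite coef_binom /damp -expRM_natl; congr (_ * expR _).
  by rewrite -mulr_natl; ring.
exact: (jetn_jfin tilt_ge0 (lexx 1) tilt_le1 tilt_bin_fin).
Qed.

Definition bin_moment i : R := fine (\sum_(0 <= n <oo) (qb n * 'C(n, i)%:R)%:E)%E.

Lemma bin_moment_ge0 i : 0 <= bin_moment i.
Proof. by apply: fine_ge0; apply: nneseries_ge0 => n _ _; rewrite lee_fin mulr_ge0 ?tilt_ge0. Qed.

Lemma bin_moment1 : bin_moment 1 = mub.
Proof.
rewrite /bin_moment -[RHS]/(fine mub%:E) -tilt_mean.
by congr fine; apply: eq_eseriesr => n _; rewrite bin1.
Qed.

Lemma jet_expand B l : jdom 1 B -> B`_0 = 1 -> (l <= D)%N ->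
  (jet D qb B)`_l = \sum_(i < l.+1)
    bin_moment i * ((B - 1%:P) ^+ i)`_l.
Proof.
move=> dB B01 lD; apply: EFin_inj; rewrite (jetE tilt_ge0)//; [|by case: dB|exact: F1].
have T0 : pge0 (B - 1%:P) by rewrite -{1}B01; apply: pge0_tail; case: dB.
have ilD (i : 'I_l.+1) : (i <= D)%N by rewrite (leq_trans _ lD)// -ltnS.
rewrite -sumEFin; transitivity (\sum_(0 <= n <oo) \sum_(i < l.+1)
    (((B - 1%:P) ^+ i)`_l)%:E * (qb n * 'C(n, i)%:R)%:E)%E.
  apply: eq_eseriesr => n _; rewrite coefX_expand B01 big_distrr -sumEFin.
  by apply: eq_bigr => i _; rewrite expr1n mulr1 -EFinM; congr EFin; rewrite /=; ring.
rewrite nneseries_sum; last first.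
  by move=> i n _; rewrite -EFinM lee_fin; apply: mulr_ge0; [exact: (pge0X _ T0)|rewrite mulr_ge0 ?tilt_ge0].
apply: eq_bigr => i _; rewrite nneseriesZl; last by move=> n _; rewrite lee_fin mulr_ge0 ?tilt_ge0.
rewrite EFinM muleC fineK// ge0_fin_numE; last first.
  by apply: nneseries_ge0 => n _ _; rewrite lee_fin mulr_ge0 ?tilt_ge0.
by have := tilt_bin_fin (ilD i); under eq_eseriesr do rewrite expr1n mulr1.
Qed.

Definition higher l (B : {poly R}) : R :=
  \sum_(i < l.+1 | (2 <= i)%N) bin_moment i * ((B - 1%:P) ^+ i)`_l.

(** The top coefficient enters linearly, with the mean as a factor, and
    [higher l B] involves coefficients of degree below [l] only: moments are
    treated by induction on their order. *)
Lemma jet_split B l : jdom 1 B -> B`_0 = 1 -> (2 <= l <= D)%N ->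
  (jet D qb B)`_l = mub * B`_l + higher l B.
Proof.
move=> dB B0 /andP[l2 lD]; rewrite jet_expand//.
case: l l2 lD => [|[|l]]// l2 lD.
rewrite (bigD1 (Ordinal (isT : (1 < l.+3)%N)))//= expr1 coefB coefC subr0 bin_moment1.
congr (_ * _ + _); rewrite (bigID (fun i : 'I_l.+3 => (2 <= i)%N)) /= [X in _ + X]big1 ?addr0; last first.
  move=> i /andP[i1]; rewrite -leqNgt => i2; move: i1; rewrite -val_eqE /= => i1.
  have -> : nat_of_ord i = 0%N by case: (nat_of_ord i) i1 i2 => [|[]].
  by rewrite expr0 coef1 mulr0.
by apply: eq_bigl => i; rewrite -val_eqE /=; case: (nat_of_ord i) => [|[]].
Qed.

Lemma Vp_00 m : (Vp 0 m)`_0 = 1.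
Proof.
elim: m => [|m IH].
  by rewrite /Vp coef_poly /Vraw /damp /= mul0r oppr0 expR0 coefD coefC coefZ coefX mulr0 addr0 expr0 divr1.
have := @Vp_step 0 m 0 (lexx 0) (leq0n _); rewrite mulr0 expr0 mul1r => ->.
apply: EFin_inj; rewrite (jet0E tilt_ge0 (lexx 1) tilt_bin_fin); last exact: jdom_Vp.
by under eq_eseriesr do rewrite IH expr1n mulr1; case: tilt_offspring.
Qed.

Lemma Vp_01 m : (Vp 0 m)`_1 = 1.
Proof.
elim: m => [|m IH].
  rewrite /Vp coef_poly ltnS D1 /Vraw /damp /= mul0r oppr0 expR0 coefD coefC coefZ coefX.
  by rewrite expr0 expr1n divr1 mulr1 add0r.
have := @Vp_step 0 m 1 (lexx 0) D1; rewrite mulr0 expr1.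
rewrite jet_expand ?Vp_00//; last exact: jdom_Vp.
rewrite !big_ord_recl big_ord0 /= expr0 coef1 mulr0 add0r addr0 expr1 coefB coefC subr0 IH.
rewrite bin_moment1.
by move=> H; apply: (mulfI (lt0r_neq0 mub0)).
Qed.

(** In a product of at least two polynomials without constant term, the
    coefficient of degree [l] involves coefficients of degree below [l] only. *)
Lemma coefX_tail_le (A B : {poly R}) i l : (2 <= i)%N -> A`_0 = 0 -> B`_0 = 0 ->
  (forall j, (j < l)%N -> 0 <= A`_j <= B`_j) -> (A ^+ i)`_l <= (B ^+ i)`_l.
Proof.
case: i => [|[|i]]// _ A0 B0 AB.
have [->|l0] := posnP l; first by rewrite !coef0_exp A0 B0 expr0n.
rewrite exprS [B ^+ _]exprS !coefM; apply: ler_sum => j _.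
have jl : (j <= l)%N by rewrite -ltnS.
have [j0|j0] := posnP j; first by rewrite j0 A0 B0 !mul0r.
have [jl'|jl'] := ltnP j l; last first.
  have -> : nat_of_ord j = l by apply/eqP; rewrite eqn_leq jl jl'.
  by rewrite subnn !coef0_exp A0 B0 !expr0n !mulr0.
have /andP[a0 ab] := AB _ jl'.
have /andP[c0 cd] : 0 <= (A ^+ i.+1)`_(l - j) <= (B ^+ i.+1)`_(l - j).
  apply: (@coefX_le _ _ _ (l - 1)); last by rewrite leq_sub2l.
  by move=> k kl; apply: AB; rewrite (leq_ltn_trans kl)// ltn_subrL.
exact: ler_pM.
Qed.

(** By [Vp_step] and [jet_split] the moment of order [l] obeys an affine
    recursion with factor [mub / mub ^+ l < 1], driven by the moments of lower
    order. For [l <= 1] the normalised moment is constant. *)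
Lemma Vp_bounded : exists2 B : {poly R}, B`_0 = 1 &
  forall m j, (j <= D)%N -> (Vp 0 m)`_j <= B`_j.
Proof.
suff H l : (l <= D)%N -> exists2 B : {poly R}, B`_0 = 1 & forall m j, (j <= l)%N -> (Vp 0 m)`_j <= B`_j.
  exact: H.
elim: l => [|l IH] lD.
  by exists 1; rewrite ?coef1// => m [|j]//; rewrite Vp_00 coef1.
have [B B0 HB] := IH (ltnW lD).
have [l0|l0] := posnP l.
  exists (1 + 'X); first by rewrite coefD coef1 coefX addr0.
  by move=> m [|[|j]]; rewrite l0// => _; rewrite ?Vp_00 ?Vp_01 coefD coef1 coefX ?addr0 ?add0r.
pose K := higher l.+1 B.
pose rho := (mub ^+ l)^-1.
have rho0 : 0 <= rho by rewrite invr_ge0 ltW.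
have rho1 : rho < 1 by rewrite invf_lt1// exprn_egt1// -lt0n.
have B'0 : (B - 1%:P)`_0 = 0 by rewrite coefB coefC B0 subrr.
have rec m : (Vp 0 m.+1)`_l.+1 <= rho * (Vp 0 m)`_l.+1 + (mub ^+ l.+1)^-1 * K.
  have := @Vp_step 0 m l.+1 (lexx 0) lD; rewrite mulr0 => H.
  have -> : (Vp 0 m.+1)`_l.+1 = (mub ^+ l.+1)^-1 * (jet D qb (Vp 0 m))`_l.+1.
    by rewrite -H mulKf// expf_neq0// gt_eqF.
  have dV := jdom_Vp m (lexx 0).
  have -> : rho * (Vp 0 m)`_l.+1 = (mub ^+ l.+1)^-1 * (mub * (Vp 0 m)`_l.+1).
    by rewrite /rho exprS; field; rewrite expf_neq0 ?gt_eqF.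
  rewrite -mulrDr ler_wpM2l ?invr_ge0 ?(ltW (mubX _))//.
  rewrite jet_split ?Vp_00//; last by rewrite ltnS l0.
  rewrite lerD2l; apply: ler_sum => i i2; apply: ler_wpM2l; first exact: bin_moment_ge0.
  apply: coefX_tail_le => //; first by rewrite coefB coefC Vp_00 subrr.
  move=> j jl; rewrite !coefB !coefC; case: eqP => [->|_]; first by rewrite Vp_00 B0 lexx subrr lexx.
  by rewrite !subr0 HB// andbT; case: dV.
pose M := Num.max ((Vp 0 0)`_l.+1) ((mub ^+ l.+1)^-1 * K / (1 - rho)).
have bd m : (Vp 0 m)`_l.+1 <= M.
  elim: m => [|m IHm]; first by rewrite le_max lexx.
  apply: (le_trans (rec m)); apply: (@le_trans _ _ (rho * M + (1 - rho) * M)); last by rewrite -mulrDl subrKC mul1r.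
  rewrite lerD ?ler_wpM2l// [leRHS]mulrC -ler_pdivrMr ?subr_gt0//.
  by rewrite le_max lexx orbT.
exists (\poly_(j < l.+2) (if j == l.+1 then M else B`_j)); first by rewrite coef_poly.
move=> m j jl; rewrite [leRHS]coef_poly ltnS jl; case: eqP => [->//|/eqP jl'].
by apply: HB; rewrite -ltnS ltn_neqAle jl'.
Qed.


(** * The limit of the normalised process *)

Variables (P : probability tree R) (Y : tree -> R).
Hypotheses (P_GW : is_GW qb 0 P) (mY : measurable_fun [set: tree] Y) (Y0 : forall t, 0 <= Y t).
Hypothesis Y_lim : {ae P, forall t, (zcard m t)%:R / mub ^+ m @[m --> \oo] --> Y t}.

Definition yexp j (b : R) t : R := Y t ^+ j * expR (- (b * Y t)).

(** These numbers are, up to the factor [(-1) ^ j], the Taylor coefficients of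
    the Laplace transform of [Y] at [b]. *)
Definition wmom j b : R := rE P (yexp j b) / j`!%:R.

Local Notation w := wmom.

Let factR j : 0 < j`!%:R :> R. Proof. by rewrite ltr0n fact_gt0. Qed.

Lemma measurable_yexp j b : measurable_fun [set: tree] (yexp j b).
Proof.
apply: measurable_funM; first exact: measurable_funX.
by apply: measurableT_comp => //; apply: measurable_funN; exact: measurable_funM.
Qed.

Lemma yexp_ge0 j b t : 0 <= yexp j b t.
Proof. by rewrite mulr_ge0 ?exprn_ge0 ?expR_ge0. Qed.

(** Binomial coefficients are equivalent to powers: the shifts by [i / mub ^+
    m] in their factors vanish. *)
Lemma cvg_binom (z : nat -> nat) (y b : R) j : (z m)%:R / mub ^+ m @[m --> \oo] --> y ->
  'C(z m, j)%:R / (mub ^+ m) ^+ j * expR (- (b * ((z m)%:R / mub ^+ m))) @[m --> \oo]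
    --> y ^+ j * expR (- (b * y)) / j`!%:R.
Proof.
move=> zy; have i0 (i : nat) : i%:R / mub ^+ m @[m --> \oo] --> (0 : R).
  rewrite (_ : (fun m => i%:R / mub ^+ m) = (fun m => i%:R * mub^-1 ^+ m)); last first.
    by apply/funext => m; rewrite exprVn.
  rewrite -[X in _ --> X](mulr0 i%:R); apply: cvgMr; apply: cvg_expr.
  by rewrite normfV gtr0_norm// invf_lt1.
have -> : (fun m => 'C(z m, j)%:R / (mub ^+ m) ^+ j * expR (- (b * ((z m)%:R / mub ^+ m)))) =
    (fun m => (j`!%:R^-1 * \prod_(i < j) ((z m)%:R / mub ^+ m - (i : nat)%:R / mub ^+ m)) *
      expR (- (b * ((z m)%:R / mub ^+ m)))).
  apply/funext => m; congr (_ * _); rewrite -HpolyE /Hpoly -mulrA; congr (_ * _).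
  rewrite -[in _ ^- _](card_ord j) -prodr_const -prodfV -big_split /=.
  by apply: eq_bigr => i _; rewrite mulrBl.
rewrite -[X in _ --> X]mulrA [X in _ --> X]mulrC -[X in _ --> X]mulrA mulrC -[X in _ --> X]mulrA.
rewrite mulrA; apply: cvgM; last first.
  by apply: continuous_cvg; [exact: continuous_expR|apply: cvgN; exact: cvgMr].
apply: cvgMr; rewrite -[in _ ^+ _](card_ord j) -prodr_const.
apply: (@cvg_big R _ *%R 1); first exact: mul_continuous.
by move=> i _; rewrite -[X in _ --> X]subr0; exact: cvgB.
Qed.

Lemma bin_le_exp z j : 'C(z, j)%:R * j`!%:R <= (z%:R ^+ j : R).
Proof.
rewrite -natrM bin_ffact -natrX ler_nat; elim: j => [|j IH]; first by [].
by rewrite ffactnSr expnSr leq_mul// leq_subr.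
Qed.

Lemma exp_poly_bound (x b : R) j : 0 < b -> 0 <= x -> x ^+ j / j`!%:R * expR (- (b * x)) <= b ^- j.
Proof.
move=> b0 x0; rewrite expRN ler_pdivrMr ?expR_gt0// [leRHS]mulrC ler_pdivlMr ?exprn_gt0//.
rewrite mulrAC -exprMn [x * b]mulrC.
case: j => [|j]; first by rewrite expr0 divr1 -expR0 ler_expR mulr_ge0// ltW.
apply: le_trans (expR_ge1Dxn j _); last by rewrite mulr_ge0// ltW.
by rewrite lerDr.
Qed.

Definition dbin j (b : R) m t : R :=
  'C(zcard m t, j)%:R / (mub ^+ m) ^+ j * expR (- (b * ((zcard m t)%:R / mub ^+ m))).

Lemma dbin_ge0 j b m t : 0 <= dbin j b m t.
Proof. by rewrite mulr_ge0 ?expR_ge0// divr_ge0 ?exprn_ge0// ltW. Qed.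

Lemma measurable_dbin j b m : measurable_fun [set: tree] (dbin j b m).
Proof.
exact: (measurable_zcard_fun m (fun z => 'C(z, j)%:R / (mub ^+ m) ^+ j * expR (- (b * (z%:R / mub ^+ m))))).
Qed.

Lemma dbin_expectation j b m : (j <= D)%N -> 0 <= b -> ('E_P[dbin j b m] = ((Vp b m)`_j)%:E)%E.
Proof.
move=> jD b0; have := Vp_expectation m P_GW b0 jD.
have -> : dbin j b m = (fun t => ((mub ^+ m) ^+ j)^-1 *
    ('C(zcard m t, j)%:R * expR (- (b * ((zcard m t)%:R / mub ^+ m))))).
  by apply/funext => t; rewrite /dbin mulrAC mulrC.
rewrite (@expectation_zcardZ _ P m ((mub ^+ m) ^+ j)^-1
  (fun z => 'C(z, j)%:R * expR (- (b * (z%:R / mub ^+ m))))).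
- by move=> ->; rewrite -EFinM mulKf// !expf_neq0// gt_eqF.
- by rewrite invr_ge0 !exprn_ge0// ltW.
- by move=> z; rewrite mulr_ge0 ?expR_ge0.
Qed.

(** By Fatou's lemma, the limit inherits the uniform bound on normalised
    moments given by [Vp_bounded]. *)
Lemma yexp_fin j b : (j <= D)%N -> 0 <= b -> ('E_P[yexp j b] < +oo)%E.
Proof.
move=> jD b0; have [B _ HB] := Vp_bounded.
pose f := dbin j b; have f0 m t : 0 <= f m t := dbin_ge0 j b m t.
have mf m : measurable_fun [set: tree] (f m) := measurable_dbin j b m.
have Ef m : ('E_P[f m] <= (B`_j)%:E)%E.
  rewrite dbin_expectation// lee_fin (le_trans _ (HB m j jD))//.
  exact: (Vp_le m b0).
have : ((j`!%:R^-1)%:E * 'E_P[yexp j b] <= (B`_j)%:E)%E.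
  rewrite unlock -ge0_integralZl_EFin//; last 2 first.
  - by move=> t _; rewrite lee_fin yexp_ge0.
  - by apply/measurable_EFinP; exact: measurable_yexp.
  have mfE m : measurable_fun [set: tree] (EFin \o f m) by apply/measurable_EFinP.
  have := @fatou _ _ _ P setT measurableT (fun m => EFin \o f m) mfE.
  move=> /(_ (fun m t _ => f0 m t)) F.
  rewrite (_ : (\int[P]_t _ = \int[P]_t limn_einf ((fun m => EFin \o f m) ^~ t))%E); last first.
    apply: ae_eq_integral => //.
    - by apply/measurable_EFinP; apply: measurable_funM => //; exact: measurable_yexp.
    - have -> : (fun t => limn_einf (fun m => (EFin \o f m) t)) =
          (fun t => - limn_esup (fun m => - (EFin \o f m) t))%E.
        by apply/funext => t; rewrite -limn_einfN; congr limn_einf; apply/funext => m /=; rewrite opprK.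
      apply: measurableT_comp => //; apply: measurable_fun_limn_esup => m.
      exact: measurableT_comp.
    apply: filterS Y_lim => t /(@cvg_binom (fun m => zcard m t) _ b j) Ht _.
    have HE : ((EFin \o f m) t @[m --> \oo] --> (Y t ^+ j * expR (- (b * Y t)) / j`!%:R)%:E)%E.
      by apply: cvg_EFin; [exact: nearW|exact: Ht].
    rewrite (cvg_limn_einf_sup HE).1.
    by rewrite /yexp -EFinM mulrC.
  apply: le_trans F _; rewrite limn_einf_lim; apply: lime_le; first exact: is_cvg_einfs.
  apply: nearW => m; apply: ereal_inf_le; exists (\int[P]_t (EFin \o f m) t)%E; first by exists m => /=.
  by have := Ef m; rewrite unlock.
have := @expectation_ge0 _ _ _ P (yexp j b) (yexp_ge0 j b).
case: ('E_P[_])%E => [x|_|]//=; first by rewrite ltry.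
by rewrite gt0_muley ?lte_fin ?invr_gt0.
Qed.

Lemma yexp_dom j b : (j <= D)%N -> 0 <= b -> dominates P (yexp j 0) (yexp j b).
Proof.
move=> jD b0; split; [exact: measurable_yexp..| |exact: yexp_fin].
move=> t; rewrite ger0_norm ?yexp_ge0// ler_wpM2l ?exprn_ge0//.
by rewrite ler_expR mul0r oppr0 oppr_le0 mulr_ge0.
Qed.

Lemma w_ge0 j b : 0 <= w j b.
Proof. by rewrite divr_ge0 ?ler0n// rE_ge0// => t; exact: yexp_ge0. Qed.

Lemma w_cvg (b : nat -> R) (b' : R) j : (j <= D)%N -> (forall k, 0 <= b k) -> 0 <= b' ->
  b k @[k --> \oo] --> b' -> w j (b k) @[k --> \oo] --> w j b'.
Proof.
move=> jD b0 b'0 bb; apply: cvgMl; apply: (@rE_cvg _ P _ _ (yexp j 0)).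
- by move=> k; exact: yexp_dom.
- exact: yexp_dom.
- apply: aeW => t; apply: cvgMr; apply: continuous_cvg; first exact: continuous_expR.
  by apply: cvgN; exact: cvgMl.
Qed.

Lemma w00 : w 0 0 = 1.
Proof.
rewrite /wmom fact0 divr1 /rE (_ : yexp 0 0 = cst 1) ?expectation_cst//.
by apply/funext => t; rewrite /yexp mul0r oppr0 expR0 mulr1.
Qed.

(** A positive damping makes the integrands bounded, by [exp_poly_bound], so
    that dominated convergence applies without uniform integrability. *)
Lemma Vp_cvg_w b j : (j <= D)%N -> 0 < b -> (Vp b m)`_j @[m --> \oo] --> w j b.
Proof.
move=> jD b0.
pose f := dbin j b; have f0 m t : 0 <= f m t := dbin_ge0 j b m t.
have mf m : measurable_fun [set: tree] (f m) := measurable_dbin j b m.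
have Ef m : (Vp b m)`_j = rE P (f m) by rewrite /rE dbin_expectation// ltW.
have -> : (fun m => (Vp b m)`_j) = (fun m => rE P (f m)) by apply/funext.
have -> : w j b = rE P (fun t => j`!%:R^-1 * yexp j b t).
  by rewrite (rE_scale _ (yexp_dom jD (ltW b0))) mulrC.
have cst_fin : ('E_P[cst (b ^- j)] < +oo)%E by rewrite expectation_cst ltry.
apply: (@rE_cvg _ P _ _ (cst (b ^- j))).
- move=> m; split=> // t; rewrite ger0_norm//.
  have x0 : 0 <= (zcard m t)%:R / mub ^+ m by rewrite divr_ge0// ltW.
  apply: le_trans (exp_poly_bound j b0 x0); rewrite ler_wpM2r ?expR_ge0//.
  rewrite ler_pdivlMr// mulrAC expr_div_n ler_pM2r ?invr_gt0 ?exprn_gt0//.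
  exact: bin_le_exp.
- split=> //; first by apply: measurable_funM => //; exact: measurable_yexp.
  move=> t; rewrite ger0_norm; last by rewrite mulr_ge0 ?invr_ge0 ?ler0n ?yexp_ge0.
  by apply: le_trans (exp_poly_bound j b0 (Y0 t)); rewrite /yexp mulrA [_^-1 * _]mulrC.
- apply: filterS Y_lim => t /(@cvg_binom (fun m => zcard m t) _ b j).
  by rewrite /yexp mulrC.
Qed.


(** * Convergence of the normalised moments and the functional equation *)

Definition wpoly b : {poly R} := \poly_(j < D.+1) w j b.

Lemma coef_wpoly b j : (j <= D)%N -> (wpoly b)`_j = w j b.
Proof. by move=> jD; rewrite coef_poly ltnS jD. Qed.

Lemma le_w j b : (j <= D)%N -> 0 <= b -> w j b <= w j 0.
Proof.
move=> jD b0; rewrite ler_pM2r ?invr_gt0// -lee_fin.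
have dom := yexp_dom jD.
rewrite -(rE_fin (dom _ b0)) -(rE_fin (dom _ (lexx 0))).
case: (dom _ b0) => m1 m0 le1 _; apply: expectation_le => //.
- by move=> t; exact: yexp_ge0.
- by move=> t; exact: yexp_ge0.
- by apply: aeW => t; exact: le_trans (ler_norm _) (le1 t).
Qed.

Lemma pge0_wpoly b : pge0 (wpoly b).
Proof. by move=> j; rewrite coef_poly; case: ifP => // _; exact: w_ge0. Qed.

Lemma ple_wpoly b : 0 <= b -> ple (wpoly b) (wpoly 0).
Proof. by move=> b0 j; rewrite !coef_poly; case: ifP => // jD; exact: le_w. Qed.

Lemma jdom_wpoly b : 0 <= b -> jdom 1 (wpoly b).
Proof.
move=> b0; split; first exact: pge0_wpoly.
by rewrite coef_wpoly// -(w00) le_w.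
Qed.

Lemma Vp_dom : exists2 B : {poly R}, jdom 1 B & forall b m, 0 <= b -> ple (Vp b m) B.
Proof.
have [B B0 HB] := Vp_bounded.
have dV b m := jdom_Vp (b := b) m.
exists (\poly_(j < D.+1) B`_j).
  split=> [j|]; rewrite coef_poly ?B0//; case: ifP => // jD.
  by apply: le_trans (HB 0%N j jD); case: (dV 0 0%N (lexx 0)).
move=> b m b0 j; rewrite [leRHS]coef_poly; case: ifP => jD; last first.
  by rewrite /Vp coef_poly jD.
by apply: le_trans (HB m j jD); exact: (Vp_le m b0).
Qed.

(** Dominated convergence in the series defining the jet, seen as an
    expectation over the first generation. *)
Lemma jet_cvg (A : nat -> {poly R}) (A' B : {poly R}) l : jdom 1 B -> (l <= D)%N ->
  (forall m, pge0 (A m) /\ ple (A m) B) -> pge0 A' -> ple A' B ->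
  (forall j, (j <= D)%N -> (A m)`_j @[m --> \oo] --> A'`_j) ->
  (jet D qb (A m))`_l @[m --> \oo] --> (jet D qb A')`_l.
Proof.
move=> dB lD A0 A'0 A'B AA'.
have J C : pge0 C -> ple C B -> ('E_P[fun t => ((C ^+ zcard 1 t)`_l)%R] = ((jet D qb C)`_l)%:E)%E.
  move=> C0 CB; have dC : jdom 1 C.
    by split=> //; case: dB => _; apply: le_trans.
  have := @coef_jetn _ D qb 0 P (tilt_offspring) P_GW 1 C l C0.
  by rewrite addn0 => -> //; exact: (@jetn_jfin _ D _ _ tilt_ge0 (lexx 1) tilt_le1 tilt_bin_fin).
have [B0 _] := dB.
have := @cvg_expectation_zcard _ P 1 [set: tree] (fun m z => (A m ^+ z)`_l)
  (fun z => (A' ^+ z)`_l) (fun z => (B ^+ z)`_l) measurableT.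
rewrite -expectationT J// (_ : (fun m => 'E_P[_])%E = (fun m => ((jet D qb (A m))`_l)%:E)); last first.
  by apply/funext => m; rewrite -expectationT; have [a b] := A0 m; exact: J.
rewrite (J A')// => H; have /fine_cvgP[_] : (((jet D qb (A m))`_l)%:E @[m --> \oo] --> ((jet D qb A')`_l)%:E)%E.
  apply: H.
  - by move=> z; refine (@cvg_coefX R A A' D z l AA' lD).
  - move=> m z; have [a b] := A0 m; apply/andP; split; first exact: (pge0X z a).
    exact: (pleX z a b).
  - exact: ltry.
exact.
Qed.

Let lim_unique (u : nat -> R) (x y : R) : u m @[m --> \oo] --> x -> u m @[m --> \oo] --> y -> x = y.
Proof. by move=> ux uy; apply: (cvg_unique _ ux uy). Qed.

Let w_step_gt0 b l : 0 < b -> (l <= D)%N -> mub ^+ l * w l (mub * b) = (jet D qb (wpoly b))`_l.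
Proof.
move=> b0 lD; have [B dB HB] := Vp_dom.
have dV m := jdom_Vp (b := b) m (ltW b0).
have Vw b' j (b'0 : 0 < b') (jD : (j <= D)%N) :=
  Vp_cvg_w jD b'0.
apply: (@lim_unique (fun m => mub ^+ l * (Vp (mub * b) m.+1)`_l)).
  apply: cvgMr; have := Vw (mub * b) l (mulr_gt0 mub0 b0) lD.
  by rewrite -cvg_shiftS.
rewrite (_ : (fun m => _) = (fun m => (jet D qb (Vp b m))`_l)); last first.
  by apply/funext => m; exact: (Vp_step m (ltW b0) lD).
apply: (@jet_cvg (fun m => Vp b m) _ B) => //.
- by move=> m; split; [case: (dV m)|exact/HB/ltW].
- exact: pge0_wpoly.
- move=> j; rewrite coef_poly; case: ifP => jD; last by case: dB.
  apply: (cvgr_to_le (Vw b j b0 jD)); apply: nearW => m; exact/HB/ltW.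
- by move=> j jD; rewrite coef_wpoly//; exact: Vw.
Qed.

(** The limit of [Vp_step]. At [b = 0] the damped moments are not available,
    and the identity follows by letting [b] decrease to [0]. *)
Lemma w_step b l : 0 <= b -> (l <= D)%N -> mub ^+ l * w l (mub * b) = (jet D qb (wpoly b))`_l.
Proof.
rewrite le_eqVlt => /orP[/eqP <-|]; last exact: w_step_gt0.
move=> lD; rewrite mulr0.
have h0 : harmonic m @[m --> \oo] --> (0 : R) by exact: cvg_harmonic.
have hp m : 0 < harmonic m :> R by rewrite invr_gt0 ltr0n.
have W u (u0 : forall k, 0 <= u k) (u1 : u k @[k --> \oo] --> (0 : R)) j (jD : (j <= D)%N) :=
  w_cvg jD u0 (lexx 0) u1.
apply: (@lim_unique (fun m => mub ^+ l * w l (mub * harmonic m))).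
  apply: cvgMr; apply: W => //; first by move=> k; rewrite mulr_ge0// ltW.
  by rewrite -[X in _ --> X](mulr0 mub); exact: cvgMr.
rewrite (_ : (fun m => _) = (fun m => (jet D qb (wpoly (harmonic m)))`_l)); last first.
  by apply/funext => m; exact: w_step_gt0.
apply: (@jet_cvg (fun m => wpoly (harmonic m)) _ (wpoly 0)) => //.
- exact: jdom_wpoly.
- by move=> m; split; [exact: pge0_wpoly|apply: ple_wpoly; exact: ltW].
- exact: pge0_wpoly.
- move=> j jD; rewrite coef_wpoly// (_ : (fun m => _) = (fun m => w j (harmonic m))).
    by apply: W => // k; exact: ltW.
  by apply/funext => m; rewrite coef_wpoly.
Qed.

(** As [exp (- y) + y <= 1 + y ^+ 2] and second moments are bounded, the
    damped mass is at most [1 - b + O(b ^+ 2)] in all generations: it stays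
    away from [1] for a small [b], which is impossible if [Y] vanishes. *)
Lemma limit_nondegenerate : (2 <= D)%N -> ~ {ae P, forall t, Y t = 0}.
Proof.
move=> D2 Yz; have [B dB HB] := Vp_dom.
have B2 : 0 <= B`_2 by case: dB.
pose C := 2 * B`_2 + 1; have C1 : 1 <= C by rewrite lerDr mulr_ge0.
have C0 : 0 < C by exact: lt_le_trans C1.
pose b : R := (2 * C)^-1; have b0 : 0 < b by rewrite invr_gt0 mulr_gt0.
have E1 : w 0 b = 1.
  rewrite /wmom fact0 divr1 -[RHS](w00) /wmom fact0 divr1.
  apply: ae_eq_rE; [exact: measurable_yexp..|].
  by apply: filterS Yz => t Yt; rewrite /yexp Yt !mulr0.
have := Vp_cvg_w (leq0n D) b0.
rewrite E1 => V1; suff : 1 <= 1 - b / 2 by rewrite lerDl oppr_ge0 leNgt divr_gt0.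
apply: (cvgr_to_le V1); apply: nearW => m.
pose x z : R := z%:R / mub ^+ m.
have x0 z : 0 <= x z by rewrite divr_ge0// ltW.
have xx z : x z ^+ 2 = ('C(z, 2)%:R / (mub ^+ m) ^+ 2) * 2 + ('C(z, 1)%:R / (mub ^+ m) ^+ 1) / mub ^+ m.
  have zz : (z ^ 2 = 2 * 'C(z, 2) + 'C(z, 1))%N.
    rewrite bin1; elim: z => [//|z IH]; rewrite -addn1 sqrnD IH addn1 binS bin1 exp1n muln1; lia.
  rewrite /x expr_div_n -natrX zz natrD natrM expr1.
  by move: (mubX m); generalize (mub ^+ m) => y y0; field; rewrite gt_eqF.
have exp_le (y : R) : 0 <= y -> expR (- y) + y <= 1 + y ^+ 2.
  move=> y0; rewrite -lerBrDr expRN -[leLHS]mul1r ler_pdivrMr ?expR_gt0//.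
  apply: (@le_trans _ _ ((1 + y ^+ 2 - y) * (1 + y))).
    have -> : (1 + y ^+ 2 - y) * (1 + y) = 1 + y ^+ 3 by ring.
    by rewrite lerDl exprn_ge0.
  rewrite ler_wpM2l ?expR_ge1Dx//.
  have -> : 1 + y ^+ 2 - y = (1 - y / 2) ^+ 2 + 3 / 4 * y ^+ 2 by field.
  by rewrite addr_ge0 ?sqr_ge0// mulr_ge0 ?sqr_ge0.
pose g j b' z : R := 'C(z, j)%:R / (mub ^+ m) ^+ j * expR (- (b' * x z)).
have g0 j b' z : 0 <= g j b' z by rewrite mulr_ge0 ?expR_ge0// divr_ge0 ?exprn_ge0// ltW.
have Eg j b' : 0 <= b' -> (j <= D)%N -> ('E_P[fun t => g j b' (zcard m t)] = ((Vp b' m)`_j)%:E)%E.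
  by move=> b'0 jD; exact: dbin_expectation.
have c1 : 0 <= 2 * b ^+ 2 by rewrite mulr_ge0 ?sqr_ge0.
have c2 : 0 <= b ^+ 2 / mub ^+ m by rewrite mulr_ge0 ?sqr_ge0 ?invr_ge0 ?(ltW (mubX m)).
have g1 c j z (c0 : 0 <= c) : 0 <= c * g j 0 z := mulr_ge0 c0 (g0 j 0 z).
have V00 := Vp_00 m.
have V01 := Vp_01 m.
have : ('E_P[fun t => (g 0 b (zcard m t) + b * g 1 0 (zcard m t))%R] <=
  'E_P[fun t => (g 0 0 (zcard m t) + (2 * b ^+ 2 * g 2 0 (zcard m t) + b ^+ 2 / mub ^+ m * g 1 0 (zcard m t)))%R])%E.
  apply: (@expectation_zcard_le _ P m (fun z => g 0 b z + b * g 1 0 z)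
    (fun z => g 0 0 z + (2 * b ^+ 2 * g 2 0 z + b ^+ 2 / mub ^+ m * g 1 0 z))) => z.
  apply/andP; split; first exact: (addr_ge0 (g0 0%N b z) (mulr_ge0 (ltW b0) (g0 1%N 0 z))).
  rewrite /g !mul0r oppr0 expR0 !mulr1 !bin0 !expr0 divr1 mul1r.
  have -> : b * ('C(z, 1)%:R / mub ^+ m ^+ 1) = b * x z by rewrite bin1 expr1.
  apply: le_trans (exp_le _ (mulr_ge0 (ltW b0) (x0 z))) _.
  by rewrite lerD2l exprMn xx le_eqVlt; apply/orP; left; apply/eqP; ring.
rewrite (@expectation_zcardD _ P m (fun z => g 0 b z) (fun z => b * g 1 0 z))//; last first.
  by move=> z; exact/g1/ltW.
rewrite (@expectation_zcardZ _ P m b (fun z => g 1 0 z)) ?(ltW b0)//.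
rewrite (@expectation_zcardD _ P m (fun z => g 0 0 z) (fun z => 2 * b ^+ 2 * g 2 0 z + b ^+ 2 / mub ^+ m * g 1 0 z))//; last first.
  by move=> z; apply: addr_ge0; exact: g1.
rewrite (@expectation_zcardD _ P m (fun z => 2 * b ^+ 2 * g 2 0 z) (fun z => b ^+ 2 / mub ^+ m * g 1 0 z))//; last 2 first.
- by move=> z; exact: g1.
- by move=> z; exact: g1.
rewrite (@expectation_zcardZ _ P m (2 * b ^+ 2) (fun z => g 2 0 z))//.
rewrite (@expectation_zcardZ _ P m (b ^+ 2 / mub ^+ m) (fun z => g 1 0 z))//.
rewrite !Eg ?(ltW b0)// -!EFinM -!EFinD lee_fin V01 !mulr1.
rewrite V00 => H.
have : b ^+ 2 / mub ^+ m <= b ^+ 2.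
  by rewrite ler_pdivrMr// ler_peMr ?sqr_ge0// exprn_ege1// ltW.
have : 2 * b ^+ 2 * (Vp 0 m)`_2 <= 2 * b ^+ 2 * B`_2.
  exact: (ler_wpM2l c1 (HB 0 m (lexx 0) 2%N)).
have : b ^+ 2 * C = b / 2 by rewrite /b; field; rewrite gt_eqF.
rewrite /C mulrDr mulr1 => H1 H2 H3.
by move: H H1 H2 H3; set X := (Vp b m)`_0; lra.
Qed.

Lemma w_gt0 j b : (j <= D)%N -> 0 <= b -> (j = 0%N \/ ~ {ae P, forall t, Y t = 0}) -> 0 < w j b.
Proof.
move=> jD b0 H; rewrite divr_gt0//.
apply: (rE_gt0 (yexp_dom jD b0)).
  by move=> t; exact: yexp_ge0.
move=> Hz; case: H => [j0|]; last first.
  apply; apply: filterS Hz => t /eqP; rewrite mulf_eq0 (gt_eqF (expR_gt0 _)) orbF.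
  by rewrite expf_eq0 => /andP[_ /eqP].
have /(_ _)[] : (P [set: tree] = 0)%E -> False.
  by rewrite probability_setT => /eqP; rewrite eqe oner_eq0.
apply/(negligibleP P measurableT); case: Hz => N [mN PN sN]; exists N; split=> // t _; apply: sN => /eqP.
by rewrite /= j0 /yexp expr0 mul1r gt_eqF// expR_gt0.
Qed.

Lemma eq_coefX_tail (A B : {poly R}) i l : (2 <= i)%N -> pge0 A -> A`_0 = 0 -> B`_0 = 0 ->
  (forall j, (j < l)%N -> A`_j = B`_j) -> (A ^+ i)`_l = (B ^+ i)`_l.
Proof.
move=> i2 A0 a0 b0 AB; apply/eqP; rewrite eq_le; apply/andP; split; apply: coefX_tail_le => // j jl.
  by rewrite -AB// A0 lexx.
by rewrite -AB// A0 lexx.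
Qed.

(** Without damping, uniform integrability of the top moments is not clear.
    Convergence comes instead from the recursion of [Vp_bounded], a
    contraction driven by the moments of lower order. The moments of [Y]
    satisfy the same fixed point equations, whose solutions are determined by
    the coefficient of degree [1] up to the scaling [x_l |-> c ^+ l * x_l]. *)
Lemma Vp0_cvg l : (l <= D)%N -> 0 < w 1 0 ->
  (Vp 0 m)`_l @[m --> \oo] --> (w 1 0)^-1 ^+ l * w l 0.
Proof.
move=> + c0; set c := (w 1 0)^-1; have c0' : 0 < c by rewrite invr_gt0.
pose A : {poly R} := \poly_(j < D.+1) (c ^+ j * w j 0).
have AE j : (j <= D)%N -> A`_j = c ^+ j * w j 0 by move=> jD; rewrite coef_poly ltnS jD.
have A0 : A`_0 = 1 by rewrite AE// expr0 mul1r w00.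
have dA : jdom 1 A.
  split; last by rewrite A0.
  by move=> j; rewrite coef_poly; case: ifP => // _; rewrite mulr_ge0 ?exprn_ge0 ?w_ge0// ltW.
have Astep k : (k <= D)%N -> mub ^+ k * A`_k = (jet D qb A)`_k.
  move=> kD; rewrite (jet_scale (A := wpoly 0) (ltW c0'))//.
  - by rewrite -w_step// mulr0 AE// mulrCA.
  - exact: pge0_wpoly.
  - by move=> j jD; rewrite AE// coef_wpoly.
have dV m := jdom_Vp (b := 0) m (lexx 0).
have V0 := Vp_00.
elim/ltn_ind: l => l IH lD; rewrite -AE//.
have [l1|l2] := leqP l 1.
  case: l l1 lD {IH} => [|[|]]// _ lD.
    by rewrite A0 (_ : (fun m => _) = (fun=> 1)); [exact: cvg_cst|apply/funext => m; exact: V0].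
  rewrite AE// expr1 mulVf ?gt_eqF//.
  rewrite (_ : (fun m => _) = (fun=> 1)); first exact: cvg_cst.
  by apply/funext => m; exact: (Vp_01).
have l0 : (0 < l)%N by exact: ltnW.
pose tr (B : {poly R}) : {poly R} := \poly_(j < l) (B - 1%:P)`_j.
have Ktr (B : {poly R}) : jdom 1 B -> B`_0 = 1 -> higher l B = \sum_(i < l.+1 | (2 <= i)%N) bin_moment i * (tr B ^+ i)`_l.
  move=> [B0 _] B1; apply: eq_bigr => i i2; congr (_ * _); apply: eq_coefX_tail => //.
  - by rewrite -B1; exact: pge0_tail.
  - by rewrite coefB coefC B1 subrr.
  - by rewrite coef_poly l0 coefB coefC B1 subrr.
  - by move=> j jl; rewrite coef_poly jl.
have l2D : (2 <= l <= D)%N by rewrite l2.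
have Kcvg : higher l (Vp 0 m) @[m --> \oo] --> higher l A.
  rewrite (Ktr A)// (_ : (fun m => _) = (fun m => \sum_(i < l.+1 | (2 <= i)%N) bin_moment i * (tr (Vp 0 m) ^+ i)`_l)); last first.
    by apply/funext => m; exact: Ktr.
  apply: (@cvg_big R _ +%R 0); first exact: add_continuous.
  move=> i _; apply: cvgMr; apply: (@cvg_coefX _ (fun m => tr (Vp 0 m)) (tr A) l) => // j jl.
  rewrite (_ : (fun m => _) = (fun m => if (j < l)%N then (Vp 0 m)`_j - (1%:P : {poly R})`_j else 0)); last first.
    by apply/funext => m; rewrite coef_poly; case: ifP => // _; rewrite coefB.
  rewrite coef_poly; case: ifP => jl'; last exact: cvg_cst.
  rewrite coefB; apply: cvgB; last exact: cvg_cst.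
  have jD : (j <= D)%N by rewrite (leq_trans (ltnW jl')).
  by rewrite AE//; exact: IH.
pose rho := mub / mub ^+ l.
have rho1 : 0 <= rho < 1.
  by rewrite divr_ge0 ?ltW//= ltr_pdivrMr// mul1r -[ltLHS]expr1 ltr_eXn2l.
have -> : A`_l = higher l A / mub ^+ l / (1 - rho).
  have := Astep _ lD; rewrite jet_split// => H; have n1 : 1 - rho != 0 by rewrite subr_eq0 gt_eqF//; case/andP: rho1.
  apply: (mulIf n1); rewrite divfK// (_ : higher l A = mub ^+ l * A`_l - mub * A`_l); last by rewrite H; ring.
  by rewrite /rho; field; rewrite expf_neq0// gt_eqF.
apply: (@cvg_contraction _ _ (fun m => higher l (Vp 0 m) / mub ^+ l)) => //; last exact: cvgMl.
move=> m; have := Vp_step m (lexx 0) lD.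
rewrite mulr0 jet_split// => H.
have -> : (Vp 0 m.+1)`_l = (mub ^+ l)^-1 * (mub * (Vp 0 m)`_l + higher l (Vp 0 m)).
  by rewrite -H mulKf// expf_neq0// gt_eqF.
by rewrite /rho; ring.
Qed.

(** The constant [c] is [1] if [b > 0]. For [b = 0] it may differ a priori,
    but it disappears in ratios of homogeneous expressions of degree [p]. *)
Lemma Vp_cvg (p : nat) b : (p <= D)%N -> 0 <= b ->
  ((1 <= p)%N -> ~ {ae P, forall t, Y t = 0}) ->
  exists2 c, 0 < c & forall n l, (l <= p)%N ->
    (Vp (b / mub ^+ n) m)`_l @[m --> \oo] --> c ^+ l * w l (b / mub ^+ n).
Proof.
move=> pD + nY; rewrite le_eqVlt => /orP[/eqP <-|b0]; last first.
  exists 1 => // n l lp; rewrite expr1n mul1r.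
  apply: (Vp_cvg_w).
    exact: leq_trans pD.
  exact: divr_gt0.
case: p => [|p] in pD nY *.
  exists 1 => // n [|]// _; rewrite mul0r expr0 mul1r w00 (_ : (fun m => _) = (fun=> 1)); first exact: cvg_cst.
  by apply/funext => m; exact: (Vp_00).
have w1 : 0 < w 1 0 by apply: w_gt0 => //; right; exact: nY.
exists (w 1 0)^-1; first by rewrite invr_gt0.
by move=> n l lp; rewrite mul0r; apply: Vp0_cvg => //; exact: leq_trans pD.
Qed.


(** * Derivatives of the Laplace transform *)

Let dom := yexp_dom.

(** Differentiation under the expectation: difference quotients of [yexp j]
    are dominated by [Y ^+ j.+1], whose expectation is finite. *)
Lemma yexp_diff (u : nat -> R) (b : R) j : (j < D)%N -> 0 <= b -> (forall k, 0 <= u k) ->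
  u k @[k --> \oo] --> b ->
  (if u k == b then - rE P (yexp j.+1 b)
   else (u k - b)^-1 * (rE P (yexp j (u k)) - rE P (yexp j b))) @[k --> \oo]
    --> - rE P (yexp j.+1 b).
Proof.
move=> jD b0 u0 ub.
have dj x : 0 <= x -> _ := dom (ltnW jD).
have dj' x : 0 <= x -> _ := dom jD.
pose F k t := if u k == b then - yexp j.+1 b t
  else (u k - b)^-1 * (yexp j (u k) t - yexp j b t).
have rEN : - rE P (yexp j.+1 b) = rE P (fun t => -1 * yexp j.+1 b t).
  by rewrite (rE_scale _ (dj' _ b0)) mulN1r.
rewrite [X in _ --> X]rEN.
have EN t : - yexp j.+1 b t = -1 * yexp j.+1 b t by rewrite mulN1r.
have diffE x t : yexp j x t - yexp j b t = Y t ^+ j * (expR (- (x * Y t)) - expR (- (b * Y t))).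
  by rewrite /yexp mulrBr.
have chord x t : 0 <= x -> `|expR (- (x * Y t)) - expR (- (b * Y t))| <= `|x - b| * Y t.
  move=> x0; have /andP[l1 l2] := expRN_chord (x * Y t) (b * Y t).
  have e1 y : 0 <= y -> `|(b * Y t - x * Y t) * expR (- (y * Y t))| <= `|x - b| * Y t.
    move=> y0; rewrite -mulrBl normrM normrM (ger0_norm (Y0 t)) distrC (ger0_norm (expR_ge0 _)).
    by rewrite ler_piMr ?mulr_ge0// -expR0 ler_expR oppr_le0 mulr_ge0.
  have := e1 _ x0; have := e1 _ b0; rewrite !ler_norml => /andP[+ _] /andP[_ +].
  by move=> h1 h2; rewrite (le_trans h1 l1) (le_trans l2 h2).
have mF k : measurable_fun [set: tree] (F k).
  rewrite /F; case: eqP => _.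
    by apply: measurable_funN; exact: measurable_yexp.
  by apply: measurable_funM => //; apply: measurable_funB; exact: measurable_yexp.
have [_ mH _ EH] := dj' _ (lexx 0).
have dF k : dominates P (yexp j.+1 0) (F k).
  split=> // t; rewrite /F; case: eqP => [_|/eqP ukb].
    by rewrite normrN; case: (dj' _ b0).
  have x0 : 0 < `|u k - b| by rewrite normr_gt0 subr_eq0.
  rewrite normrM normfV ler_pdivrMl// diffE normrM ger0_norm ?exprn_ge0//.
  rewrite /yexp mul0r oppr0 expR0 mulr1 exprS mulrA [X in _ <= X]mulrC ler_wpM2l ?exprn_ge0//.
  exact: chord.
have -> : (fun k => if u k == b then - rE P (yexp j.+1 b)
   else (u k - b)^-1 * (rE P (yexp j (u k)) - rE P (yexp j b))) = (fun k => rE P (F k)).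
  apply/funext => k; rewrite /F; case: eqP => _.
    by rewrite rEN; congr rE; apply/funext => t; rewrite EN.
  have dd : dominates P (fun t => yexp j 0 t + yexp j 0 t) (fun t => yexp j (u k) t - yexp j b t).
    have [m1 m0 le1 _] := dj _ (u0 k); have [m2 _ le2 E0] := dj _ b0.
    split.
    - exact: measurable_funB.
    - exact: measurable_funD.
    - by move=> t; rewrite (le_trans (ler_normB _ _))// lerD.
    rewrite unlock; under eq_integral do rewrite EFinD.
    rewrite ge0_integralD//; [|by move=> t _; rewrite lee_fin yexp_ge0|exact/measurable_EFinP|
      by move=> t _; rewrite lee_fin yexp_ge0|exact/measurable_EFinP].
    by move: E0; rewrite unlock => E0; rewrite lte_add_pinfty.
  by rewrite (rE_scale _ dd) (rE_sub (dj _ (u0 k)) (dj _ b0)).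
apply: (@rE_cvg _ P _ _ (yexp j.+1 0)) => //.
  split=> //; first by apply: measurable_funM => //; exact: measurable_yexp.
  by move=> t; rewrite -EN normrN; case: (dj' _ b0).
apply: aeW => t; apply/cvgrPdist_le => e e0.
have cexp : expR (- (u k * Y t)) @[k --> \oo] --> expR (- (b * Y t)).
  by apply: continuous_cvg; [exact: continuous_expR|apply: cvgN; exact: cvgMl].
have cz : Y t ^+ j.+1 * (expR (- (b * Y t)) - expR (- (u k * Y t))) @[k --> \oo] --> 0.
  rewrite -[X in _ --> X](mulr0 (Y t ^+ j.+1)); apply: cvgMr.
  by rewrite -(subrr (expR (- (b * Y t)))); apply: cvgB => //; exact: cvg_cst.
have /cvgrPdist_le/(_ e e0) := cz; apply: filterS => k.
rewrite sub0r normrN normrM (ger0_norm (exprn_ge0 _ (Y0 t))) => Hk.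
rewrite -EN /F; case: eqP => [_|/eqP ukb]; first by rewrite subrr normr0 ltW.
have x0 : u k - b != 0 by rewrite subr_eq0.
apply: le_trans Hk; rewrite -normrN opprB.
have -> : (u k - b)^-1 * (yexp j (u k) t - yexp j b t) - - yexp j.+1 b t =
    (u k - b)^-1 * Y t ^+ j * ((expR (- (u k * Y t)) - expR (- (b * Y t))) -
      (b * Y t - u k * Y t) * expR (- (b * Y t))).
  by rewrite diffE /yexp exprS; move: (expR _) (expR _) => y z; field.
have /andP[l1 l2] := expRN_chord (u k * Y t) (b * Y t).
rewrite -subr_ge0 in l1; rewrite normrM normrM normfV (ger0_norm l1) (ger0_norm (exprn_ge0 _ (Y0 t))).
rewrite -mulrA ler_pdivrMl ?normr_gt0// exprS -mulrA [Y t * _]mulrCA [leRHS]mulrCA ler_wpM2l ?exprn_ge0//.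
apply: (@le_trans _ _ ((b * Y t - u k * Y t) * (expR (- (u k * Y t)) - expR (- (b * Y t))))).
  by rewrite mulrBr lerD2r.
rewrite (le_trans (ler_norm _))// -mulrBl !normrM (ger0_norm (Y0 t)) mulrA.
by rewrite (distrC b) [in leRHS](distrC (expR (- (b * Y t)))).
Qed.

Lemma derivn_laplace j (b : R) : (j <= D)%N -> 0 <= b ->
  derivn_nneg j (laplace P Y) b = (-1) ^+ j * j`!%:R * w j b.
Proof.
move=> jD b0; have -> : (-1) ^+ j * j`!%:R * w j b = (-1) ^+ j * rE P (yexp j b).
  by rewrite -mulrA [_ * w j b]mulrC divfK// gt_eqF.
elim: j => [|j IH] in jD b b0 *.
  rewrite mul1r /derivn_nneg /= /laplace /rE; congr (fine ('E_P[_])%E); apply/funext => t.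
  by rewrite /yexp mul1r.
rewrite /derivn_nneg iterS -/(derivn_nneg j _).
apply: (@deriv_nnegE _ _ (fun y => (-1) ^+ j * rE P (yexp j y))) => //.
  by move=> y y0; apply: IH => //; exact: ltnW.
move=> u u0 ub; have := yexp_diff jD b0 u0 ub => /(@cvgMr _ _ _ _ _ ((-1) ^+ j)) H.
rewrite exprSr -mulrA mulN1r; apply: cvg_trans H; apply: near_eq_cvg; apply: nearW => k /=.
by case: eqP => // _; ring.
Qed.

(** The signs of the derivatives cancel in the quotient, since the orders in
    each composition add up to [p]. What remains is the expansion
    [coefX_expand] of one coefficient of a power, the sum over [i] being the
    number of factors of positive degree. *)
Lemma GbarE (a : R) p n n0 x : 0 <= a -> (p <= D)%N ->
  Gbar (laplace P Y) mub a p n n0 x =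
  ((wpoly (a / mub ^+ n)) ^+ x)`_p / w p (a / mub ^+ n0).
Proof.
move=> a0 pD; have b0 m : 0 <= a / mub ^+ m by rewrite divr_ge0// exprn_ge0// ltW.
have der j m (jD : (j <= D)%N) := derivn_laplace jD (b0 m).
set W := wpoly (a / mub ^+ n); set b := a / mub ^+ n.
have s2 k : (-1) ^+ k * (-1) ^+ k = 1 :> R by rewrite -expr2 sqrr_sign.
rewrite /Gbar; case: p pD => [|p] pD.
  by rewrite !der// fact0 expr0 !mul1r coef0_exp coef_wpoly.
have abarE i : abar (laplace P Y) mub a p.+1 i n = (-1) ^+ p.+1 * ((W - (W`_0)%:P) ^+ i)`_p.+1.
  have E : forall j, (j <= p.+1)%N ->
      (W - (W`_0)%:P)`_j = (\sum_(l < p.+2 | (0 < l)%N) w l b *: 'X^l)`_j.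
    move=> j jp; rewrite coefB coefC coef_sum.
    case: j jp => [|j] jp.
      rewrite subrr big1// => l l0; rewrite coefZ coefXn; case: eqP l0 => [<-//|_ _].
      by rewrite mulr0.
    have jp' : (j.+1 < p.+2)%N by [].
    rewrite subr0 (bigD1 (Ordinal jp'))//= coefZ coefXn eqxx mulr1 big1 ?addr0.
      by rewrite coef_wpoly// (leq_trans jp).
    move=> l /andP[_ lj]; rewrite coefZ coefXn; case: eqP => [E|_]; last by rewrite mulr0.
    by move: lj; rewrite -val_eqE /= -E eqxx.
  rewrite (coefX_eq _ E)// (@coef_sum_exp R (fun l => w l b) p.+2 (fun l => (0 < l)%N)) big_distrr /=; apply: eq_bigr => c /andP[_ /eqP cs].
  rewrite -[in (-1) ^+ _]cs -prodrXr -big_split /=; apply: eq_bigr => r _.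
  rewrite der; last by rewrite (leq_trans _ pD)// -ltnS.
  by rewrite mulrAC mulfK// gt_eqF.
rewrite coefX_expand big_ord_recl expr0 coef1 mulr0 add0r big_add1 big_mkord.
rewrite der// !big_distrr big_distrl /=; apply: eq_bigr => i _.
have W0 : W`_0 = w 0 b by rewrite coef_wpoly.
have -> : laplace P Y b = W`_0 by rewrite -[LHS]/(derivn_nneg 0 (laplace P Y) b) der// W0 expr0 fact0 !mul1r.
rewrite HpolyE abarE /bump leq0n add1n; set C := ((W - _) ^+ _)`_ _.
case: (leqP i.+1 x) => ix; last by rewrite bin_small// !(mulr0, mul0r).
have -> : W`_0 ^ (x%:Z - i.+1%:Z) = W`_0 ^+ (x - i.+1) by rewrite subzn.
set wq := w p.+1 (a / mub ^+ n0); move: wq => wq.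
rewrite !invfM; have -> : ((-1) ^+ p.+1)^-1 = (-1) ^+ p.+1 :> R by rewrite -signr_odd; case: odd; rewrite ?expr0 ?invr1// expr1 invrN1.
have f0 : p.+1`!%:R != 0 :> R by rewrite gt_eqF.
have -> : p.+1`!%:R * ((-1) ^+ p.+1 * (p.+1`!)%:R^-1 * wq^-1) *
  ((-1) ^+ p.+1 * C * 'C(x, i.+1)%:R * W`_0 ^+ (x - i.+1)) =
  ((-1) ^+ p.+1 * (-1) ^+ p.+1) * (p.+1`!%:R / p.+1`!%:R) * ('C(x, i.+1)%:R * W`_0 ^+ (x - i.+1) * C * wq^-1) by ring.
by rewrite s2 divff// !mul1r.
Qed.

Lemma MbarE (a : R) p n n0 t : 0 <= a -> (p <= D)%N ->
  Mbar (laplace P Y) mub a kappa p n n0 t =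
  (mub ^+ (p * (n - n0)))^-1 * (kappa ^+ zcard n t / kappa) *
  (((wpoly (a / mub ^+ n)) ^+ zcard n t)`_p / w p (a / mub ^+ n0)).
Proof.
move=> a0 pD; rewrite /Mbar GbarE//; congr (_ * _ * _).
by rewrite expfzDr// gt_eqF// (lt_trans ltr01).
Qed.


(** * Limits at the second fixed point *)

Variable P0 : probability tree R.
Hypothesis P0_GW : is_GW q 0 P0.

Let gf_le_kappa : (\sum_(0 <= n <oo) (q n * kappa ^+ n)%:E <= kappa%:E)%E.
Proof. by rewrite -/(gf kappa) gf_fix. Qed.

Let jfin_kappa A : jdom kappa A -> forall m, jfin D q (jetn D q m A).
Proof.
exact: (@jetn_jfin _ D _ _ q0 (ltW kappa1) gf_le_kappa
  (fun i => bin_series_fin (i := i))).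
Qed.

Let jdomZ A : jdom 1 A -> jdom kappa (kappa *: A).
Proof.
case=> A0 A1; split; first exact: (pge0Z (ltW kp)).
by rewrite coefZ ler_piMr// ltW.
Qed.

Lemma expectation_kappa_fin n A i : jdom 1 A -> (i <= D)%N ->
  ('E_P0[fun t => (kappa ^+ zcard n t * (A ^+ zcard n t)`_i)%R] =
   (kappa * (jetn D qb n A)`_i)%:E)%E.
Proof.
move=> dA iD; have := @coef_jetn _ D q 0 P0 q_off P0_GW n (kappa *: A) i.
rewrite addn0 jetn_tilt//; last by case: dA.
rewrite coefZ => <- //; first last.
- exact/jfin_kappa/jdomZ.
- by case: (jdomZ dA).
by congr ('E_P0[_])%E; apply/funext => t; rewrite exprZn coefZ.
Qed.

(** The Markov property in generation [n] for the law [q], with [kappa]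
    factored out of the jets, leaves the normalised moments of the tilted
    process. *)
Lemma expectation_at_kappa (a : R) p m n (L : set tree) : filt n L -> 0 <= a -> (p <= D)%N ->
  ('E_P0[fun t => (Hpoly p (zcard (m + n) t)%:R * kappa ^+ zcard (m + n) t *
                  expR (- (a * (zcard (m + n) t)%:R / mub ^+ (m + n))) * \1_L t)%R] =
   ((mub ^+ m) ^+ p)%:E * 'E_P0[fun t => (kappa ^+ zcard n t *
     (Vp (a / mub ^+ n) m ^+ zcard n t)`_p * \1_L t)%R])%E.
Proof.
move=> fL a0 pD; have b0 : 0 <= a / mub ^+ n by rewrite divr_ge0// ltW.
set d := damp (a / mub ^+ n) m.
have dE : d = expR (- (a / mub ^+ (m + n))).
  by rewrite /d /damp exprD invfM mulrA mulrAC.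
have dl : jdom 1 (d%:P + d *: 'X) by apply: jdom_lin; exact: (damp_in01 m b0).
have := @markov _ D q 0 P0 q_off P0_GW m n L (kappa *: (d%:P + d *: 'X)) p (leq0n _) fL.
rewrite jetn_tilt//; last by case: dl.
rewrite -/(Vraw (a / mub ^+ n) m) => H.
transitivity ('E_P0[fun t => (((kappa *: (d%:P + d *: 'X)) ^+ zcard (m + n) t)`_p * \1_L t)%R])%E.
  congr ('E_P0[_])%E; apply/funext => t; congr (_ * _).
  rewrite exprZn coefZ coef_binom HpolyE dE -expRM_natl mulrCA mulrA.
  by congr (_ * expR _); rewrite mulrN -mulr_natl; ring.
rewrite H//; first last.
- exact/jfin_kappa/jdomZ.
- by case: (jdomZ dl).
have V0 := jdom_Vp m b0.
rewrite -(@expectation_zcardZL _ P0 n L ((mub ^+ m) ^+ p)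
  (fun z => kappa ^+ z * (Vp (a / mub ^+ n) m ^+ z)`_p)).
- congr ('E_P0[_])%E; apply/funext => t; congr (_ * _); rewrite exprZn coefZ mulrCA; congr (_ * _).
  apply: (@coefX_scale _ _ _ (mub ^+ m) D) => // j jD.
  exact: (Vraw_Vp).
- exact: filt_measurable fL.
- by rewrite !exprn_ge0// ltW.
- by move=> z; apply: mulr_ge0; [exact/exprn_ge0/ltW|case: V0 => V0 _; exact: (pge0X z V0)].
Qed.

(** After division by [(mub ^+ m) ^+ p], numerator and denominator converge by
    dominated convergence. Both limits are homogeneous of degree [p] in the
    moments, so that the constant of [Vp_cvg] cancels. *)
Lemma ratio_limit_at_kappa (a : R) p n (L : set tree) : filt n L -> 0 <= a -> (p <= D)%N ->
  ((1 <= p)%N -> ~ {ae P, forall t, Y t = 0}) ->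
  let X m t := Hpoly p (zcard (m + n) t)%:R * kappa ^+ zcard (m + n) t *
    expR (- (a * (zcard (m + n) t)%:R / mub ^+ (m + n))) in
  ('E_P0[fun t => (X m t * \1_L t)%R] / 'E_P0[X m])%E @[m --> \oo] -->
  ('E_P0[fun t => (Mbar (laplace P Y) mub a kappa p n 0 t * \1_L t)%R])%E.
Proof.
move=> fL a0 pD nY X; have mL := filt_measurable fL.
have b0 : 0 <= a / mub ^+ n by rewrite divr_ge0// ltW.
have [c c0 Hc] := Vp_cvg pD a0 nY.
have [B dB HB] := Vp_dom.
pose W := wpoly (a / mub ^+ n).
have W0 : pge0 W by exact: pge0_wpoly.
have wp : 0 < w p a.
  apply: (w_gt0) => //.
  by case: (p) nY => [_|p' H]; [left|right; exact: H].
have V0 m := jdom_Vp m b0.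
pose g m z : R := kappa ^+ z * (Vp (a / mub ^+ n) m ^+ z)`_p.
pose g' z : R := kappa ^+ z * (c ^+ p * (W ^+ z)`_p).
pose h z : R := kappa ^+ z * (B ^+ z)`_p.
have kX z : 0 <= kappa ^+ z by exact/exprn_ge0/ltW.
have gh m z : 0 <= g m z <= h z.
  apply/andP; split; first by apply: mulr_ge0 => //; case: (V0 m) => V _; exact: (pge0X z V).
  by apply: ler_wpM2l => //; apply: (pleX z); [case: (V0 m)|exact: HB].
have hfin : ('E_P0[fun t => h (zcard n t)] < +oo)%E by rewrite expectation_kappa_fin ?ltry.
have gg' z : g m z @[m --> \oo] --> g' z.
  apply: cvgMr; rewrite -(@coefX_scale _ W (\poly_(j < p.+1) (c ^+ j * W`_j)) c p z p)//; last first.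
    by move=> j jp; rewrite coef_poly ltnS jp.
  apply: (@cvg_coefX _ (fun m => Vp (a / mub ^+ n) m) _ p) => // j jp.
  by rewrite coef_poly ltnS jp coef_wpoly; [exact: Hc|exact: leq_trans pD].
have num := cvg_expectation_zcard mL gg' gh hfin.
pose F t : R := kappa ^+ zcard n t * (W ^+ zcard n t)`_p.
have F0 t : 0 <= F t by apply: mulr_ge0 => //; exact: (pge0X _ W0).
have numE : ('E_P0[fun t => (g' (zcard n t) * \1_L t)%R] =
    (c ^+ p)%:E * 'E_P0[fun t => (F t * \1_L t)%R])%E.
  rewrite -(@expectation_zcardZL _ P0 n L (c ^+ p) (fun z => kappa ^+ z * (W ^+ z)`_p))//.
  - by congr ('E_P0[_])%E; apply/funext => t; rewrite /g' mulrCA.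
  - by rewrite exprn_ge0// ltW.
  - by move=> z; apply: mulr_ge0 => //; exact: (pge0X z W0).
have mF : measurable_fun [set: tree] F.
  exact: (measurable_zcard_fun n (fun z => kappa ^+ z * (W ^+ z)`_p)).
have [x xE] : exists x, ('E_P0[fun t => (F t * \1_L t)%R] = x%:E)%E.
  exists (fine ('E_P0[fun t => (F t * \1_L t)%R])%E); rewrite fineK// ge0_fin_numE; last first.
    by apply: expectation_ge0 => t; rewrite mulr_ge0// indicE ler0n.
  apply: (@le_lt_trans _ _ ('E_P0[F])%E).
    apply: expectation_le => //.
    - by apply: measurable_funM => //; exact: measurable_indic.
    - by move=> t; rewrite mulr_ge0// indicE ler0n.
    - by apply: aeW => t; rewrite ler_piMr// indicE lern1 leq_b1.
  have dW := jdom_wpoly b0.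
  by rewrite /F (expectation_kappa_fin n dW pD) ltry.
have MF : (fun t => Mbar (laplace P Y) mub a kappa p n 0 t * \1_L t) =
    (fun t => ((mub ^+ (p * n))^-1 / kappa / w p a) * F t * \1_L t).
  apply/funext => t; congr (_ * _).
  rewrite (MbarE)// -/W subn0 expr0 divr1.
  by rewrite /F; ring.
rewrite MF (@expectation_zcardZL _ P0 n L ((mub ^+ (p * n))^-1 / kappa / w p a)
  (fun z => kappa ^+ z * (W ^+ z)`_p))//; first last.
- by move=> z; apply: mulr_ge0 => //; exact: (pge0X z W0).
- by apply: mulr_ge0; [apply: mulr_ge0; rewrite invr_ge0 ?exprn_ge0 ?(ltW mub0) ?(ltW kp)|rewrite invr_ge0; exact: ltW].
rewrite xE -EFinM.
have -> : (mub ^+ (p * n))^-1 / kappa / w p a * x = (c ^+ p * x) / (kappa * (mub ^+ n) ^+ p * (c ^+ p * w p a)).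
  rewrite -exprM mulnC; have := mubX (p * n)%N; generalize (mub ^+ (p * n)) => y y0.
  by field; rewrite !gt_eqF ?exprn_gt0.
have XE m : ('E_P0[X m] = ((mub ^+ m) ^+ p)%:E * (kappa * (mub ^+ n) ^+ p * (Vp a (m + n))`_p)%:E)%E.
  have /= := @expectation_at_kappa a p (m + n) 0 [set: tree] (@filtT 0%N) a0 pD.
  rewrite -expectationT addn0 expr0 divr1 -expectationT => ->.
  rewrite (@expectation_kappa_fin 0 (Vp a (m + n)) p)//=; last first.
    exact: (jdom_Vp (m + n) a0).
  by rewrite -!EFinM exprD exprMn; congr EFin; ring.
have XL m : ('E_P0[fun t => (X m t * \1_L t)%R] =
    ((mub ^+ m) ^+ p)%:E * 'E_P0[fun t => (g m (zcard n t) * \1_L t)%R])%E.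
  exact: expectation_at_kappa.
have -> : (fun m => 'E_P0[fun t => (X m t * \1_L t)%R] / 'E_P0[X m])%E =
    (fun m => (((mub ^+ m) ^+ p)%:E * 'E_P0[fun t => (g m (zcard n t) * \1_L t)%R]) /
      (((mub ^+ m) ^+ p)%:E * (kappa * (mub ^+ n) ^+ p * (Vp a (m + n))`_p)%:E))%E.
  by apply/funext => m; rewrite XE XL.
apply: (@cvge_ratio R (fun m => (mub ^+ m) ^+ p)).
- by apply: nearW => m; rewrite !expf_neq0// gt_eqF.
- by move: num; rewrite numE xE.
- apply: cvg_EFin; first exact: nearW.
  apply: cvgMr; have := Hc 0%N p (leqnn p); rewrite expr0 divr1.
  by rewrite -(cvg_shiftn n).
- rewrite gt_eqF//; apply: mulr_gt0; apply: mulr_gt0 => //; exact: exprn_gt0.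
Qed.

End subcritical.

(** * A sequence of independent discrete variables on the unit interval *)

Section unit_interval.
Variable R : realType.

Local Notation leb := (@lebesgue_measure R).
Local Notation U01 := (uniform_prob (@ltr01 R)).
Local Notation Om := (measurableTypeR R).
Implicit Types (B : set Om).

Definition I01 : set Om := `[0, 1[%classic.

Lemma measurable_I01 : measurable I01. Proof. exact: measurable_itv. Qed.

Lemma uniform01E B : measurable B -> U01 B = leb (B `&` I01).
Proof.
move=> mB; rewrite /uniform_prob integral_uniform_pdf.
transitivity (leb (B `&` `[0, 1]%classic)).
  rewrite (eq_integral (fun=> 1%E)); last first.
    by move=> x; rewrite inE => -[_ /=]; rewrite in_itv /= /uniform_pdf => ->; rewrite subr0 invr1.
  rewrite integral_cst ?mul1e//.
  by apply: measurableI => //; exact: measurable_itv.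
have m1 : measurable (B `&` `[0, 1]%classic : set Om) by apply: measurableI => //; exact: measurable_itv.
have m2 : measurable (B `&` I01) by apply: measurableI => //; exact: measurable_I01.
apply/eqP; rewrite eq_le; apply/andP; split; last first.
  apply: le_measure; rewrite ?inE//.
  by apply: setIS => x; rewrite /I01 /= !in_itv /= => /andP[-> /ltW].
apply: (@le_trans _ _ (leb ((B `&` I01) `|` [set 1]))).
  apply: le_measure; rewrite ?inE//; first by apply: measurableU => //; exact: measurable_set1.
  move=> x [Bx]; rewrite /= in_itv /= => /andP[x0]; rewrite le_eqVlt => /orP[/eqP ->|x1]; first by right.
  by left; split=> //; rewrite /I01 /= in_itv /= x0.
apply: (le_trans (measureU2 leb m2 (measurable_set1 (1 : R)))).
by rewrite [X in (_ + X)%E](_ : _ = 0%E) ?adde0//; exact: lebesgue_measure_set1.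
Qed.

Definition affine (s r : R) (u : Om) : Om := (u - s) / r.

Lemma measurable_affine s r : measurable_fun [set: Om] (affine s r).
Proof. by apply: measurable_funM => //; exact: measurable_funB. Qed.

Lemma lebesgue_affine (s r : R) B : 0 < r -> measurable B ->
  leb (affine s r @^-1` B) = (r%:E * leb B)%E.
Proof.
move=> r0 mB.
pose F : {mfun Om >-> Om} := @mfun_Sub _ _ Om Om (affine s r) (mem_set (@measurable_affine s r)).
have ri0 : 0 <= r^-1 by rewrite invr_ge0 ltW.
pose mk := mscale (NngNum ri0) (pushforward leb F) : {measure set Om -> \bar R}.
pose mu := mk (@measurable_affine s r).
have muE A : mu A = ((r^-1)%:E * leb (affine s r @^-1` A))%E by [].
have -> : leb B = mu B.
  apply: lebesgue_measure_unique => // _ [[a b]] _ <-.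
  rewrite [RHS]muE.
  have -> : affine s r @^-1` `]a, b]%classic = `](r * a + s), (r * b + s)]%classic.
    apply/seteqP; split => x; rewrite /= !in_itv /= /affine ltr_pdivlMr// ler_pdivrMr//;
      by rewrite ltrBrDr lerBlDr [a * r]mulrC [b * r]mulrC.
  rewrite !lebesgue_measure_itv /= !lte_fin ltrD2r ltr_pM2l//.
  case: ifP => // _; last by rewrite mule0.
  by rewrite -!EFinD -EFinM; congr EFin; field; rewrite gt_eqF.
by rewrite muE muleA -EFinM divff ?gt_eqF// mul1e.
Qed.

Section split.
Variable pi : nat -> R.
Hypotheses (pi0 : forall k, 0 <= pi k) (pi1 : (\sum_(0 <= k <oo) (pi k)%:E = 1)%E).

Let cum k := \sum_(j < k) pi j.

Let cumS k : cum k.+1 = cum k + pi k. Proof. by rewrite /cum big_ord_recr. Qed.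

Let cum_le k l : (k <= l)%N -> cum k <= cum l.
Proof.
by move=> /subnK <-; elim: (l - k)%N => [//|d IH]; rewrite addSn cumS (le_trans IH)// lerDl.
Qed.

Let slot k : set Om := `[cum k, cum k.+1[%classic.

Let slot_disj k l u : slot k u -> slot l u -> k = l.
Proof.
rewrite /slot /= !in_itv /= => /andP[k1 k2] /andP[l1 l2].
apply/eqP; rewrite eqn_leq; apply/andP; split; rewrite leqNgt; apply/negP => /cum_le H.
  by have := lt_le_trans l2 H; rewrite ltNge k1.
by have := lt_le_trans k2 H; rewrite ltNge l1.
Qed.

Let cum_lim : cum k @[k --> \oo] --> (1 : R).
Proof.
have : ((cum k)%:E @[k --> \oo] --> 1%E)%E.
  rewrite -pi1 (_ : (fun k => _) = (fun k => \sum_(0 <= j < k) (pi j)%:E)%E); last first.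
    by apply/funext => k; rewrite sumEFin /cum big_mkord.
  by apply: is_cvg_nneseries => n _ _; rewrite lee_fin.
by move=> /fine_cvgP[_].
Qed.

Let cum_le1 k : cum k <= 1.
Proof.
apply: (cvgr_to_ge cum_lim); exists k => // l /=; exact: cum_le.
Qed.

Let slot_cover u : I01 u -> exists k, slot k u.
Proof.
rewrite /I01 /= in_itv /= => /andP[u0 u1].
have [N HN] : exists N, u < cum N.
  have /cvgrPdist_lt/(_ (1 - u))[|N _ /(_ N (leqnn N))] := cum_lim; first by rewrite subr_gt0.
  by move=> /ltr_distlDr H; exists N; move: H => /=; lra.
elim: N HN => [|N IH] HN; first by move: HN; rewrite /cum big_ord0 ltNge u0.
case: (ltP u (cum N)) => uN; first exact: IH.
by exists N; rewrite /slot /= in_itv /= uN.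
Qed.

Let slot_sub k : slot k `<=` I01.
Proof.
move=> u; rewrite /slot /I01 /= !in_itv /= => /andP[u1 u2].
by rewrite (lt_le_trans u2 (cum_le1 _)) andbT (le_trans _ u1)// /cum sumr_ge0.
Qed.

(** The unit interval is cut into consecutive slots of lengths [pi k], and
    [draw] reads the number of the slot of a point. The points outside the
    unit interval get the value 0. *)
Definition draw (u : Om) : nat := xget 0%N [set k | slot k u].

(** The position inside the slot, rescaled to the unit interval. *)
Definition rest (u : Om) : Om := affine (cum (draw u)) (pi (draw u)) u.

Let drawE k u : slot k u -> draw u = k.
Proof. by move=> su; rewrite /draw; case: xgetP => [l _ /slot_disj|/(_ k)]; [apply|]. Qed.

Let measurable_slot k : measurable (slot k). Proof. exact: measurable_itv. Qed.

Lemma measurable_draw k : measurable [set u | draw u = k].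
Proof.
have -> : [set u | draw u = k] = slot k `|` (if k == 0%N then ~` \bigcup_l slot l else set0).
  apply/seteqP; split => u /=.
    case: (pselect (exists l, slot l u)) => [[l sl] <-|nl].
      by left; rewrite (drawE sl).
    move=> <-; right; rewrite /draw; case: xgetP => [l _ sl|_]; first by case: nl; exists l.
    by rewrite eqxx => -[l _ sl]; apply: nl; exists l.
  move=> [/drawE//|]; case: eqP => // -> nl; rewrite /draw; case: xgetP => // l _ sl.
  by case: nl; exists l.
apply: measurableU => //; case: eqP => // _; apply: measurableC.
exact: bigcup_measurable.
Qed.

Lemma draw_restI k B : [set u | draw u = k] `&` rest @^-1` B =
  [set u | draw u = k] `&` affine (cum k) (pi k) @^-1` B.
Proof. by apply/seteqP; split => u [/= <-]. Qed.

Lemma measurable_rest : measurable_fun [set: Om] rest.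
Proof.
move=> _ B mB; rewrite setTI.
have -> : rest @^-1` B = \bigcup_k ([set u | draw u = k] `&` affine (cum k) (pi k) @^-1` B).
  apply/seteqP; split => u; first by move=> uB; exists (draw u).
  by move=> [k _ [/= <-]].
apply: bigcup_measurable => k _; apply: measurableI; first exact: measurable_draw.
by rewrite -[X in measurable X]setTI; exact: measurable_affine.
Qed.

(** On its slot the map [rest] is affine of slope [1 / pi k]: under the
    uniform law, the position in the slot is again uniform and independent of
    the number of the slot. Countably many independent variables can thus be
    read from one point. *)
Lemma draw_rest_law k B : measurable B ->
  U01 ([set u | draw u = k] `&` rest @^-1` B) = ((pi k)%:E * U01 B)%E.
Proof.
move=> mB; have mr : measurable (rest @^-1` B).
  by rewrite -[X in measurable X]setTI; exact: measurable_rest.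
rewrite !uniform01E//; last by apply: measurableI => //; exact: measurable_draw.
have -> : ([set u | draw u = k] `&` rest @^-1` B) `&` I01 = slot k `&` affine (cum k) (pi k) @^-1` B.
  rewrite draw_restI; apply/seteqP; split => u.
    by move=> [[/= uk uB] uI]; split=> //; have [l sl] := slot_cover uI; rewrite -uk (drawE sl).
  by move=> [sk uB]; split; [split=> //=; exact: drawE|exact: slot_sub sk].
have [pk|pk] := leP (pi k) 0.
  have -> : pi k = 0 by apply/eqP; rewrite eq_le pk pi0.
  rewrite mul0e (_ : slot k = set0) ?set0I ?measure0//.
  apply/seteqP; split => u //; rewrite /slot /= in_itv /= cumS => /andP[u1 u2].
  by have := lt_le_trans u2 (_ : cum k + pi k <= cum k); rewrite gerDl pk ltNge u1 => /(_ isT).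
have -> : slot k = affine (cum k) (pi k) @^-1` I01.
  apply/seteqP; split => u; rewrite /slot /I01 /= !in_itv /= /affine;
  by rewrite ler_pdivlMr// ltr_pdivrMr// mul0r mul1r subr_ge0 ltrBlDr cumS [pi k + _]addrC.
have mI : measurable (I01 `&` B) by apply: measurableI => //; exact: measurable_I01.
by rewrite -preimage_setI (lebesgue_affine _ pk mI) setIC.
Qed.

End split.

(** Each variable is read from what the previous one left. *)
Section sequence.
Variable pi : nat -> nat -> R.
Hypotheses (pi0 : forall i k, 0 <= pi i k).
Hypotheses (pi1 : forall i, (\sum_(0 <= k <oo) (pi i k)%:E = 1)%E).

Fixpoint remain i (u : Om) : Om := if i is j.+1 then rest (pi j) (remain j u) else u.

Definition draws i (u : Om) : nat := draw (pi i) (remain i u).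

Lemma measurable_remain i : measurable_fun [set: Om] (remain i).
Proof.
elim: i => [|i IH] /=; first exact: measurable_id.
exact: (measurableT_comp (measurable_rest (pi0 i)) IH).
Qed.

Lemma measurable_draws i k : measurable [set u | draws i u = k].
Proof.
rewrite -[X in measurable X]setTI.
have mk : measurable [set u | draw (pi i) u = k] by apply: measurable_draw.
exact: (measurable_remain i measurableT mk).
Qed.

Let law i (c : option nat) : R := if c is Some k then pi i k else 1.

Let event (c : nat -> option nat) N : set Om :=
  [set u | forall i k, (i < N)%N -> c i = Some k -> draws i u = k].

Let measurable_event c N : measurable (event c N).
Proof.
have -> : event c N = \bigcap_i (if (i < N)%N then if c i is Some k then [set u | draws i u = k] else setT else setT).
  apply/seteqP; split => u.
    by move=> H i _; case: ifP => // iN; case E: (c i) => [k|//]; exact: H.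
  by move=> H i k iN ci; have := H i I; rewrite iN ci.
apply: bigcapT_measurable => i; case: ifP => // _; case: (c i) => // k; exact: measurable_draws.
Qed.

(** Values prescribed by [c] at some of the indices below [N]; at the other
    ones, where [c] is [None], the sum of the weights is [1]. *)
Lemma draws_law c N B : measurable B ->
  U01 (event c N `&` remain N @^-1` B) = ((\prod_(i < N) law i (c i))%:E * U01 B)%E.
Proof.
elim: N B => [|N IH] B mB.
  rewrite big_ord0 mul1e; congr (U01 _).
  by apply/seteqP; split => u; [case|move=> uB; split].
pose C : set Om := if c N is Some k then [set u | draw (pi N) u = k] else setT.
have -> : event c N.+1 `&` remain N.+1 @^-1` B =
    event c N `&` remain N @^-1` (C `&` rest (pi N) @^-1` B).
  apply/seteqP; split => u /=.
    move=> [H uB]; split; first by move=> i k iN; apply: H; exact: ltnW.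
    by split=> //; rewrite /C; case E: (c N) => [k|//]; exact: (H N k (ltnSn N) E).
  move=> [H [uC uB]]; split=> // i k; rewrite ltnS leq_eqVlt => /orP[/eqP ->|iN]; last exact: H.
  by move=> E; move: uC; rewrite /C E.
have mr : measurable (rest (pi N) @^-1` B).
  by rewrite -[X in measurable X]setTI; exact: (measurable_rest (pi0 N)).
rewrite IH; last first.
  by apply: measurableI => //; rewrite /C; case: (c N) => // k; exact: measurable_draw.
rewrite big_ord_recr /= EFinM -muleA; congr (_ * _)%E; rewrite /C /law; case: (c N) => [k|].
  exact: draw_rest_law.
rewrite mul1e -(_ : \bigcup_k ([set u | draw (pi N) u = k] `&` rest (pi N) @^-1` B) = setT `&` rest (pi N) @^-1` B); last first.
  by rewrite -setI_bigcupl (_ : \bigcup_k _ = setT)// -subTset => u _; exists (draw (pi N) u).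
rewrite measure_semi_bigcup//=; last 3 first.
- by move=> k; apply: measurableI => //; exact: measurable_draw.
- by move=> i j _ _ [u [[/= <- _] [/= <- _]]].
- by apply: bigcup_measurable => k _; apply: measurableI => //; exact: measurable_draw.
under eq_eseriesr do rewrite draw_rest_law//.
have -> : U01 B = (fine (U01 B))%:E by rewrite fineK// fin_num_measure.
under eq_eseriesr do rewrite muleC.
by rewrite nneseriesZl ?pi1 ?mule1// => k _; rewrite lee_fin.
Qed.

Lemma draws_joint (s : seq (nat * nat)) : uniq (unzip1 s) ->
  U01 [set u | forall i k, (i, k) \in s -> draws i u = k] = (\prod_(ik <- s) pi ik.1 ik.2)%:E.
Proof.
move=> us; have [N lt_N] : exists N, forall i k, (i, k) \in s -> (i < N)%N.
  exists (\max_(ik <- s) ik.1).+1 => i k ik.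
  by rewrite ltnS (big_rem _ ik) /= leq_maxl.
pose c i := ohead [seq ik.2 | ik <- s & ik.1 == i].
have cE i k : (i, k) \in s -> c i = Some k.
  move=> iks; rewrite /c; suff -> : [seq ik <- s | ik.1 == i] = [:: (i, k)] by [].
  elim: s us iks {lt_N c} => [//|[j l] s IH] /= /andP[js us].
  rewrite inE => /orP[/eqP[-> ->]|iks].
    rewrite eqxx; congr cons; apply/eqP; rewrite -(negbK (_ == _)) -has_filter.
    apply/hasPn => -[j' l'] jl' /=; apply: contra js => /eqP <-.
    by apply/mapP; exists (j', l').
  case: eqP => [ji|_]; last exact: IH.
  by case/negP: js; apply/mapP; exists (i, k).
have cN i k : c i = Some k -> (i, k) \in s.
  rewrite /c; case E : [seq ik <- s | ik.1 == i] => [//|[j l] r] /= [<-].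
  have : (j, l) \in [seq ik <- s | ik.1 == i] by rewrite E mem_head.
  by rewrite mem_filter /= => /andP[/eqP -> ].
have := draws_law c N measurableT; rewrite preimage_setT setIT probability_setT mule1 => H.
rewrite (_ : [set u | _] = event c N); last first.
  apply/seteqP; split => u Hu i k; first by move=> _ /cN; exact: Hu.
  by move=> ik; apply: Hu; [exact: lt_N ik|exact: cE].
rewrite H; congr EFin.
rewrite -(big_mkord xpredT (fun i => law i (c i))) (bigID (mem (unzip1 s))) /=.
rewrite [X in _ * X]big1 ?mulr1; last first.
  move=> i; rewrite /law; case E: (c i) => [k|//] /negP[]; apply/mapP; exists (i, k) => //.
  exact: cN.
rewrite -big_filter (perm_big (unzip1 s)) /=; last first.
  apply: uniq_perm => //; first by rewrite filter_uniq// iota_uniq.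
  move=> i; rewrite mem_filter mem_index_iota leq0n /=; case: (boolP (i \in unzip1 s)) => //= /mapP[[j k] jk ->].
  exact: lt_N jk.
rewrite big_map; apply: eq_big_seq => -[i k] ik /=.
by rewrite /law (cE i k ik).
Qed.

End sequence.

End unit_interval.

(** * Typed trees built from one choice of children per node and type *)

Section sprout.
Variables (p n0 : nat) (F : seq nat -> 'I_p.+1 -> seq 'I_p.+1).
Implicit Types (u v : seq nat) (l : 'I_p.+1).

Definition child_type (c : seq 'I_p.+1) i : option 'I_p.+1 :=
  if (0 < i <= size c)%N then Some (nth ord0 c i.-1) else None.

(** The type of the word [ones n0 ++ rev r], if it is a node. Words are read
    backwards, so that the recursion follows the ancestors. *)
Fixpoint rtype (r : seq nat) : option 'I_p.+1 :=
  if r is i :: r' then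
    obind (fun l => child_type (F (ones n0 ++ rev r') l) i) (rtype r')
  else Some ord_max.

Definition stype u : option 'I_p.+1 :=
  if take n0 u == ones n0 then rtype (rev (drop n0 u)) else None.

Lemma stype_root : stype (ones n0) = Some ord_max.
Proof. by rewrite /stype take_oversize ?drop_oversize ?size_nseq// eqxx. Qed.

Lemma stype_rcons u i : (n0 <= size u)%N ->
  stype (rcons u i) = obind (fun l => child_type (F u l) i) (stype u).
Proof.
move=> nu; rewrite /stype -cats1 takel_cat// drop_cat.
case: eqP => // tu; move: nu; rewrite leq_eqVlt => /orP[/eqP nu|nu].
  have uE : u = ones n0 by rewrite -tu take_oversize// -nu.
  rewrite -nu ltnn subnn drop0 [drop n0 u]drop_oversize; last by rewrite -nu.
  by rewrite /= cats0 -uE.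
by rewrite nu cats1 rev_rcons /= revK -tu cat_take_drop.
Qed.

Lemma size_stype u : stype u -> (n0 <= size u)%N.
Proof.
rewrite /stype; case: eqP => // tu _.
by rewrite leqNgt; apply/negP => un; have := congr1 size tu; rewrite size_nseq take_oversize ?(ltnW un)// => E; rewrite E ltnn in un.
Qed.

Lemma stype_split u : stype u -> u = ones n0 \/
  exists v i, [/\ u = rcons v i, stype v & (n0 <= size v)%N].
Proof.
move=> su; have := size_stype su; rewrite leq_eqVlt => /orP[/eqP nu|nu].
  left; move: su; rewrite /stype; case: eqP => // <- _.
  by rewrite take_oversize ?nu.
case/lastP: u su nu => [//|v i] su; rewrite size_rcons ltnS => nv; right; exists v, i.
by split=> //; move: su; rewrite stype_rcons//; case: (stype v).
Qed.

Definition sprout_nodes : set (seq nat) := [set u | stype u].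

Lemma sprout_child u l i : stype u = Some l ->
  sprout_nodes (rcons u i) <-> (0 < i <= size (F u l))%N.
Proof.
move=> su; rewrite /sprout_nodes /= stype_rcons ?size_stype ?su//= /child_type.
by case: ifP.
Qed.

Lemma is_tree_sprout : is_tree (ones n0) sprout_nodes.
Proof.
have so : size (ones n0) = n0 by rewrite size_nseq.
split.
- move=> u; have [n] := ubnP (size u); elim: n u => // n IH u un.
  rewrite /sprout_nodes /= => su; case: (stype_split su) => [->|[v [i [uE sv nv]]]].
    by rewrite /is_word all_nseq orbT.
  rewrite uE /is_word all_rcons; apply/andP; split.
    case E : (stype v) sv => [l|//] _; move: su; rewrite uE => /(sprout_child _ E).
    by case/andP.
  by apply: IH => //; move: un; rewrite uE size_rcons ltnS.
- by rewrite /sprout_nodes /= stype_root.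
- by move=> u; rewrite so ltnNge => /negP nu /size_stype.
- move=> u su une; case: (stype_split su) => // -[v [i [-> sv _]]].
  by rewrite parent_rcons.
- move=> u; rewrite /sprout_nodes /=; case E : (stype u) => [l|//] _.
  exists (size (F u l)) => i i0; have := sprout_child i E; rewrite i0 /=.
  by [].
Qed.

Definition sprout : typed_tree p :=
  TypedTree (Tree (ex_intro (fun u => is_tree u _) _ is_tree_sprout)) (fun u => odflt ord0 (stype u)).

Lemma sprout_nchild u l : stype u = Some l -> nchild sprout_nodes u = size (F u l).
Proof.
move=> su; apply: nchild_uniq => i i0; have := sprout_child i su; rewrite i0 /=.
by [].
Qed.

Lemma sprout_child_types u l : stype u = Some l ->
  child_types sprout u = [seq (val k : nat) | k <- F u l].
Proof.
move=> su; rewrite /child_types /= (sprout_nchild su); apply: (@eq_from_nth _ 0%N).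
  by rewrite !size_map size_iota.
move=> i; rewrite size_map size_iota => iF.
rewrite (nth_map 0%N) ?size_iota// nth_iota// (nth_map ord0)//.
have nu : (n0 <= size u)%N by rewrite size_stype ?su.
rewrite stype_rcons ?su//= /child_type /= add1n iF //=.
Qed.

(** A cylinder only depends on the children chosen by the nodes below its
    height, at their actual types: this turns it into finitely many conditions
    on independent variables. *)
Lemma tcyl_sprout h (x : typed_tree p) : (n0 < h)%N ->
  is_tree (ones n0) (nodes (skel x)) -> height_le h (nodes (skel x)) ->
  tcyl h x sprout <-> ttype x (ones n0) = ord_max /\
    forall u, restr h.-1 (nodes (skel x)) u -> [seq (val k : nat) | k <- F u (ttype x u)] = child_types x u.
Proof.
move=> nh tx hx; set A := nodes (skel x) in tx hx *.
have so : size (ones n0) = n0 by rewrite size_nseq.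
have h1 u : (size u <= h.-1)%N = (size u < h)%N by case: (h) nh.
rewrite /tcyl /= (restr_id hx); split.
  move=> [rh ht]; have root : A (ones n0) by case: tx.
  have typeE u : A u -> stype u = Some (ttype x u).
    move=> Au; have := ht u Au; have : restr h sprout_nodes u by rewrite rh.
    by move=> [+ _]; rewrite /sprout_nodes /=; case: (stype u) => //= l _ ->.
  split; first by have := typeE _ root; rewrite stype_root => -[].
  move=> u [Au]; rewrite h1 => uh.
  have := sprout_child_types (typeE u Au) => <-.
  rewrite /child_types; have -> : nchild (nodes (skel sprout)) u = nchild A u.
    by apply: (@nchild_restr h) => //; rewrite /= rh (restr_id hx).
  apply/eq_in_map => i; rewrite mem_iota add1n ltnS => /andP[i0 ik] /=.
  by rewrite (typeE (rcons u i))//; apply/(nchildP tx Au i0).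
move=> [rt H].
have E u : (size u <= h)%N -> (sprout_nodes u <-> A u) /\ (A u -> stype u = Some (ttype x u)).
  have [n] := ubnP (size u); elim: n u => // n IH u un uh.
  have [un0|n0u] := leqP (size u) n0.
    case: (eqVneq u (ones n0)) => [->|une].
      split; last by move=> _; rewrite stype_root rt.
      by split=> _; [case: tx|rewrite /sprout_nodes /= stype_root].
    suff [S1 S2] : ~ sprout_nodes u /\ ~ A u by split.
    move: un0; rewrite leq_eqVlt => /orP[/eqP un0|un0]; split.
    - by move=> /(size_root_eq is_tree_sprout); rewrite so un0 => /(_ erefl) /eqP; rewrite (negbTE une).
    - by move=> /(size_root_eq tx); rewrite so un0 => /(_ erefl) /eqP; rewrite (negbTE une).
    - by case: is_tree_sprout => _ _ /(_ u); rewrite so => /(_ un0).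
    - by case: tx => _ _ /(_ u); rewrite so => /(_ un0).
  case/lastP: u un uh n0u => [//|v i]; rewrite size_rcons !ltnS => vn vh n0v.
  have [Ev Et] := IH v vn (ltnW vh).
  have vparent (B : set (seq nat)) : is_tree (ones n0) B -> B (rcons v i) -> B v /\ (0 < i)%N.
    move=> tB Bvi; split; last exact: (is_tree_pos tB Bvi).
    case: (tB) => _ _ _ /(_ _ Bvi) + _; rewrite parent_rcons; apply.
    by move=> /(congr1 size); rewrite size_rcons so => E; move: n0v; rewrite -E ltnn.
  have step : A v -> (0 < i)%N -> (sprout_nodes (rcons v i) <-> A (rcons v i)) /\
      (A (rcons v i) -> stype (rcons v i) = Some (ttype x (rcons v i))).
    move=> Av i0; have sv := Et Av.
    have Hv : restr h.-1 A v by split=> //; rewrite h1.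
    have cv := H v Hv.
    have sz : size (F v (ttype x v)) = nchild A v.
      by have := congr1 size cv; rewrite !size_map size_iota.
    split.
      by rewrite (sprout_child i sv) i0 sz /=; split=> /(nchildP tx Av i0).
    move=> /(nchildP tx Av i0) ik; rewrite stype_rcons// sv /= /child_type i0 sz ik /=.
    congr Some; apply: val_inj; rewrite -(nth_map ord0 0%N val) ?sz ?prednK//.
    by rewrite cv /child_types (nth_map 0%N) ?size_iota ?prednK// nth_iota ?prednK// add1n prednK.
  split; last by move=> Avi; have [Av i0] := vparent A tx Avi; exact: (step Av i0).2.
  split=> [Bvi|Avi].
    have [Bv i0] := vparent _ is_tree_sprout Bvi.
    exact: (step (Ev.1 Bv) i0).1.1.
  have [Av i0] := vparent A tx Avi.
  exact: (step Av i0).1.2.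
split.
  apply/seteqP; split => u.
    by move=> [/= su uh]; exact: (E u uh).1.1.
  by move=> Au; split; [exact: ((E u (hx u Au)).1.2 Au)|exact: hx].
by move=> u Au; rewrite ((E u (hx u Au)).2 Au).
Qed.

End sprout.

(** * Random typed trees *)

Section random_sprout.
Variables (R : realType) (p n0 : nat) (wt : nat -> nat -> seq nat -> R).
Hypothesis wt0 : forall n l c, 0 <= wt n l c.
Hypothesis wt1 : forall n (l : 'I_p.+1),
  (\esum_(c in [set: seq 'I_p.+1]) (wt n l (map val c))%:E = 1)%E.

Local Notation Om := (measurableTypeR R).
Local Notation U01 := (uniform_prob (@ltr01 R)).
Local Notation C := (seq 'I_p.+1).

(** Lists over a nonempty finite type are in bijection with the natural
    numbers, the values taken by the variables at hand. *)
Lemma code_types : exists2 e : nat -> C, set_bij [set: nat] [set: C] e &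
  exists e' : C -> nat, cancel e' e /\ cancel e e'.
Proof.
have : ([set: C] #= [set: nat])%card.
  apply: eq_card_nat; first exact: countableP.
  move=> /(finite_image size) fin; apply: infinite_nat; apply: sub_finite_set fin.
  by move=> n _; exists (nseq n ord0) => //; rewrite size_nseq.
move=> /pcard_eqP/bijPex[e' [_ inj surj]].
have e'inj : injective e' by move=> x y; apply: inj; rewrite inE.
have ex n : exists c, e' c = n by have [c _ <-] := surj n I; exists c.
pose e n := sval (cid (ex n)).
have eK n : e' (e n) = n := svalP (cid (ex n)).
have e'K c : e (e' c) = c by apply: e'inj; rewrite eK.
exists e; last by exists e'.
split=> //; first by move=> x y _ _ xy; rewrite -(eK x) xy eK.
by move=> c _; exists (e' c).
Qed.

Let e := sval (cid2 code_types).
Let e_bij : set_bij [set: nat] [set: C] e := s2valP (cid2 code_types).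
Let e' : C -> nat := sval (cid (s2valP' (cid2 code_types))).
Let e'K : cancel e' e. Proof. exact: (svalP (cid (s2valP' (cid2 code_types)))).1. Qed.
Let eK : cancel e e'. Proof. exact: (svalP (cid (s2valP' (cid2 code_types)))).2. Qed.

(* Each word makes one choice of children for each type that it may get, and
   these choices are independent. *)
Let idx (u : seq nat) (l : 'I_p.+1) : nat := choice.pickle (u, l).

Let pi i k : R :=
  if choice.unpickle i is Some (u, l) then wt (@size nat u) (l : 'I_p.+1) (map val (e k)) else (k == 0%N)%:R.

Let pi0 i k : 0 <= pi i k.
Proof. by rewrite /pi; case: (choice.unpickle i) => [[u l]|]; rewrite ?ler0n. Qed.

Let pi1 i : (\sum_(0 <= k <oo) (pi i k)%:E = 1)%E.
Proof.
rewrite /pi; case: (choice.unpickle i) => [[u l]|].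
  rewrite nneseries_esum; last by move=> k _; rewrite lee_fin.
  rewrite (_ : [set x | _] = [set: nat]); last by apply/seteqP; split.
  by rewrite -[RHS](wt1 (size u) l) (@reindex_esum R _ _ setT setT e (fun c => (wt (size u) l (map val c))%:E) e_bij).
rewrite (nneseries_split _ 1)//=.
by rewrite big_nat1 eseries0 ?adde0// => -[].
Qed.

Definition kids (om : Om) (u : seq nat) (l : 'I_p.+1) : C := e (draws pi (idx u l) om).

Lemma measurable_kids u l (S : set C) : measurable [set om | S (kids om u l)].
Proof.
have -> : [set om | S (kids om u l)] = \bigcup_(k in [set k | S (e k)]) [set om | draws pi (idx u l) om = k].
  apply/seteqP; split => om; first by move=> Sk; exists (draws pi (idx u l) om).
  by move=> [k Sk /= H]; rewrite /kids H.
apply: bigcup_measurable => k _; apply: measurable_draws => //.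
Qed.

Lemma kids_joint (D : set (seq nat)) (ty : seq nat -> 'I_p.+1) (c : seq nat -> C) : finite_set D ->
  U01 [set om | forall u, D u -> kids om u (ty u) = c u] =
  (\big[*%R/1]_(u \in D) wt (size u) (ty u) (map val (c u)))%:E.
Proof.
move=> fD; pose s := [seq (idx u (ty u), e' (c u)) | u <- fset_set D].
have us : uniq (unzip1 s).
  rewrite /unzip1 -map_comp map_inj_in_uniq ?fset_uniq// => u v _ _ /=.
  by move=> /(pcan_inj choice.pickleK)[].
have := draws_joint pi0 pi1 us; rewrite big_map => H.
rewrite (fsbig_finite _ _ fD) /= (_ : [set om | _] = [set om | forall i k, (i, k) \in s -> draws pi i om = k]).
  rewrite H; congr EFin; apply: eq_bigr => u _; rewrite /pi /= /idx choice.pickleK.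
  by rewrite e'K.
apply/seteqP; split => om Hom.
  move=> i k /mapP[u]; rewrite in_fset_set// inE => Du [-> ->].
  by have := Hom u Du; rewrite /kids => <-; rewrite eK.
move=> u Du; rewrite /kids (Hom _ (e' (c u))) ?e'K//.
by apply/mapP; exists u => //; rewrite in_fset_set// inE.
Qed.

Let measurable_prop (Q : Prop) : measurable ([set _ | Q] : set Om).
Proof.
case: (pselect Q) => H.
  by rewrite (_ : [set _ | _] = setT)//; apply/seteqP; split.
by rewrite (_ : [set _ | _] = set0)//; apply/seteqP; split.
Qed.

Lemma measurable_rtype r o : measurable [set om | rtype n0 (kids om) r = o].
Proof.
elim: r o => [|i r IH] o /=.
  exact: measurable_prop.
rewrite (_ : [set om | _] = \big[setU/set0]_(l : 'I_p.+1)
    ([set om | rtype n0 (kids om) r = Some l] `&` [set om | [set c | child_type c i = o] (kids om (ones n0 ++ rev r) l)])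
    `|` (if o is None then [set om | rtype n0 (kids om) r = None] else set0)).
  apply: measurableU; last by case: (o) => //; exact: IH.
  apply: bigsetU_measurable => l _; apply: measurableI; first exact: IH.
  exact: measurable_kids.
apply/seteqP; split => om /=.
  case E: (rtype n0 (kids om) r) => [l|] /=; last by move=> <-; right.
  by move=> H; left; rewrite -bigcup_seq; exists l => //=; rewrite mem_index_enum.
case; first by rewrite -bigcup_seq => -[l _ /= [-> ]].
by case: o => // ->.
Qed.

Lemma measurable_stype u o : measurable [set om | stype n0 (kids om) u = o].
Proof.
rewrite /stype; case: eqP => _; first exact: measurable_rtype.
exact: measurable_prop.
Qed.

Let measurable_all (S : seq nat -> set (option 'I_p.+1)) :
  measurable [set om | forall u, S u (stype n0 (kids om) u)].
Proof.
have mS u : measurable [set om | S u (stype n0 (kids om) u)].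
  have -> : [set om | S u (stype n0 (kids om) u)] =
      \big[setU/set0]_(o : option 'I_p.+1) (if `[< S u o >] then [set om | stype n0 (kids om) u = o] else set0).
    apply/seteqP; split => om /=.
      by move=> H; rewrite -bigcup_seq; exists (stype n0 (kids om) u); rewrite /= ?mem_index_enum//; case: asboolP.
    rewrite -bigcup_seq => -[y _].
    have [Sy|//] := asboolP (S u y).
    by move=> /= H; rewrite H.
  apply: bigsetU_measurable => o _; case: ifP => // _; exact: measurable_stype.
pose G i : set Om :=
  if choice.unpickle i is Some u then [set om | S u (stype n0 (kids om) u)] else setT.
have -> : [set om | forall u, S u (stype n0 (kids om) u)] = \bigcap_i G i.
  apply/seteqP; split => om H; first by move=> i _; rewrite /G; case: (choice.unpickle i) => // u; exact: H.
  by move=> u; have := H (choice.pickle u) I; rewrite /G choice.pickleK.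
by apply: bigcapT_measurable => i; rewrite /G; case: (choice.unpickle i) => [u|] //; exact: mS.
Qed.

Lemma measurable_sprout : measurable_fun [set: Om] (fun om => sprout n0 (kids om)).
Proof.
apply: (@measurability _ _ _ _ _ _ (@tcyls p)) => //.
move=> _ [_ [h _ [x _ <-]] <-]; rewrite setTI.
pose S u : set (option 'I_p.+1) := [set o |
   ((isSome o /\ (size u <= h)%N) <-> restr h (nodes (skel x)) u) /\
   (restr h (nodes (skel x)) u -> odflt ord0 o = ttype x u)].
rewrite (_ : _ @^-1` _ = [set om | forall u, S u (stype n0 (kids om) u)]).
  exact: (measurable_all S).
apply/seteqP; split => om; rewrite /preimage /tcyl /=.
  by move=> [E H] u /=; split=> [|xu]; [rewrite -E|exact: H].
move=> H; split; last by move=> u; case: (H u).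
by apply/seteqP; split => u; case: (H u) => /= H1 _; [move/H1|move/H1].
Qed.

Lemma measurable_skel_sprout : measurable_fun [set: Om] (fun om => skel (sprout n0 (kids om))).
Proof.
apply: (@measurability _ _ _ _ _ _ cyls) => //.
move=> _ [_ [h _ [A _ <-]] <-]; rewrite setTI.
pose S u : set (option 'I_p.+1) := [set o | (isSome o /\ (size u <= h)%N) <-> A u].
rewrite (_ : _ @^-1` _ = [set om | forall u, S u (stype n0 (kids om) u)]).
  exact: (measurable_all S).
apply/seteqP; split => om; rewrite /preimage /cyl /=.
  by move=> E u; rewrite /S /= -E.
by move=> H; apply/seteqP; split => u; case: (H u) => /=.
Qed.

Definition typed_law : probability (typed_tree p) R :=
  distribution U01 (@mfun_Sub _ _ Om (typed_tree p) _ (mem_set measurable_sprout)).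

Definition skel_law : probability tree R :=
  distribution U01 (@mfun_Sub _ _ Om tree _ (mem_set measurable_skel_sprout)).

Lemma skel_lawE A : skel_law A = typed_law (@skel p @^-1` A).
Proof. by []. Qed.

Lemma typed_lawE h (x : typed_tree p) : (n0 < h)%N ->
  is_tree (ones n0) (nodes (skel x)) -> height_le h (nodes (skel x)) ->
  typed_law (tcyl h x) = (((ttype x (ones n0) : nat) == p)%:R *
    \big[*%R/1]_(u \in restr h.-1 (nodes (skel x))) wt (size u) (ttype x u) (child_types x u))%:E.
Proof.
move=> nh tx hx.
have -> : typed_law (tcyl h x) = U01 [set om | tcyl h x (sprout n0 (kids om))] by [].
have opE : ((ttype x (ones n0) : nat) == p) = (ttype x (ones n0) == ord_max) by rewrite -val_eqE.
rewrite opE; case: eqP => [rt|rt]; last first.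
  rewrite mul0r (_ : [set om | _] = set0) ?measure0//.
  by apply/seteqP; split => om //= /(tcyl_sprout _ nh tx hx)[].
pose c u : C := [seq ttype x (rcons u i) | i <- iota 1 (nchild (nodes (skel x)) u)].
have cE u : map val (c u) = child_types x u by rewrite -map_comp.
transitivity ((\big[*%R/1]_(u \in restr h.-1 (nodes (skel x)))
    wt (size u) (ttype x u) (map val (c u)))%:E); last first.
  by rewrite mul1r; congr EFin; apply: eq_fsbigr => u _; rewrite cE.
rewrite -kids_joint; last exact: (finite_restr _ tx).
congr (U01 _); apply/seteqP; split => om.
  move=> /(tcyl_sprout _ nh tx hx)[_ H] u xu; apply: (inj_map val_inj).
  by rewrite cE -H.
move=> H; apply/(tcyl_sprout _ nh tx hx); split=> // u xu.
by rewrite H// cE.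
Qed.

End random_sprout.


(** * The multi-type tree *)

(** Types are conserved from a node to its children, so that the types at
    depth [d] below a node determine its own type as their sum. *)
Fixpoint hat (A : set (seq nat)) (s : seq nat -> nat) d u : nat :=
  if d is d'.+1 then (\sum_(i <- iota 1 (nchild A u)) hat A s d' (rcons u i))%N else s u.

Lemma hat_total A s r d j : (j <= d)%N ->
  (\sum_(u <- gen A r j) hat A s (d - j) u = \sum_(v <- gen A r d) s v)%N.
Proof.
move=> /subnK <-; rewrite addnK; move: (d - j)%N => k; elim: k j => [//|k IH] j.
by rewrite addSnnS -IH big_genS.
Qed.

Lemma hat_le A s r d j u : (j <= d)%N -> u \in gen A r j ->
  (hat A s (d - j) u <= \sum_(v <- gen A r d) s v)%N.
Proof. by move=> jd ug; rewrite -(@hat_total A s r d j jd) (big_rem _ ug) /= leq_addr. Qed.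

Section types_law.
Variables (R : realType) (p : nat) (qb : nat -> R) (mub : R) (W : nat -> nat -> R).
Hypotheses (qb0 : forall k, 0 <= qb k) (mub0 : 0 < mub).
Hypotheses (W0 : forall n j, 0 <= W n j) (W_gt0 : forall n j, (j <= p)%N -> 0 < W n j).

Definition Wpoly n : {poly R} := \sum_(i < p.+1) W n i *: 'X^i.

Hypothesis W_step : forall n l, (l <= p)%N ->
  (\sum_(0 <= k <oo) (qb k * ((Wpoly n.+1) ^+ k)`_l)%:E = (mub ^+ l * W n l)%:E)%E.

(** The weight [mt_weight], written with moments instead of derivatives of the
    Laplace transform. *)
Definition typew (n l : nat) (c : seq nat) : R :=
  if sumn c == l then
    qb (size c) * (mub ^+ l)^-1 / W n l * \prod_(j <- c) W n.+1 j
  else 0.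

Lemma typew_ge0 n l c : 0 <= typew n l c.
Proof.
rewrite /typew; case: ifP => // _; rewrite !mulr_ge0 ?invr_ge0 ?exprn_ge0 ?(ltW mub0)//.
by rewrite prodr_ge0.
Qed.

Let codom_bij k : set_bij [set: {ffun 'I_k -> 'I_p.+1}] [set c : seq 'I_p.+1 | size c = k]
  (fun f => [seq f i | i <- enum 'I_k]).
Proof.
split.
- by move=> f _ /=; rewrite size_map size_enum_ord.
- move=> f g _ _ /eq_in_map fg; apply/ffunP => i; apply: fg; exact: mem_enum.
- move=> c /= ck; exists [ffun i : 'I_k => nth ord0 c i] => //.
  apply: (@eq_from_nth _ ord0); rewrite size_map size_enum_ord ?ck// => i ik.
  by rewrite (nth_map (Ordinal ik)) ?size_enum_ord// ffunE nth_enum_ord.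
Qed.

(** The weights sum to [1] by the functional equation of the moments, the sum
    over the types of [k] children being a coefficient of a [k]-th power. *)
Lemma typew_sum n (l : 'I_p.+1) :
  (\esum_(c in [set: seq 'I_p.+1]) (typew n l (map val c))%:E = 1)%E.
Proof.
have lp : (l <= p)%N by rewrite -ltnS.
have w1 := W_gt0 n lp.
have -> : [set: seq 'I_p.+1] = \bigcup_(k in [set: nat]) [set c : seq 'I_p.+1 | size c = k].
  by apply/seteqP; split => c // _; exists (size c).
rewrite esum_bigcupT; last 2 first.
- by move=> i j _ _ [c [/= <- <-]].
- by move=> c; rewrite lee_fin typew_ge0.
rewrite (eq_esum (b := fun k => ((mub ^+ l * W n l)^-1 * (qb k * ((Wpoly n.+1) ^+ k)`_l))%:E)); last first.
  move=> k _; rewrite (@reindex_esum R _ _ setT _ (fun f : {ffun 'I_k -> 'I_p.+1} => [seq f i | i <- enum 'I_k]) _ (codom_bij k)).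
  rewrite esum_fset; [|exact: finite_finset|by move=> f _; rewrite lee_fin typew_ge0].
  rewrite (@fsbigTE _ _ _ _ [fset f | f in {ffun 'I_k -> 'I_p.+1}]%fset); last first.
    by move=> f; rewrite !inE.
  rewrite sumEFin; congr EFin.
  rewrite (perm_big (enum {ffun 'I_k -> 'I_p.+1})) /=; last first.
    apply: uniq_perm; rewrite ?fset_uniq ?enum_uniq// => f.
    by rewrite !inE mem_enum.
  rewrite big_enum /= (@coef_sum_exp R (W n.+1) p.+1 xpredT) big_distrr big_distrr /= [RHS]big_mkcond /=.
  apply: eq_bigr => f _; rewrite /typew.
  have -> : [forall r : 'I_k, xpredT (f r)] by apply/forallP.
  have -> : sumn [seq \val i | i <- [seq f i | i <- enum 'I_k]] = (\sum_i f i)%N.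
    by rewrite sumnE 2!big_map big_enum.
  rewrite /=; case: eqP => // _; rewrite 2!size_map size_enum_ord 2!big_map big_enum /=.
  by rewrite invfM; ring.
rewrite (_ : [set: nat] = [set x | xpredT x]); last by apply/seteqP; split.
have T0 k : 0 <= ((Wpoly n.+1) ^+ k)`_l.
  rewrite (@coef_sum_exp R (W n.+1) p.+1 xpredT); apply: sumr_ge0 => c _.
  by apply: prodr_ge0.
have m0 : 0 <= (mub ^+ l * W n l)^-1 by rewrite invr_ge0 mulr_ge0// exprn_ge0// ltW.
rewrite -(nneseries_esum (a := fun k => ((mub ^+ l * W n l)^-1 * (qb k * ((Wpoly n.+1) ^+ k)`_l))%:E)); last first.
  by move=> k _; rewrite lee_fin !mulr_ge0.
under eq_eseriesr do rewrite EFinM.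
rewrite nneseriesZl; last by move=> k _; rewrite lee_fin mulr_ge0.
by rewrite W_step// -EFinM mulVf// mulf_neq0 ?expf_neq0 ?gt_eqF.
Qed.

Variable n0 : nat.

Local Notation Om := (measurableTypeR R).
Local Notation U01 := (uniform_prob (@ltr01 R)).
Local Notation kids := (@kids R p typew).
Local Notation spr om := (@sprout p n0 (kids om)).

(** Violating choices have weight 0, and there are countably many of them. *)
Lemma kids_conserve : {ae U01, forall om, forall (u : seq nat) (l : 'I_p.+1),
  sumn (map val (kids om u l)) = l}.
Proof.
have null (u : seq nat) (l : 'I_p.+1) (c : seq 'I_p.+1) : sumn (map val c) <> l ->
    {ae U01, forall om, kids om u l <> c}.
  move=> nc; exists [set om | kids om u l = c]; split.
  - exact: (@measurable_kids R p typew typew_ge0 u l [set c]).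
  - have := @kids_joint R p typew typew_ge0 typew_sum [set u] (fun=> l) (fun=> c) (finite_set1 u).
    have z : typew (size u) l (map val c) = 0 by rewrite /typew; case: eqP.
    rewrite fsbig_set1 z => E; rewrite -[RHS]E; congr (U01 _).
    by apply/seteqP; split => om /= H; [move=> v ->|exact: H].
  - by move=> om /contrapT.
have : {ae U01, forall om, forall i : nat, if @choice.unpickle (seq nat * 'I_p.+1 * seq 'I_p.+1)%type i is Some (u, l, c)
    then sumn (map val c) <> l -> kids om u l <> c else True}.
  apply: ae_foralln => i; case: (choice.unpickle i) => [[[u l] c]|]; last exact: aeW.
  case: (pselect (sumn (map val c) = l)) => [E|E]; first by apply: aeW => om.
  by apply: filterS (null u l c E) => om.
apply: filterS => om H u l; apply: contrapT => E.
by have := H (choice.pickle (u, l, kids om u l)); rewrite choice.pickleK => /(_ E).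
Qed.

Section cylinder.
Variables (A : set (seq nat)) (d : nat).
Hypotheses (tA : is_tree (ones n0) A) (hA : height_le (n0 + d) A).

Let so : size (ones n0) = n0. Proof. by rewrite size_nseq. Qed.

Local Notation g := (gen A (ones n0) d).

(** On the nodes of [A], the only types which are conserved from parent to
    children and equal [s] at depth [d]. *)
Definition typed_of (s : seq nat -> nat) : typed_tree p :=
  TypedTree (Tree (ex_intro (fun u => is_tree u _) _ tA)) (fun u => inord (hat A s (n0 + d - size u) u)).

Let typeE s j u : (\sum_(v <- g) s v)%N = p -> (j <= d)%N -> u \in gen A (ones n0) j ->
  ttype (typed_of s) u = hat A s (d - j) u :> nat.
Proof.
move=> sp jd ug; have := size_gen ug; rewrite so => su.
rewrite /= su subnDl inordK// ltnS -sp; exact: hat_le ug.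
Qed.

Let child_typesE s j u : (\sum_(v <- g) s v)%N = p -> (j < d)%N -> u \in gen A (ones n0) j ->
  child_types (typed_of s) u = [seq hat A s (d - j.+1) (rcons u i) | i <- iota 1 (nchild A u)].
Proof.
move=> sp jd ug; apply/eq_in_map => i ik; apply: (typeE sp) => //.
by rewrite genS; apply/flattenP; exists (children A u); [exact: map_f|rewrite /children map_f].
Qed.

Let gen_prod s j := \prod_(u <- gen A (ones n0) j) W (n0 + j) (hat A s (d - j) u).

Let gen_prod_neq0 s j : (\sum_(v <- g) s v)%N = p -> (j <= d)%N -> gen_prod s j != 0.
Proof.
move=> sp jd; rewrite /gen_prod prodf_seq_neq0; apply/allP => u ug; rewrite gt_eqF// W_gt0//.
by rewrite -sp; exact: hat_le.
Qed.

(* The moments of the children in one generation are those of the parents in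
   the next one. *)
Let typew_gen s j : (\sum_(v <- g) s v)%N = p -> (j < d)%N ->
  \prod_(u <- gen A (ones n0) j) typew (size u) (ttype (typed_of s) u) (child_types (typed_of s) u) =
  (\prod_(u <- gen A (ones n0) j) qb (nchild A u)) * (mub ^+ p)^-1 * (gen_prod s j.+1 / gen_prod s j).
Proof.
move=> sp jd; have jd' := ltnW jd.
have dj : (d - j)%N = (d - j.+1).+1 by rewrite subnSK.
have E u : u \in gen A (ones n0) j ->
    typew (size u) (ttype (typed_of s) u) (child_types (typed_of s) u) =
    (qb (nchild A u) * (mub ^+ hat A s (d - j) u)^-1) * ((W (n0 + j) (hat A s (d - j) u))^-1 *
      \prod_(i <- iota 1 (nchild A u)) W (n0 + j.+1) (hat A s (d - j.+1) (rcons u i))).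
  move=> ug; rewrite (child_typesE sp jd ug) (typeE sp jd' ug) /typew.
  have -> : sumn [seq hat A s (d - j.+1) (rcons u i) | i <- iota 1 (nchild A u)] = hat A s (d - j) u.
    by rewrite dj sumnE big_map.
  by rewrite eqxx size_map size_iota big_map (size_gen ug) so addnS !mulrA.
rewrite (eq_big_seq _ E) !big_split /= -!mulrA; congr (_ * _).
rewrite [X in _ * (X * _)]prodfV -/(gen_prod s j) [X in _ = _ * X]mulrC; congr (_ * _).
  by rewrite prodfV prodrXr hat_total// sp.
by rewrite /gen_prod big_genS.
Qed.

(** The factors [W] telescope along the generations, leaving those of the last
    generation and of the root, and each generation contributes [mub ^- p]
    since its types add up to [p]. *)
Lemma typed_of_law s : (\sum_(v <- g) s v)%N = p -> (0 < d)%N ->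
  (typed_law p n0 typew_ge0 (tcyl (n0 + d) (typed_of s)) =
   (gwp qb A (ones n0) d * (mub ^+ (p * d))^-1 / W n0 p * \prod_(v <- g) W (n0 + d) (s v))%:E)%E.
Proof.
move=> sp d0.
have rootE : hat A s d (ones n0) = p.
  by have := hat_total A s (ones n0) (leq0n d); rewrite subn0 /= big_seq1 sp.
have nd : (n0 < n0 + d)%N by rewrite -{1}(addn0 n0) ltn_add2l.
rewrite (typed_lawE typew_ge0 typew_sum nd (x := typed_of s) tA hA); congr EFin.
have -> : ttype (typed_of s) (ones n0) == p :> nat.
  by rewrite (@typeE s 0 (ones n0) sp)// ?subn0 ?rootE//= inE.
rewrite mul1r.
have -> : ((n0 + d).-1 = size (ones n0) + d.-1)%N by rewrite so -subn1 -addnBA// subn1.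
rewrite fsbig_restr// prednK//.
have step k : (k <= d)%N -> \prod_(0 <= j < k) \prod_(u <- gen A (ones n0) j)
      typew (size u) (ttype (typed_of s) u) (child_types (typed_of s) u) =
    gwp qb A (ones n0) k * (mub ^+ (p * k))^-1 * (gen_prod s k / gen_prod s 0).
  elim: k => [|k IH] kd.
    by rewrite big_nil /gwp big_nil muln0 expr0 invr1 !mul1r divff// gen_prod_neq0.
  rewrite big_nat_recr//= IH ?(ltnW kd)// typew_gen// gwpS mulnS exprD invfM.
  by have := @gen_prod_neq0 s k sp (ltnW kd) => n1; field; rewrite n1 gen_prod_neq0// !expf_neq0// gt_eqF.
rewrite step// /gen_prod /= big_seq1 addn0 subn0 rootE subnn /=.
by rewrite -!mulrA; congr (_ * (_ * _)); rewrite mulrC.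
Qed.

(** Almost surely types are conserved, hence determined by those of generation
    [n0 + d]. Forgetting the types sums [typed_of_law] over the compositions
    of [p] indexed by that generation, which is a coefficient of a power. *)
Lemma skel_cyl_law :
  (skel_law p n0 typew_ge0 (cyl (n0 + d) A) =
   (gwp qb A (ones n0) d * (mub ^+ (p * d))^-1 / W n0 p * ((Wpoly (n0 + d)) ^+ size g)`_p)%:E)%E.
Proof.
have root B : is_tree (ones n0) B -> restr n0 B = [set ones n0].
  move=> tB; apply/seteqP; split => u /=.
    move=> [Bu un]; apply: (size_root_eq tB Bu); apply/eqP; rewrite eqn_leq so un /= leqNgt.
    by apply/negP => nu; case: tB => _ _ /(_ u); rewrite so => /(_ nu).
  by move=> ->; split; [case: tB|rewrite so].
have [d0|d0] := posnP d.
  have AE : A = [set ones n0] by rewrite -(root A tA) restr_id// -{1}(addn0 n0) -d0.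
  have -> : skel_law p n0 typew_ge0 (cyl (n0 + d) A) = U01 [set: Om].
    congr (U01 _); apply/seteqP; split => om // _; rewrite /cyl /= d0 addn0 AE.
    by apply: root; exact: is_tree_sprout.
  rewrite probability_setT d0 /= muln0 expr0 invr1 addn0 /gwp big_nil !mul1r expr1.
  rewrite /Wpoly coef_sum (bigD1 ord_max)//= coefZ coefXn eqxx mulr1 big1 ?addr0; last first.
    by move=> i ip; rewrite coefZ coefXn; case: eqP => [E|]; rewrite ?mulr0//; move: ip; rewrite -val_eqE /= -E eqxx.
  by rewrite mulVf// gt_eqF// W_gt0.
pose Q := fun c : {ffun 'I_(size g) -> 'I_p.+1} => (\sum_i (c i : nat))%N == p.
pose ev (c : {ffun 'I_(size g) -> 'I_p.+1}) : set Om := [set om | tcyl (n0 + d) (typed_of (cw c)) (spr om)].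
pose E : set Om := [set om | cyl (n0 + d) A (skel (spr om))].
have ug := uniq_gen A (ones n0) d.
have scw c : Q c -> (\sum_(v <- g) cw c v)%N = p.
  by move=> /eqP cp; rewrite (@big_cw _ _ addn _ _ c id ug).
have mev c : measurable (ev c).
  have mt : measurable (tcyl (n0 + d) (typed_of (cw c)) : set (typed_tree p)).
    by apply: sub_sigma_algebra; exists (n0 + d)%N => //; exists (typed_of (cw c)).
  by have := @measurable_sprout R p n0 typew typew_ge0 measurableT _ mt; rewrite setTI.
have mE : measurable E.
  by have := @measurable_skel_sprout R p n0 typew typew_ge0 measurableT _ (measurable_cyl (n0 + d) A); rewrite setTI.
pose E' := \bigcup_(c in [set c | Q c]) ev c.
have mE' : measurable E'.
  by apply: fin_bigcup_measurable => [|c _]; [exact: finite_finset|exact: mev].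
have EE' : U01 E = U01 E'.
  have E'E : E' `<=` E.
    by move=> om [c _]; rewrite /ev /E /cyl /tcyl /= => -[-> _]; exact: restr_id.
  have [N [mN N0 HN]] := kids_conserve.
  apply/eqP; rewrite eq_le; apply/andP; split; last by apply: le_measure; rewrite ?inE.
  apply: (@le_trans _ _ (U01 (E' `|` N))); last first.
    apply: (le_trans (measureU2 U01 mE' mN)); first by rewrite [X in (_ + X <= _)%E](_ : _ = 0%E) ?adde0//; exact: N0.
  apply: le_measure; rewrite ?inE//; first exact: measurableU.
  move=> om Eom; have [|Nom] := pselect (N om); [by right|left].
  have good : forall (u : seq nat) (l : 'I_p.+1), sumn (map val (kids om u l)) = l.
    by apply: contrapT => bad; apply: Nom; apply: HN.
  pose ty u := odflt ord0 (stype n0 (kids om) u).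
  have snode u : A u -> stype n0 (kids om) u = Some (ty u).
    by rewrite /ty; move: Eom; rewrite /E /cyl /= => <- [/= +_]; rewrite /sprout_nodes /=; case: stype.
  pose c : {ffun 'I_(size g) -> 'I_p.+1} := [ffun i : 'I_(size g) => ty (nth [::] g i)].
  have tyE k j u : (j + k)%N = d -> u \in gen A (ones n0) j -> ty u = hat A (cw c) k u :> nat.
    elim: k j u => [|k IH] j u jk ugj.
      rewrite addn0 in jk; rewrite jk in ugj; have ig : (index u g < size g)%N by rewrite index_mem.
      by rewrite /= -{2}(nth_index [::] ugj) (cw_nth c (Ordinal ig) ug) ffunE /= nth_index.
    have Au := mem_gen_in tA ugj; have su := size_gen ugj.
    rewrite /= -(good u (ty u)) -(sprout_child_types (snode u Au)) /child_types sumnE big_map.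
    have -> : nchild (nodes (skel (spr om))) u = nchild A u.
      apply: (@nchild_restr (n0 + d)); first by rewrite Eom restr_id.
      by rewrite su so -jk ltn_add2l -{1}(addn0 j) ltn_add2l.
    apply: eq_big_seq => i ik /=; apply: (IH j.+1); first by rewrite addSnnS.
    by rewrite genS; apply/flattenP; exists (children A u); [exact: map_f|rewrite /children map_f].
  have Qc : Q c.
    have rg : ones n0 \in gen A (ones n0) 0 by rewrite /= inE.
    have := tyE d 0%N (ones n0) (add0n d) rg.
    rewrite /ty stype_root /= => pE; apply/eqP.
    have := hat_total A (cw c) (ones n0) (leq0n d); rewrite subn0 /= big_seq1 => H.
    by apply: etrans (esym pE); rewrite H (@big_cw _ _ addn _ _ c id ug).
  exists c => //; rewrite /ev /tcyl /= (restr_id hA); split=> // u Au.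
  have un := hA Au; have nu : (n0 <= size u)%N.
    by rewrite leqNgt; apply/negP => H; case: tA => _ _ /(_ u); rewrite so => /(_ H).
  have ugj : u \in gen A (ones n0) (size u - n0) by apply/(mem_gen _ _ tA); rewrite so subnKC.
  apply: val_inj; rewrite /= -(tyE (n0 + d - size u)%N (size u - n0)%N u)//; last first.
    by rewrite addnC addnBA// subnK// addKn.
  by rewrite inordK ?ltn_ord.
have -> : skel_law p n0 typew_ge0 (cyl (n0 + d) A) = U01 E by [].
rewrite EE' measure_bigcup_fin//; last first.
  move=> c c' Qc Qc' [om [H1 H2]]; apply/ffunP => i; apply: val_inj => /=.
  have ig : nth [::] g i \in g by rewrite mem_nth.
  have Av : restr (n0 + d) A (nth [::] g i).
    by split; [exact: mem_gen_in tA ig|exact/hA/(mem_gen_in tA ig)].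
  have := H1.2 _ Av; rewrite (H2.2 _ Av) => /(congr1 val).
  rewrite /= -[val (inord _)]/(ttype (typed_of (cw c')) _ : nat) (typeE (scw _ Qc') (leqnn d) ig).
  rewrite -[val (inord _)]/(ttype (typed_of (cw c)) _ : nat) (typeE (scw _ Qc) (leqnn d) ig).
  by rewrite subnn /= !cw_nth.
transitivity (\sum_(c | Q c) (gwp qb A (ones n0) d * (mub ^+ (p * d))^-1 / W n0 p *
    \prod_i W (n0 + d) (c i))%:E)%E.
  apply: eq_bigr => c Qc; have := @typed_of_law (cw c) (scw c Qc) d0.
  rewrite (@big_cw _ _ *%R _ _ c (fun k => W (n0 + d) k) ug) => <-.
  by [].
rewrite sumEFin -big_distrr /= (@coef_sum_exp R (W (n0 + d)) p.+1 xpredT); congr (_ * _)%:E.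
by apply: eq_bigl => c; rewrite /Q; have -> : [forall r, xpredT (c r)] by apply/forallP.
Qed.

End cylinder.

Lemma skel_null d A : ~ is_tree (ones n0) A -> skel_law p n0 typew_ge0 (cyl (n0 + d) A) = 0%E.
Proof.
move=> nA; have -> : skel_law p n0 typew_ge0 (cyl (n0 + d) A) = U01 set0; last by rewrite measure0.
congr (U01 _); apply/seteqP; split => om //; rewrite /cyl /= => E; apply: nA.
rewrite -E; apply: is_tree_restr; first exact: is_tree_sprout.
by rewrite size_nseq leq_addr.
Qed.

End types_law.

(** * The law of the multi-type tree is the changed law *)

Section changed_law.
Variables (R : realType) (q : nat -> R) (kappa : R) (D : nat).
Hypotheses (q_off : is_offspring q) (q_sub : (mean q < 1)%E) (kappa1 : 1 < kappa).
Hypothesis kappa_fix : gfD q 0 kappa = kappa%:E.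
Hypotheses (D1 : (1 <= D)%N) (kappa_fin : (gfD q D kappa < +oo)%E).

Local Notation qb := (tilt q kappa).
Local Notation mub := (fine (gfD q 1 kappa)).

Variables (P : probability tree R) (Y : tree -> R).
Hypotheses (P_GW : is_GW qb 0 P) (mY : measurable_fun [set: tree] Y) (Y0 : forall t, 0 <= Y t).
Hypothesis Y_lim : {ae P, forall t, (zcard m t)%:R / mub ^+ m @[m --> \oo] --> Y t}.

Variables (p : nat) (a : R).
Hypotheses (pD : (p <= D)%N) (a0 : 0 <= a).
Hypothesis nY : (1 <= p)%N -> ~ {ae P, forall t, Y t = 0}.

Local Notation w := (wmom P Y).
Local Notation phi := (laplace P Y).

Let q0 n : 0 <= q n. Proof. by case: q_off. Qed.
Let kp : 0 < kappa. Proof. exact: lt_trans kappa1. Qed.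
Let mub1 : 1 < mub.
Proof. exact: (gfD1_gt1 q_off q_sub kappa1 kappa_fix D1 kappa_fin). Qed.
Let mub0 : 0 < mub. Proof. exact: lt_trans mub1. Qed.
Let qb0 := tilt_ge0 q_off kappa1.
Let b0 n : 0 <= a / mub ^+ n. Proof. by rewrite divr_ge0// exprn_ge0// ltW. Qed.

Let W n j : R := w j (a / mub ^+ n).

Let W0 n j : 0 <= W n j. Proof. exact: w_ge0. Qed.

Let W_gt0 n j : (j <= p)%N -> 0 < W n j.
Proof.
move=> jp; apply: (w_gt0 q_off q_sub kappa1 kappa_fix D1 kappa_fin P_GW mY Y0 Y_lim) => //.
  exact: leq_trans pD.
case: j jp => [|j] jp; [by left|right; apply: nY; exact: leq_trans jp].
Qed.

Let WpolyE n k l : (l <= p)%N -> ((Wpoly p W n) ^+ k)`_l = ((wpoly D P Y (a / mub ^+ n)) ^+ k)`_l.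
Proof.
apply: coefX_eq => j jp; rewrite coef_wpoly; last exact: leq_trans pD.
rewrite /Wpoly coef_sum (bigD1 (Ordinal (jp : (j < p.+1)%N)))//= coefZ coefXn eqxx mulr1 big1 ?addr0//.
move=> i ij; rewrite coefZ coefXn; case: eqP => [E|]; rewrite ?mulr0//.
by move: ij; rewrite -val_eqE /= -E eqxx.
Qed.

Let W_step n l : (l <= p)%N ->
  (\sum_(0 <= k <oo) (qb k * ((Wpoly p W n.+1) ^+ k)`_l)%:E = (mub ^+ l * W n l)%:E)%E.
Proof.
move=> lp; have lD := leq_trans lp pD.
have -> : W n l = w l (mub * (a / mub ^+ n.+1)).
  by rewrite exprS invfM mulrCA [mub * _]mulrA divff ?mul1r// gt_eqF.
rewrite (w_step q_off q_sub kappa1 kappa_fix D1 kappa_fin P_GW mY Y0 Y_lim (b0 n.+1) lD).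
have dW := jdom_wpoly q_off q_sub kappa1 kappa_fix D1 kappa_fin P_GW mY Y0 Y_lim (b0 n.+1).
rewrite jetE//; first last.
- exact: (@jdom_jfin _ D _ _ qb0 (lexx 1) (tilt_bin_fin q_off q_sub kappa1 D1 kappa_fin)).
- by case: dW.
by apply: eq_eseriesr => k _; rewrite WpolyE.
Qed.

Let typew_ge0' := typew_ge0 qb0 mub0 W0.

(** The signs of the derivatives cancel because the types of the children add
    up to the type of the parent. *)
Lemma mt_weightE n l c : (l <= p)%N ->
  mt_weight phi mub a qb n l c = typew qb mub W n l c.
Proof.
move=> lp; rewrite /mt_weight /typew; case: eqP => // cl.
have der j m : (j <= p)%N -> derivn_nneg j phi (a / mub ^+ m) = (-1) ^+ j * j`!%:R * W m j.
  move=> jp; apply: (derivn_laplace q_off q_sub kappa1 kappa_fix D1 kappa_fin P_GW mY Y0 Y_lim) => //.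
  exact: leq_trans pD.
have f0 j : j`!%:R != 0 :> R by rewrite pnatr_eq0 -lt0n fact_gt0.
have -> : \prod_(j <- c) (derivn_nneg j phi (a / mub ^+ n.+1) / j`!%:R) =
    (-1) ^+ l * \prod_(j <- c) W n.+1 j.
  rewrite -cl sumnE -prodrXr -big_split /=; apply: eq_big_seq => j jc.
  rewrite der; last by rewrite (leq_trans _ lp)// -cl sumnE (big_rem _ jc) /= leq_addr.
  by rewrite mulrAC mulfK.
rewrite der//; have wn : W n l != 0 by rewrite gt_eqF// W_gt0.
have s2 : (-1) ^+ l * (-1) ^+ l = 1 :> R by rewrite -expr2 sqrr_sign.
have s0 : (-1) ^+ l != 0 :> R by rewrite expf_neq0// oppr_eq0 oner_neq0.
have m0 : mub ^+ l != 0 by rewrite gt_eqF// exprn_gt0.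
move: (W n l) wn (\prod_(j <- c) _) (mub ^+ l) m0 ((-1) ^+ l) s0 s2 (f0 l) => v v0 x y y0 s s0 s2 fl.
have -> : qb (size c) * y^-1 * (l`!%:R / (s * l`!%:R * v)) * (s * x) = qb (size c) * y^-1 * v^-1 * x.
  by field; rewrite v0 y0 s0 fl.
by [].
Qed.

Variable n0 : nat.

Definition Q_law : probability tree R := skel_law p n0 typew_ge0'.

Lemma is_Qbar_law : is_Qbar phi mub a qb p n0 Q_law.
Proof.
exists (typed_law p n0 typew_ge0'); split; last by move=> A _; exact: skel_lawE.
move=> h x nh tx hx.
rewrite (typed_lawE typew_ge0' (typew_sum qb0 mub0 W0 W_gt0 W_step) nh tx hx).
by congr (_ * _)%:E; apply: eq_fsbigr => u _; rewrite mt_weightE// -ltnS.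
Qed.

(** The exponents of [kappa] telescope: a generation contributes the
    difference between the size of the next one and its own. *)
Lemma gwp_tilt A d : kappa * gwp qb A (ones n0) d = kappa ^+ size (gen A (ones n0) d) * gwp q A (ones n0) d.
Proof.
have kn : kappa != 0 by rewrite gt_eqF.
elim: d => [|d IH]; first by rewrite /gwp !big_nil /= expr1.
rewrite !gwpS mulrA IH size_genS -prodrXr.
have -> : \prod_(u <- gen A (ones n0) d) qb (nchild A u) =
    (\prod_(u <- gen A (ones n0) d) kappa ^+ nchild A u) * (kappa ^+ size (gen A (ones n0) d))^-1 *
    \prod_(u <- gen A (ones n0) d) q (nchild A u).
  rewrite (eq_bigr (fun u => kappa ^+ nchild A u * kappa^-1 * q (nchild A u))); last first.
    by move=> u _; rewrite tiltE.
  rewrite !big_split /=; congr (_ * _ * _).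
  by rewrite big_const_seq count_predT iter_mulr_1 exprVn.
by field; rewrite expf_neq0.
Qed.

Variable P0 : probability tree R.
Hypothesis P0_GW : is_GW q n0 P0.

(** Both sides are computed on the cylinders of height [n], where the density
    is constant; an event of the filtration is a countable disjoint union of
    cylinders. *)
Lemma has_density_law : has_density n0 P0 Q_law (fun n => Mbar phi mub a kappa p n n0).
Proof.
move=> n L nn fL; have mL := filt_measurable fL.
have [d nE] : exists d, n = (n0 + d)%N by exists (n - n0)%N; rewrite subnKC.
subst n.
pose F z : R := (mub ^+ (p * d))^-1 * (kappa ^+ z / kappa) *
  (((wpoly D P Y (a / mub ^+ (n0 + d))) ^+ z)`_p / w p (a / mub ^+ n0)).
have F0 z : 0 <= F z.
  apply: mulr_ge0.
    by rewrite !mulr_ge0 ?invr_ge0 ?exprn_ge0// ltW.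
  by rewrite divr_ge0 ?w_ge0//; apply: pge0X; exact: pge0_wpoly.
have ME t : Mbar phi mub a kappa p (n0 + d) n0 t = F (zcard (n0 + d) t).
  by rewrite (MbarE q_off q_sub kappa1 kappa_fix D1 kappa_fin P_GW mY Y0 Y_lim)// addKn.
have -> : (fun t => Mbar phi mub a kappa p (n0 + d) n0 t * \1_L t) = (fun t => F (zcard (n0 + d) t) * \1_L t).
  by apply/funext => t; rewrite ME.
have mF : measurable_fun [set: tree] (fun t => (F (zcard (n0 + d) t))%:E).
  by apply/measurable_EFinP; exact: measurable_zcard_fun.
rewrite expectation_indicE// (ge0_integral_cylF P0 (n0 + d) mL mF); last by move=> t; rewrite lee_fin.
rewrite -{1}(bigcup_cylF (n0 + d) L) measure_semi_bigcup//=; last 3 first.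
- by move=> i; apply: measurableI => //; exact: measurable_cylF.
- by apply: trivIset_setIl; exact: cylF_trivIset.
- by apply: bigcup_measurable => i _; apply: measurableI => //; exact: measurable_cylF.
apply: eq_eseriesr => i _.
case: (saturated_cylF i (filt_saturated fL)) => ->; first by rewrite measure0 integral_set0.
case: (cylF_cyl (n0 + d) i) => [->|[A ->]]; first by rewrite measure0 integral_set0.
have mA := measurable_cyl (n0 + d) A.
case: (pselect (is_tree (ones n0) A)) => tA; last first.
  rewrite null_set_integral//; last 2 first.
  - exact: measurable_funTS.
  - exact: (cyl_null q_off P0_GW).
  transitivity (Q_law (cyl (n0 + d) A)); first by [].
  exact: (@skel_null _ _ _ _ _ _ _ _ _ _ _ _).
case: (pselect (exists t, cyl (n0 + d) A t)) => [[t0 At0]|noA]; last first.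
  suff -> : cyl (n0 + d) A = set0 by rewrite measure0 integral_set0.
  by rewrite -subset0 => t At; apply: noA; exists t.
have hA : height_le (n0 + d) A by rewrite -At0; exact: height_restr.
have so : size (ones n0) = n0 by rewrite size_nseq.
pose z := size (gen A (ones n0) d).
rewrite (eq_integral (fun=> (F z)%:E)); last first.
  move=> t; rewrite inE => At; suff -> : zcard (n0 + d) t = z by [].
  have tt : is_tree (ones n0) (nodes t) by apply: (@is_tree_of_restr _ (n0 + d)); rewrite At.
  have := zcard_gen d tt; rewrite so => ->; congr size.
  by apply: (@gen_restr (n0 + d)); rewrite ?so// At restr_id.
rewrite integral_cst// [X in (_ = _ * X)%E](_ : _ = (gwp q A (ones n0) d)%:E); last exact: cyl_law.
transitivity (Q_law (cyl (n0 + d) A)); first by [].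
rewrite [LHS](skel_cyl_law qb0 mub0 W0 W_gt0 W_step tA hA).
rewrite -EFinM WpolyE// -/z; congr EFin.
have -> : gwp qb A (ones n0) d = kappa ^+ z / kappa * gwp q A (ones n0) d.
  by rewrite mulrAC -gwp_tilt mulrAC divff ?mul1r// gt_eqF.
by rewrite /F -/(W n0 p); ring.
Qed.

(** The filtrations above [n0] form a pi-system which generates the
    sigma-field of trees. *)
Lemma has_density_unique (Q1 Q2 : probability tree R) (M : nat -> tree -> R) :
  has_density n0 P0 Q1 M -> has_density n0 P0 Q2 M ->
  forall A, measurable A -> Q1 A = Q2 A.
Proof.
move=> H1 H2 A mA; pose G : set (set tree) := \bigcup_(n in [set n | (n0 <= n)%N]) filt n.
apply: (@measure_unique _ R tree G (fun=> setT)) => //.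
- apply/seteqP; split; last first.
    by apply: smallest_sub; [exact: sigma_algebra_measurable|move=> L [n _ /filt_measurable]].
  apply: smallest_sub; first exact: smallest_sigma_algebra.
  move=> _ [n _ [C _ <-]]; apply: sub_sigma_algebra; exists (maxn n n0); first exact: leq_maxr.
  by apply: (@filt_le n); [exact: leq_maxl|apply: sub_sigma_algebra; exists C].
- move=> L1 L2 [n nn f1] [m mm f2]; exists (maxn n m); first by rewrite /= leq_max nn.
  have := @filt_le n (maxn n m) L1 (leq_maxl _ _) f1; have := @filt_le m (maxn n m) L2 (leq_maxr _ _) f2.
  move=> /filtP s2 /filtP s1; apply/filtP => t t' tt' [t1 t2]; split; [exact: s1 tt' t1|exact: s2 tt' t2].
- by move=> _; exists n0 => //=; exact: filtT.
- by rewrite bigcup_const//; exists 0%N.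
- move=> L [n nn fL]; exact: (etrans (H1 n L nn fL) (esym (H2 n L nn fL))).
- by move=> _; rewrite (le_lt_trans (probability_le1 _ _))// ltry.
Qed.

End changed_law.

Theorem theorem5p1 (R : realType) (p : nat) (q : nat -> R) (kappa : R)
    (P : nat -> probability tree R)
    (Pbar : probability tree R) (Wbar : {RV Pbar >-> R})
    (q_offspring : is_offspring q)
    (q_subcritical : (mean q < 1)%E)
    (kappa_unique : unique (fun x : R =>
       [/\ 1 < x, gfD q 0 x = x%:E & (gfD q (maxn p 1) x < +oo)%E]) kappa)
    (P_GW : forall k, is_GW q k (P k))
    (Pbar_GW : is_GW (tilt q kappa) 0 Pbar)
    (Wbar_lim : {ae Pbar, forall t,
       (zcard m t)%:R / fine (gfD q 1 kappa) ^+ m @[m --> \oo] --> Wbar t}) :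
  let mu := fine (mean q) in
  let mubar := fine (gfD q 1 kappa) in
  let phi := laplace Pbar Wbar in
  (* for s = 0 < p both expectations vanish *)
  (forall (n : nat) (L : set tree), filt n L ->
   forall s : R, 0 <= s < kappa -> (p = 0%N \/ 0 < s) ->
     let X m t := Hpoly p (zcard (m + n) t)%:R * s ^+ zcard (m + n) t in
     ('E_(P 0%N)[fun t => (X m t * \1_L t)%R] / 'E_(P 0%N)[X m])%E
       @[m --> \oo] -->
     (if p is 0 then 'E_(P 0%N)[\1_L]
      else 'E_(P 0%N)[fun t => ((zcard n t)%:R / mu ^+ n * \1_L t)%R])%E) /\
  (* for p = 1, Gbar is 0 / 0 when Wbar = 0 almost surely *)
  (forall a : R, 0 <= a ->
   (p = 1%N -> ~ {ae Pbar, forall t, Wbar t = 0}) ->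
   (forall (n : nat) (L : set tree), filt n L ->
     let X m t := Hpoly p (zcard (m + n) t)%:R * kappa ^+ zcard (m + n) t *
                  expR (- (a * (zcard (m + n) t)%:R / mubar ^+ (m + n))) in
     ('E_(P 0%N)[fun t => (X m t * \1_L t)%R] / 'E_(P 0%N)[X m])%E
       @[m --> \oo] -->
     ('E_(P 0%N)[fun t => (Mbar phi mubar a kappa p n 0 t * \1_L t)%R])%E) /\
   (forall n0 : nat, exists Q : probability tree R,
     let M n := Mbar phi mubar a kappa p n n0 in
     [/\ has_density n0 (P n0) Q M,
         (forall Q' : probability tree R, has_density n0 (P n0) Q' M ->
            forall A : set tree, measurable A -> Q' A = Q A) &
         is_Qbar phi mubar a (tilt q kappa) p n0 Q])).
Proof.
case: kappa_unique => -[kappa1 kappa_fix kappa_fin] _ mu mubar phi.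
have D1 : (1 <= maxn p 1)%N by exact: leq_maxr.
have pD : (p <= maxn p 1)%N by exact: leq_maxl.
split.
  move=> n L fL s sk sp; exact: (ratio_limit_below_kappa q_offspring q_subcritical kappa1 kappa_fix (P_GW 0%N) fL sk sp).
have mub1 : 1 < mubar := gfD1_gt1 q_offspring q_subcritical kappa1 kappa_fix D1 kappa_fin.
(* A nonnegative version of the limit, which has the same Laplace transform. *)
pose Y t : R := Num.max (Wbar t) 0.
have Y0 t : 0 <= Y t by rewrite le_max lexx orbT.
have mY : measurable_fun [set: tree] Y by apply: measurable_maxr => //; exact: measurable_funP.
have WY : {ae Pbar, forall t, Wbar t = Y t}.
  apply: filterS Wbar_lim => t Ht; rewrite /Y max_l//.
  apply: (cvgr_to_ge Ht); apply: nearW => m.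
  by rewrite divr_ge0// exprn_ge0// ltW// (lt_trans ltr01).
have Y_lim : {ae Pbar, forall t, (zcard m t)%:R / mubar ^+ m @[m --> \oo] --> Y t}.
  by apply: filterS2 Wbar_lim WY => t + <-.
have phiE : phi = laplace Pbar Y.
  apply/funext => b; apply: ae_eq_rE.
  - by apply: measurableT_comp => //; apply: measurable_funN; exact: measurable_funM.
  - by apply: measurableT_comp => //; apply: measurable_funN; exact: measurable_funM.
  - by apply: filterS WY => t ->.
move=> a a0 nW.
have nY : (1 <= p)%N -> ~ {ae Pbar, forall t, Y t = 0}.
  (* For p = 1 this is the assumption; for p >= 2 the tilted law has a second
     moment. *)
  case: p nW kappa_fin D1 pD => [//|[|p]] nW kf D1 pD _.
    by move=> Yz; apply: (nW erefl); apply: filterS2 WY Yz => t -> .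
  exact: (limit_nondegenerate q_offspring q_subcritical kappa1 kappa_fix D1 kf Pbar_GW mY Y0 Y_lim).
rewrite phiE; split.
  move=> n L fL; exact: (ratio_limit_at_kappa q_offspring q_subcritical kappa1 kappa_fix D1
    kappa_fin Pbar_GW mY Y0 Y_lim (P_GW 0%N) fL a0 pD nY).
move=> n0.
exists (Q_law q_offspring q_subcritical kappa1 kappa_fix D1 kappa_fin Pbar Y0 p a n0).
have dQ := has_density_law q_offspring q_subcritical kappa1 kappa_fix D1 kappa_fin Pbar_GW mY Y0
  Y_lim pD a0 nY (P_GW n0).
split=> //; last exact: is_Qbar_law.
by move=> Q' dQ' A mA; exact: has_density_unique dQ' dQ A mA.
Qed.
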